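(* Let $\mathcal{M}$ be a graded manifold with underlying manifold $M$, let $X,Y$ be vector fields on $\mathcal{M}$ (of arbitrary degrees) with $[X,X]=0$, and let $\theta:\mathcal{D}\to\mathcal{M}$ be the flow of $X$. Then $Y$ is invariant under the flow $\theta$ (that is, $Y\otimes1\sim_\theta Y$) if and only if $[X,Y]=0$.
   Context: Graded manifolds: ''graded'' means $\mathbb{Z}$-graded and all elements are homogeneous. For a sequence $(n_j)_{j\in\mathbb{Z}}$ of non-negative integers with finite sum and $V\subseteq\mathbb{R}^{n_0}$ open, the graded domain $V^{(n_j)}$ is $V$ with the sheaf $\mathcal{C}^\infty_{(n_j)}$ assigning to an open $W\subseteq V$ the graded commutative algebra whose degree $k$ elements are formal power series in variables $\xi^\mu$ of non-zero degrees ($n_j$ of them of degree $j$ for each $j\neq0$; $\xi^\mu\xi^\nu=(-1)^{|\xi^\mu||\xi^\nu|}\xi^\nu\xi^\mu$), of total degree $k$, with coefficients in $C^\infty(W)$. A graded manifold $\mathcal{M}=(M,\mathcal{C}^\infty_{\mathcal{M}})$ is a Hausdorff second countable space $M$ with a sheaf of graded commutative associative unital algebras locally isomorphic (as locally ringed spaces) to graded domains; $M$ is then a smooth manifold. A graded smooth map $\phi=(\underline{\phi},\phi^* ):\mathcal{M}\to\mathcal{N}$ consists of a smooth map $\underline{\phi}:M\to N$ and a morphism of sheaves of graded algebras $\phi^*:\mathcal{C}^\infty_{\mathcal{N}}\to\underline{\phi}_*\mathcal{C}^\infty_{\mathcal{M}}$ inducing local morphisms on stalks. $\mathcal{M}|_U$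 is the restriction to an open $U\subseteq M$. Products are categorical products. A vector field of degree $|X|$ is a degree $|X|$ graded derivation of $\mathcal{C}^\infty_{\mathcal{M}}(M)$; $[X,Y]=X\circ Y-(-1)^{|X||Y|}Y\circ X$. $X\sim_\phi Y$ ($\phi$-related) means $X\circ\phi^*=\phi^*\circ Y$. Flows: a flow domain on the manifold $M$ is an open $D\subseteq M\times\mathbb{R}$ such that each $\{t\mid(m,t)\in D\}$, $m\in M$, is an open interval containing $0$. $\mathbb{R}[-k]$ is the graded manifold with a single global coordinate $\mathbb{t}$ of degree $-k$ (it is $\mathbb{R}$ for $k=0$; its underlying manifold is a point $\{\ast\}$ for $k\ne0$), with addition $+$ given by $+^*(\mathbb{t})=\mathbb{t}_1+\mathbb{t}_2$ and zero $0:\{\ast\}\to\mathbb{R}[-k]$, $0^*(\mathbb{t})=0$. A flow domain of degree $k$ on $\mathcal{M}$ is $\mathcal{D}=(\mathcal{M}\times\mathbb{R})|_D$ with $D$ a flow domain on $M$ if $k=0$, and $\mathcal{D}=\mathcal{M}\times\mathbb{R}[-k]$ if $k\neq0$. A flow of degree $k$ on $\mathcal{M}$ is a graded smooth map $\theta:\mathcal{D}\to\mathcal{M}$, $\mathcal{D}$ a flow domain of degree $k$, such that $\theta\circ(1_{\mathcal{M}},0_{\mathcal{M}})=1_{\mathcal{M}}$ (with $0_{\mathcal{M}}$ the composite $\mathcal{M}\to\{\ast\}\xrightarrow{0}\mathbb{R}[-k]$) and $\theta\circ(\theta\times1_{\mathbb{R}[-k]})=\theta\circ(1_{\mathcal{M}}\times+)\circ\mathsf{a}$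 on $\mathcal{D}^\bullet$, where $\mathsf{a}$ is the associator, $\mathcal{D}^\bullet=(\mathcal{M}\times\mathbb{R}[-k])\times\mathbb{R}[-k]$ for $k\ne0$, and for $k=0$, $\mathcal{D}^\bullet$ is the restriction of $(\mathcal{M}\times\mathbb{R})\times\mathbb{R}$ to the open set of all $((m,s),t)$ with $(m,s)\in D$, $(\underline{\theta}(m,s),t)\in D$ and $(m,s+t)\in D$. The infinitesimal generator of $\theta$ is the unique degree $k$ vector field $X$ with $1\otimes\partial_{\mathbb{t}}\sim_\theta X$, where $1\otimes\partial_{\mathbb{t}}$ is the lift to $\mathcal{D}$ of the coordinate vector field on $\mathbb{R}[-k]$. Every vector field $X$ of degree $k$ with $[X,X]=0$ (automatic for $k$ even) is the infinitesimal generator of a unique maximal flow of degree $k$ (every other flow with generator $X$ is a restriction of it); it is called the flow of $X$. For $k=0$ its underlying map is the maximal ordinary flow of the underlying vector field $X_0$ on $M$ (defined by $\underline{X(f)}=X_0(\underline f)$, $\underline f$ being the body of $f$). Lift: $Y\otimes1$ denotes the canonical lift of $Y$ to $\mathcal{M}\times\mathbb{R}[-k]$ ($k=|X|$), i.e. the unique vector field $p_1$-related to $Y$ and $p_2$-related to $0$ ($p_1,p_2$ the projections), restricted to $\mathcal{D}$. *)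

(* Defs.v *)
From HB Require Import structures.
From mathcomp Require Import all_boot all_order all_algebra.
From mathcomp Require Import all_classical all_reals all_analysis.

Set Implicit Arguments.
Unset Strict Implicit.
Unset Printing Implicit Defensive.

Import Order.TTheory GRing.Theory Num.Theory numFieldNormedType.Exports.

Local Open Scope classical_set_scope.
Local Open Scope ring_scope.

Record opens (T : topologicalType) := Opens {
  oset :> set T;
  oopen : open oset }.

Definition opensT (T : topologicalType) : opens T := Opens (@openT T).

Section GradedSpace.
Variable R : realType.

Definition gsign (i j : int) : R := (-1) ^+ absz (i * j).

(* A topological space with a presheaf of Z-graded algebras.  Since degrees   *)
(* only agree up to provable equality, the product of sections of degrees i   *)
(* and j lands in any degree k that comes with a proof of i + j = k.          *)
Record gspace := GSpace {
  gcarrier :> topologicalType;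
  sect : opens gcarrier -> int -> lmodType R;
  gres : forall U V : opens gcarrier, V `<=` U ->
    forall k, sect U k -> sect V k;
  gone : forall U, sect U (0 : int);
  gmul : forall U (i j k : int), i + j = k -> sect U i -> sect U j -> sect U k;
  gres_linear : forall (U V : opens gcarrier) (s : V `<=` U) k, linear (@gres U V s k);
  gres_id : forall (U : opens gcarrier) (s : U `<=` U) k (f : sect U k), gres s f = f;
  gres_gres : forall (U V W : opens gcarrier) (s : V `<=` U) (s' : W `<=` V) (s'' : W `<=` U)
    k (f : sect U k), gres s' (gres s f) = gres s'' f;
  gres_one : forall (U V : opens gcarrier) (s : V `<=` U), gres s (gone U) = gone V;
  gres_mul : forall (U V : opens gcarrier) (s : V `<=` U) (i j k : int) (e : i + j = k)
    (f : sect U i) (g : sect U j),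
    gres s (gmul e f g) = gmul e (gres s f) (gres s g) }.

Record graded_commutative_algebras (M : gspace) : Prop := {
  gmul_linearr : forall (U : opens M) i j k (e : i + j = k) (f : sect U i),
    linear (fun g : sect U j => gmul e f g);
  gmul_linearl : forall (U : opens M) i j k (e : i + j = k) (g : sect U j),
    linear (fun f : sect U i => gmul e f g);
  gmulA : forall (U : opens M) i j k ij jk n (eij : i + j = ij)
    (ejk : j + k = jk) (e : i + jk = n) (e' : ij + k = n)
    (f : sect U i) (g : sect U j) (h : sect U k),
    gmul e f (gmul ejk g h) = gmul e' (gmul eij f g) h;
  gmul1 : forall (U : opens M) k (e : 0 + k = k) (f : sect U k),
    gmul e (gone U) f = f;
  gmulC : forall (U : opens M) i j k (e : i + j = k) (e' : j + i = k)
    (f : sect U i) (g : sect U j),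
    gmul e f g = gsign i j *: gmul e' g f }.

Definition is_sheaf (M : gspace) : Prop :=
  forall (U : opens M) (I : Type) (V : I -> opens M) (s : forall i, V i `<=` U),
    U `<=` \bigcup_i V i ->
    forall k (f : forall i, sect (V i) k),
    (forall i j (W : opens M) (si : W `<=` V i) (sj : W `<=` V j),
       gres si (f i) = gres sj (f j)) ->
    exists! g : sect U k, forall i, gres (s i) g = f i.

(* The germ of f at x is invertible. *)
Definition gunit_at (M : gspace) (U : opens M) k (f : sect U k) (x : M) :=
  exists (W : opens M) (s : W `<=` U) (g : sect W (- k)),
    oset W x /\ gmul (subrr k) (gres s f) g = gone W.

Definition preimage_opens (T S : topologicalType) (f : T -> S)
    (cf : forall V, open V -> open (f @^-1` V)) (V : opens S) : opens T :=
  Opens (cf V (oopen V)).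

(* Locality of the maps induced on stalks is the reflection of invertible     *)
(* germs.  Between graded manifolds it forces the underlying map to be smooth *)
(* and the body of gpull f to be the body of f composed with that map.        *)
Record gmap (M N : gspace) := GMap {
  gfun :> M -> N;
  gfun_continuous : forall V, open V -> open (gfun @^-1` V);
  gpull : forall (V : opens N) k,
    sect V k -> sect (preimage_opens gfun_continuous V) k;
  gpull_linear : forall (V : opens N) k, linear (@gpull V k);
  gpull_one : forall V : opens N, gpull (gone V) = gone _;
  gpull_mul : forall (V : opens N) i j k (e : i + j = k)
    (f : sect V i) (g : sect V j),
    gpull (gmul e f g) = gmul e (gpull f) (gpull g);
  gpull_res : forall (V W : opens N) (s : W `<=` V)
    (s' : preimage_opens gfun_continuous W `<=`
          preimage_opens gfun_continuous V) k (f : sect V k),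
    gpull (gres s f) = gres s' (gpull f);
  gpull_local : forall (V : opens N) k (f : sect V k) (x : M),
    oset V (gfun x) -> gunit_at (gpull f) x -> gunit_at f (gfun x) }.

Definition gmap_eq (M N : gspace) (phi psi : gmap M N) : Prop :=
  phi =1 psi /\
  forall (V : opens N) k (f : sect V k) (W : opens M)
    (s : W `<=` preimage_opens (gfun_continuous phi) V)
    (s' : W `<=` preimage_opens (gfun_continuous psi) V),
    gres s (gpull phi f) = gres s' (gpull psi f).

Section Identity.
Variable M : gspace.

Let gid_continuous (V : set M) : open V -> open (id @^-1` V).
Proof. by []. Defined.

Let gid_sub (V : opens M) : preimage_opens gid_continuous V `<=` V.
Proof. by []. Qed.

Definition gid : gmap M M.
Proof.
refine (@GMap M M id gid_continuous (fun V k f => gres (@gid_sub V) f) _ _ _ _ _).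
- by move=> V k; exact: gres_linear.
- by move=> V; exact: gres_one.
- by move=> V i j k e f g; exact: gres_mul.
- move=> V W s s' k f.
  have s'' : preimage_opens gid_continuous W `<=` V by move=> x /s.
  by rewrite !(gres_gres _ _ s'').
- move=> V k f x Vx [W [s [g [Wx e]]]]; exists W.
  have s' : W `<=` V by move=> y /s.
  by exists s', g; split=> //; rewrite -e (gres_gres _ _ s').
Defined.

End Identity.

Section Composition.
Variables (M N Q : gspace) (psi : gmap N Q) (phi : gmap M N).

Let gcomp_continuous (V : set Q) (oV : open V) : open ((psi \o phi) @^-1` V) :=
  gfun_continuous phi (gfun_continuous psi oV).

Definition gcomp : gmap M Q.
Proof.
refine (@GMap M Q (psi \o phi) gcomp_continuous
  (fun V k f => gpull phi (gpull psi f)) _ _ _ _ _).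
- by move=> V k a f g; rewrite (gpull_linear psi) (gpull_linear phi).
- by move=> V; rewrite gpull_one gpull_one.
- by move=> V i j k e f g; rewrite gpull_mul gpull_mul.
- move=> V W s s' k f.
  have s'' : preimage_opens (gfun_continuous psi) W `<=`
             preimage_opens (gfun_continuous psi) V by move=> x /s.
  by rewrite (gpull_res s s'') (gpull_res s'' s').
- move=> V k f x Vx u; apply: gpull_local => //.
  exact: (gpull_local (V := preimage_opens (gfun_continuous psi) V)).
Defined.

End Composition.

Definition giso (M N : gspace) : Prop :=
  exists (phi : gmap M N) (psi : gmap N M),
    gmap_eq (gcomp psi phi) (gid M) /\ gmap_eq (gcomp phi psi) (gid N).

Section Restriction.
Variables (M : gspace) (U : opens M).

Let carrier : topologicalType := set_type (oset U).

Lemma open_set_val (W : set carrier) : open W -> open (set_val @` W : set M).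
Proof.
move=> [A oA AW]; have -> : set_val @` W = A `&` U.
  apply/seteqP; split=> [_ [x Wx <-]|x [Ax Ux]].
    by split; [move: Wx; rewrite -AW | exact: set_valP].
  exists (SigSub (mem_set Ux) : carrier) => //.
  by rewrite -AW.
exact: openI oA (oopen U).
Qed.

Definition image_opens (W : opens carrier) : opens M :=
  Opens (open_set_val (oopen W)).

Lemma image_opensS (V W : opens carrier) :
  W `<=` V -> image_opens W `<=` image_opens V.
Proof. exact: image_subset. Qed.

Definition grestrict : gspace.
Proof.
refine (@GSpace carrier (fun W k => sect (image_opens W) k)
  (fun V W s k f => gres (image_opensS s) f) (fun W => gone _)
  (fun W i j k e f g => gmul e f g) _ _ _ _ _).
- by move=> V W s k; exact: gres_linear.
- by move=> V s k f; exact: gres_id.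
- by move=> V W W' s s' s'' k f; exact: gres_gres.
- by move=> V W s; exact: gres_one.
- by move=> V W s i j k e f g; exact: gres_mul.
Defined.

Let incl_continuous (V : set M) :
  open V -> open ((set_val : grestrict -> M) @^-1` V).
Proof. by move=> oV; exists V. Qed.

Let incl_sub (V : opens M) :
  image_opens (preimage_opens incl_continuous V) `<=` V.
Proof. by move=> _ [x Vx <-]. Qed.

Definition gincl : gmap grestrict M.
Proof.
refine (@GMap grestrict M set_val incl_continuous
  (fun V k f => gres (@incl_sub V) f) _ _ _ _ _).
- by move=> V k; exact: gres_linear.
- by move=> V; exact: (gres_one (@incl_sub V)).
- by move=> V i j k e f g; exact: (gres_mul (@incl_sub V)).
- move=> V W s s' k f /=.
  have s'' : image_opens (preimage_opens incl_continuous W) `<=` V.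
    by move=> x /incl_sub /s.
  by rewrite !(gres_gres _ _ s'').
- move=> V k f x Vx [W [s [g [Wx e]]]].
  have s' : image_opens W `<=` V by move=> _ [y /s Vy <-].
  exists (image_opens W), s', g; split; first by exists x.
  by move: e => /= <-; rewrite (gres_gres _ _ s').
Defined.

End Restriction.

End GradedSpace.

Section Smooth.
Variables (R : realType) (n : nat).

(* Meant for open W; iterated partial derivatives are continuous on W. *)
Fixpoint class_C (r : nat) (W : set 'rV[R]_n) (f : 'rV[R]_n -> R) : Prop :=
  (forall x, W x -> {for x, continuous f}) /\
  if r is r'.+1 then
    forall i : 'I_n, (forall x, W x -> derivable f x (delta_mx 0 i)) /\
      class_C r' W (fun x => 'D_(delta_mx 0 i) f x)
  else True.

Definition smooth_on (W : set 'rV[R]_n) (f : 'rV[R]_n -> R) : Prop :=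
  forall r, class_C r W f.

Lemma class_CS (r : nat) (W W' : set 'rV[R]_n) f :
  W' `<=` W -> class_C r W f -> class_C r W' f.
Proof.
move=> s; elim: r f => [|r IH] f [cf df]; split=> //; first by move=> x /s /cf.
  by move=> x /s /cf.
by move=> i; have [d c] := df i; split; [move=> x /s /d | exact: IH].
Qed.

Lemma class_C_pred (r : nat) (W : set 'rV[R]_n) f :
  class_C r.+1 W f -> class_C r W f.
Proof.
elim: r f => [|r IH] f [cf df]; split=> // i.
by have [d c] := df i; split=> //; exact: IH.
Qed.

Lemma eq_class_C (r : nat) (W : set 'rV[R]_n) f g :
  open W -> (forall x, W x -> f x = g x) -> class_C r W f -> class_C r W g.
Proof.
move=> oW; have fgn (h k : 'rV[R]_n -> R) : (forall x, W x -> h x = k x) ->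
    forall x, W x -> {near x, h =1 k}.
  by move=> hk x Wx; apply: filterS (open_nbhs_nbhs (conj oW Wx)) => y /hk.
have cg (h k : 'rV[R]_n -> R) : (forall x, W x -> h x = k x) ->
    (forall x, W x -> {for x, continuous h}) ->
    forall x, W x -> {for x, continuous k}.
  move=> hk ch x Wx; have := ch x Wx.
  rewrite /prop_for /continuous_at hk //; apply: cvg_trans.
  exact: (@near_eq_cvg _ _ (nbhs x) _ _ _ (fgn _ _ hk x Wx)).
elim: r f g => [|r IH] f g fg [cf df]; split=> //; try exact: cg fg cf.
move=> i; have [d c] := df i; split.
  by move=> x Wx; apply: near_eq_derivable (d x Wx); exact: fgn.
by apply: IH c => x Wx; apply: near_eq_derive; exact: fgn.
Qed.

Lemma class_C_cst (r : nat) (W : set 'rV[R]_n) (a : R) :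
  class_C r W (fun=> a).
Proof.
elim: r a => [|r IH] a; (split=> [x _|]; first exact: cst_continuous) => // i.
split; first by move=> x _; exact: derivable_cst.
have -> : (fun x : 'rV[R]_n => 'D_(delta_mx 0 i) (fun=> a) x) = (fun=> 0 : R).
  by rewrite funeqE => x; exact: derive_cst.
exact: IH.
Qed.

Lemma class_CD (r : nat) (W : set 'rV[R]_n) f g : open W ->
  class_C r W f -> class_C r W g -> class_C r W (fun x => f x + g x).
Proof.
move=> oW; elim: r f g => [|r IH] f g [cf df] [cg dg].
all: split=> [x Wx|//]; first exact: (continuousD (cf x Wx) (cg x Wx)).
move=> i; have [dfi cfi] := df i; have [dgi cgi] := dg i; split.
  by move=> x Wx; exact: derivableD (dfi x Wx) (dgi x Wx).
apply: eq_class_C (IH _ _ cfi cgi) => // x Wx.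
exact: esym (deriveD (dfi x Wx) (dgi x Wx)).
Qed.

Lemma class_CM (r : nat) (W : set 'rV[R]_n) f g : open W ->
  class_C r W f -> class_C r W g -> class_C r W (fun x => f x * g x).
Proof.
move=> oW; elim: r f g => [|r IH] f g Cf Cg.
  by have [[cf _] [cg _]] := (Cf, Cg); split=> // x Wx;
     exact: (continuousM (cf x Wx) (cg x Wx)).
have [[cf df] [cg dg]] := (Cf, Cg).
split=> [x Wx|i]; first exact: (continuousM (cf x Wx) (cg x Wx)).
have [dfi cfi] := df i; have [dgi cgi] := dg i; split.
  by move=> x Wx; exact: derivableM (dfi x Wx) (dgi x Wx).
apply: (@eq_class_C _ _ (fun x => f x * 'D_(delta_mx 0 i) g x +
                                  g x * 'D_(delta_mx 0 i) f x)) => //.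
  by move=> x Wx; exact: esym (deriveM (dfi x Wx) (dgi x Wx)).
by apply: class_CD => //; apply: IH => //; exact: class_C_pred.
Qed.

Lemma smooth_onS (W W' : set 'rV[R]_n) f :
  W' `<=` W -> smooth_on W f -> smooth_on W' f.
Proof. by move=> s sf r; exact: class_CS s (sf r). Qed.

Lemma eq_smooth_on (W : set 'rV[R]_n) f g :
  open W -> (forall x, W x -> f x = g x) -> smooth_on W f -> smooth_on W g.
Proof. by move=> oW fg sf r; exact: eq_class_C fg (sf r). Qed.

Lemma smooth_on_cst (W : set 'rV[R]_n) (a : R) : smooth_on W (fun=> a).
Proof. by move=> r; exact: class_C_cst. Qed.

Lemma smooth_onD (W : set 'rV[R]_n) f g : open W ->
  smooth_on W f -> smooth_on W g -> smooth_on W (fun x => f x + g x).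
Proof. by move=> oW sf sg r; exact: class_CD. Qed.

Lemma smooth_onM (W : set 'rV[R]_n) f g : open W ->
  smooth_on W f -> smooth_on W g -> smooth_on W (fun x => f x * g x).
Proof. by move=> oW sf sg r; exact: class_CM. Qed.

Lemma smooth_on_sum (W : set 'rV[R]_n) (I : finType) (P : pred I)
    (f : I -> 'rV[R]_n -> R) : open W ->
  (forall i, smooth_on W (f i)) -> smooth_on W (fun x => \sum_(i | P i) f i x).
Proof.
move=> oW sf; elim: (index_enum I) => [|i s IH].
  by under eq_fun do rewrite big_nil; exact: smooth_on_cst.
under eq_fun do rewrite big_cons; case: (P i) => //.
exact: smooth_onD.
Qed.

Lemma smooth_on_coord (W : set 'rV[R]_n) (i : 'I_n) :
  smooth_on W (fun x => x 0 i).
Proof.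
have dx x j : is_derive x (delta_mx 0 j) (fun y : 'rV[R]_n => y 0 i)
                        ((j == i)%:R).
  apply: DeriveDef; first exact/diff_derivable/differentiable_coord.
  rewrite deriveE; last exact: differentiable_coord.
  have @L : {linear 'rV[R]_n -> R}.
  by exists (fun y : 'rV[R]_n => y 0 i); do 2![eexists]; do ?[constructor];
     rewrite ?mxE// => ? *; rewrite ?mxE//; move=> ?; rewrite !mxE.
rewrite (_ : (fun _ => _) = L) // diff_lin; last exact: coord_continuous.
by rewrite /= mxE eqxx eq_sym.
move=> r; elim: r => [|r _]; split=> //; try by move=> x _; exact: coord_continuous.
move=> j; split; first by move=> x _; have [] := dx x j.
have -> : (fun x : 'rV[R]_n => 'D_(delta_mx 0 j) (fun y : 'rV[R]_n => y 0 i) x) =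
          (fun=> (j == i)%:R).
  by rewrite funeqE => x; have [] := dx x j.
exact: class_C_cst.
Qed.
End Smooth.

(* The graded domain R^n with formal coordinates xi_0, ..., xi_{q-1} of       *)
(* degrees d 0, ..., d (q-1); the sequence (n_j) is recovered as n_0 = n and  *)
(* n_j = #|[set mu | d mu == j]| for j <> 0.                                  *)
Section GradedDomain.
Variables (R : realType) (n q : nat) (d : 'I_q -> int).

Definition mono := {ffun 'I_q -> nat}.

Definition mono_deg (a : mono) : int := \sum_i d i *+ a i.

Definition mono_ok (a : mono) : bool := [forall i, odd `|d i|%N ==> (a i <= 1)%N].

(* xi^b xi^c = mono_sign b c xi^(b + c), where xi^a is the product of the     *)
(* xi_i^(a i) in increasing order of i: every xi_i of xi^b moves past every   *)
(* xi_j of xi^c with j < i.                                                   *)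
Definition mono_sign (b c : mono) : R :=
  \prod_(i < q) \prod_(j < q | (j < i)%N) gsign R (d i *+ b i) (d j *+ c j).

Definition series := mono -> 'rV[R]_n -> R^o.

(* Sections over W are represented by coefficients extended by 0 outside W.   *)
Definition is_section (W : opens 'rV[R]_n) (k : int) (f : series) : Prop :=
  (forall a, smooth_on W (f a)) /\
  (forall a x, f a x != 0 -> [/\ oset W x, mono_ok a & mono_deg a = k]).

Definition section_pred W k : {pred series} := fun f => `[< is_section W k f >].

Lemma section_pred_submod W k : submod_closed (section_pred W k).
Proof.
split; first by apply/asboolP; split=> [a|a x]; [exact: smooth_on_cst | rewrite eqxx].
move=> r f g /asboolP[sf nf] /asboolP[sg ng]; apply/asboolP; split=> [a|a x].
  apply: smooth_onD => //; first exact: oopen.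
  by apply: smooth_onM => //; [exact: oopen | exact: smooth_on_cst].
have [f0|/nf //] := eqVneq (f a x) 0; have [g0|/ng //] := eqVneq (g a x) 0.
by rewrite [X in X != 0](_ : _ = r * f a x + g a x) // f0 g0 mulr0 addr0 eqxx.
Qed.

HB.instance Definition _ W k :=
  GRing.isSubmodClosed.Build R series (section_pred W k) (section_pred_submod W k).

Record gdom_sect (W : opens 'rV[R]_n) (k : int) := GDomSect {
  coef :> mono -> 'rV[R]_n -> R^o;
  coefP : coef \in section_pred W k }.

HB.instance Definition _ W k := [isSub for @coef W k].
HB.instance Definition _ W k := [Choice of gdom_sect W k by <:].
HB.instance Definition _ W k := [SubChoice_isSubLmodule of gdom_sect W k by <:].

Definition series_res (W : set 'rV[R]_n) (f : series) : series :=
  fun a x => if x \in W then f a x else 0.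

Definition series_one (W : set 'rV[R]_n) : series :=
  fun a x => if (a == [ffun=> 0%N]) && (x \in W) then 1 else 0.

Definition mono_sub (a b : mono) : mono := [ffun i => (a i - b i)%N].

(* b ranges over the exponents below a, so that xi^a is, up to sign, the      *)
(* product of xi^b and xi^(a - b).                                            *)
Definition series_mul (f g : series) : series := fun a x =>
  if mono_ok a then
    \sum_(b : {ffun 'I_q -> 'I_(\sum_i a i).+1} | [forall i, (b i <= a i)%N])
      let b' : mono := [ffun i => val (b i)] in
      mono_sign b' (mono_sub a b') * (f b' x * g (mono_sub a b') x)
  else 0.

Lemma series_resP (U V : opens 'rV[R]_n) (s : V `<=` U) k (f : gdom_sect U k) :
  series_res V f \in section_pred V k.
Proof.
have /asboolP[sf nf] := coefP f; apply/asboolP; split=> [a|a x].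
  have := smooth_onS s (sf a); apply: eq_smooth_on; first exact: oopen.
  by move=> x Vx; rewrite /series_res mem_set.
rewrite /series_res; case: ifPn => [/set_mem Vx|]; last by rewrite eqxx.
by move=> /nf[].
Qed.

Lemma series_oneP (U : opens 'rV[R]_n) : series_one U \in section_pred U 0.
Proof.
apply/asboolP; split=> [a|a x].
  have := @smooth_on_cst R n U (a == [ffun=> 0%N])%:R.
  apply: eq_smooth_on; first exact: oopen.
  by move=> x Ux; rewrite /series_one mem_set // andbT; case: eqP.
rewrite /series_one; case: ifPn => [/andP[/eqP-> /set_mem Ux] _|]; last by rewrite eqxx.
split=> //; first by apply/forallP => i; rewrite ffunE implybT.
by rewrite /mono_deg big1 // => i _; rewrite ffunE mulr0n.
Qed.

Lemma series_mulP (U : opens 'rV[R]_n) i j k (e : i + j = k)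
    (f : gdom_sect U i) (g : gdom_sect U j) :
  series_mul f g \in section_pred U k.
Proof.
have /asboolP[sf nf] := coefP f; have /asboolP[sg ng] := coefP g.
apply/asboolP; split=> [a|a x]; rewrite /series_mul;
  have [aok|_] := boolP (mono_ok a).
- apply: smooth_on_sum => [|b]; first exact: oopen.
  apply: smooth_onM; [exact: oopen | exact: smooth_on_cst |].
  by apply: smooth_onM => //; exact: oopen.
- exact: smooth_on_cst.
- move=> nz; have /existsP[b /andP[ba]] : [exists b :
      {ffun 'I_q -> 'I_(\sum_i a i).+1}, [forall i, (b i <= a i)%N] &&
      (let b' : mono := [ffun i => val (b i)] in
       f b' x * g (mono_sub a b') x != 0)].
    apply: contraNT nz; rewrite negb_exists => /forallP h.
    rewrite big1 // => b ba; have := h b; rewrite ba /= negbK => /eqP ->.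
    by rewrite mulr0.
  rewrite /= mulf_eq0 negb_or => /andP[/nf[Ux _ db] /ng[_ _ dc]]; split=> //.
  rewrite -e -db -dc /mono_deg -big_split; apply: eq_bigr => l _ /=.
  by rewrite !ffunE -mulrnDr subnKC //; exact: (forallP ba).
- by rewrite eqxx.
Qed.

Definition gdom : gspace R.
Proof.
refine (@GSpace R 'rV[R]_n (fun W k => gdom_sect W k)
  (fun U V s k f => GDomSect (series_resP s f))
  (fun U => GDomSect (series_oneP U))
  (fun U i j k e f g => GDomSect (series_mulP e f g)) _ _ _ _ _).
- move=> U V s k r f g; apply/val_inj/funext => a; apply/funext => x /=.
  rewrite /series_res [RHS](_ : _ = r * series_res V f a x + series_res V g a x) //.
  by rewrite /series_res; case: ifP => // _; rewrite mulr0 addr0.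
- move=> U s k f; apply/val_inj/funext => a; apply/funext => x /=.
  rewrite /series_res; case: ifPn => // /negP Ux.
  have /asboolP[_ nf] := coefP f.
  by apply/esym/eqP/negP => /negP /nf[/mem_set].
- move=> U V W s s' s'' k f; apply/val_inj/funext => a; apply/funext => x /=.
  by rewrite /series_res; case: ifPn => // /set_mem /s' /mem_set ->.
- move=> U V s; apply/val_inj/funext => a; apply/funext => x /=.
  rewrite /series_res /series_one; case: ifPn => [/set_mem/[dup] Vx /s Ux|Vx].
    by rewrite !mem_set.
  by rewrite andbF.
- move=> U V s i j k e f g; apply/val_inj/funext => a; apply/funext => x /=.
  rewrite /series_res /series_mul; case: ifPn => [Vx|Vx].
    by [].
  by case: ifP => // _; rewrite big1 // => b _; rewrite mul0r mulr0.
Defined.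

End GradedDomain.

Section Manifolds.
Variable R : realType.

Definition locally_graded_domain (M : gspace R) : Prop :=
  forall m : M, exists (U : opens M) (n q : nat) (d : 'I_q -> int)
      (V : opens (gdom R n d)),
    [/\ oset U m, (forall i, d i != 0) & giso (grestrict U) (grestrict V)].

Record gmanifold (M : gspace R) : Prop := {
  gmanifold_hausdorff : hausdorff_space M;
  gmanifold_second_countable : @second_countable M;
  gmanifold_algebras : graded_commutative_algebras M;
  gmanifold_sheaf : is_sheaf M;
  gmanifold_local : locally_graded_domain M }.

Record gproduct (M N : gspace R) := GProduct {
  gprod :> gspace R;
  gfst : gmap gprod M;
  gsnd : gmap gprod N;
  gprod_manifold : gmanifold gprod;
  gprod_universal : forall Q, gmanifold Q ->
    forall (f : gmap Q M) (g : gmap Q N), exists h : gmap Q gprod,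
      [/\ gmap_eq (gcomp gfst h) f, gmap_eq (gcomp gsnd h) g &
        forall h' : gmap Q gprod, gmap_eq (gcomp gfst h') f ->
          gmap_eq (gcomp gsnd h') g -> gmap_eq h' h] }.

Section Fields.
Variable M : gspace R.

Definition graded_endo (d : int) :=
  forall i j : int, i + d = j -> sect (opensT M) i -> sect (opensT M) j.

Definition is_derivation d (X : graded_endo d) : Prop :=
  (forall i j (e : i + d = j), linear (X i j e)) /\
  forall i j k i' j' k' (e : i + j = k) (ei : i + d = i') (ej : j + d = j')
    (ek : k + d = k') (el : i' + j = k') (er : i + j' = k')
    (f : sect (opensT M) i) (g : sect (opensT M) j),
    X _ _ ek (gmul e f g) =
      gmul el (X _ _ ei f) g + gsign R d i *: gmul er f (X _ _ ej g).

Record vector_field d := VectorField {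
  vfield :> graded_endo d;
  vfield_derivation : is_derivation vfield }.

Lemma bracket_degl (i j d d' : int) : i + (d + d') = j -> i + d' + d = j.
Proof. by rewrite addrAC addrA. Qed.

Lemma bracket_degr (i j d d' : int) : i + (d + d') = j -> i + d + d' = j.
Proof. by rewrite addrA. Qed.

Definition bracket d d' (X : graded_endo d) (Y : graded_endo d') :
    graded_endo (d + d') := fun i j e f =>
  X _ _ (bracket_degl e) (Y _ _ erefl f) -
  gsign R d d' *: Y _ _ (bracket_degr e) (X _ _ erefl f).

Definition endo0 d : graded_endo d := fun i j e f => 0.
Arguments endo0 : clear implicits.

Definition endo_eq d (X Y : graded_endo d) : Prop :=
  forall i j (e : i + d = j) (f : sect (opensT M) i), X i j e f = Y i j e f.

End Fields.

Lemma sub_preimage_opensT (M N : gspace R) (phi : gmap M N) :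
  opensT M `<=` preimage_opens (gfun_continuous phi) (opensT N).
Proof. by []. Qed.

Definition pullT (M N : gspace R) (phi : gmap M N) k (f : sect (opensT N) k) :
    sect (opensT M) k :=
  gres (@sub_preimage_opensT _ _ phi) (gpull phi f).

Definition vf_related (M N : gspace R) (phi : gmap M N) d
    (X : graded_endo M d) (Y : graded_endo N d) : Prop :=
  forall i j (e : i + d = j) (f : sect (opensT N) i),
    X i j e (pullT phi f) = pullT phi (Y i j e f).

End Manifolds.

Arguments endo0 {R} M d i j e f.

Section Flows.
Variable R : realType.

(* R[-k]: one coordinate, of degree -k; the underlying space is the space of  *)
(* row vectors of length 1 if k = 0 and of length 0 otherwise.                *)
Definition gline (k : int) : gspace R :=
  gdom R (k == 0) (fun _ : 'I_(k != 0) => - k).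

Definition gpoint : gspace R := gdom R 0 (fun _ : 'I_0 => 0).

(* One of the two index types is empty and the other a singleton, so this is  *)
(* the coefficient series of the only coordinate, even or formal.             *)
Definition line_coord_series (k : int) : series R (k == 0) (k != 0) :=
  fun a x => if a == [ffun=> 1%N] then \prod_i x 0 i else 0.
Arguments line_coord_series : clear implicits.

Lemma line_coordP (k : int) :
  line_coord_series k \in section_pred (fun _ : 'I_(k != 0) => - k)
                            (opensT 'rV[R]_(k == 0)) (- k).
Proof.
rewrite /line_coord_series; apply/asboolP; split=> [a|a x].
  case: (a == _); last exact: smooth_on_cst.
  case: (k == 0) => /=.
    under eq_fun do rewrite big_ord1.
    exact: smooth_on_coord.
  under eq_fun do rewrite big_ord0.
  exact: smooth_on_cst.
have [-> _|_] := eqVneq a; last by rewrite eqxx.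
split=> //; first by apply/forallP => i; rewrite ffunE implybT.
rewrite /mono_deg; case: (k =P 0) => [->|_]; first by rewrite big_ord0 oppr0.
by rewrite big_ord1 ffunE.
Qed.

Definition line_coord (k : int) : sect (opensT (gline k)) (- k) :=
  GDomSect (line_coordP k).

(* Products are unique up to isomorphism only, so flows are relative to a     *)
(* choice of them.                                                            *)
Record flow_setting (M : gspace R) (k : int) := FlowSetting {
  fs_MR : gproduct M (gline k);
  fs_MRR : gproduct fs_MR (gline k);
  fs_RR : gproduct (gline k) (gline k);
  fs_add : gmap fs_RR (gline k);
  fs_addP : pullT fs_add (line_coord k) =
    pullT (gfst fs_RR) (line_coord k) + pullT (gsnd fs_RR) (line_coord k);
  fs_zero : gmap gpoint (gline k);
  fs_zeroP : pullT fs_zero (line_coord k) = 0 }.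

Section Setting.
Variables (M : gspace R) (k : int) (S : flow_setting M k).

Let MR := fs_MR S.
Let MRR := fs_MRR S.
Let RR := fs_RR S.

Definition flow_domain (D : opens MR) : Prop :=
  if k == 0 then
    forall m : M,
      let I := [set t : R | exists x, [/\ oset D x, gfst MR x = m &
                                         gsnd MR x = const_mx t]] in
      [/\ open I, is_interval I & I 0]
  else oset D = setT.

Definition dom_fst (D : opens MR) : gmap (grestrict D) M :=
  gcomp (gfst MR) (gincl D).

Definition dom_snd (D : opens MR) : gmap (grestrict D) (gline k) :=
  gcomp (gsnd MR) (gincl D).

(* (1_M, 0_M) : M -> D composed with theta is the identity. *)
Definition flow_unit (D : opens MR) (theta : gmap (grestrict D) M) : Prop :=
  exists (c : gmap M gpoint) (u : gmap M (grestrict D)),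
    [/\ gmap_eq (gcomp (dom_fst D) u) (gid M),
        gmap_eq (gcomp (dom_snd D) u) (gcomp (fs_zero S) c) &
        gmap_eq (gcomp theta u) (gid M)].

(* The points ((m, s), t) of (M x R) x R with (m, s), (theta (m, s), t) and   *)
(* (m, s + t) in D; for k <> 0 the last two coordinates carry no information. *)
Definition flow_domain2 (D : opens MR) (theta : gmap (grestrict D) M) : set MRR :=
  if k == 0 then
    [set y | exists a b c : grestrict D,
      [/\ gincl D a = gfst MRR y,
          dom_fst D b = theta a /\ dom_snd D b = gsnd MRR y &
          dom_fst D c = dom_fst D a /\
          dom_snd D c = (dom_snd D a + gsnd MRR y :> 'rV[R]_(k == 0))]]
  else setT.

(* On D2 := flow_domain2: a is the first projection to D, b is theta x 1, r   *)
(* is the pair (s, t) and c is (1 x +) composed with the associator.          *)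
Definition flow_group_law (D : opens MR) (theta : gmap (grestrict D) M) : Prop :=
  exists (D2 : opens MRR) (a b c : gmap (grestrict D2) (grestrict D))
      (r : gmap (grestrict D2) RR),
    let p := gcomp (gfst MRR) (gincl D2) in
    let t := gcomp (gsnd MRR) (gincl D2) in
    [/\ oset D2 = flow_domain2 theta,
        gmap_eq (gcomp (gincl D) a) p,
        [/\ gmap_eq (gcomp (dom_fst D) b) (gcomp theta a) &
            gmap_eq (gcomp (dom_snd D) b) t],
        [/\ gmap_eq (gcomp (gfst RR) r) (gcomp (gsnd MR) p),
            gmap_eq (gcomp (gsnd RR) r) t,
            gmap_eq (gcomp (dom_fst D) c) (gcomp (gfst MR) p) &
            gmap_eq (gcomp (dom_snd D) c) (gcomp (fs_add S) r)] &
        gmap_eq (gcomp theta b) (gcomp theta c)].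

Record flow := Flow {
  fdom : opens MR;
  flow_map :> gmap (grestrict fdom) M;
  flow_domP : flow_domain fdom;
  flow_unitP : flow_unit flow_map;
  flow_group_lawP : flow_group_law flow_map }.

(* Z is the lift of (X, Y), where X is a vector field on M and Y one on       *)
(* R[-k], to the restriction to D of their product.                           *)
Definition is_lift d (X : graded_endo M d) (Y : graded_endo (gline k) d)
    (D : opens MR) (Z : vector_field (grestrict D) d) : Prop :=
  exists W : vector_field MR d,
    [/\ vf_related (gfst MR) W X, vf_related (gsnd MR) W Y & vf_related (gincl D) Z W].

Definition is_coord_field (T : vector_field (gline k) k) : Prop :=
  vfield T (addNr k) (line_coord k) = gone _.

Definition is_generator (theta : flow) (X : vector_field M k) : Prop :=
  exists (T : vector_field (gline k) k)
      (Z : vector_field (grestrict (fdom theta)) k),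
    [/\ is_coord_field T, is_lift (endo0 M k) T Z & vf_related theta Z X].

Definition is_restriction (theta' theta : flow) : Prop :=
  exists j : gmap (grestrict (fdom theta')) (grestrict (fdom theta)),
    gmap_eq (gcomp (gincl (fdom theta)) j) (gincl (fdom theta')) /\
    gmap_eq (gcomp theta j) theta'.

Definition is_flow_of (theta : flow) (X : vector_field M k) : Prop :=
  is_generator theta X /\
  forall theta' : flow, is_generator theta' X -> is_restriction theta' theta.

End Setting.

End Flows.

(* Main.v *)
(* Sections of a graded manifold are separated by their pullbacks (jets) along
   formal points, that is, maps from graded domains over a point.  A derivation
   along a formal point of M x R[-k] which kills the functions of M and the
   coordinate t of the line is zero: its coefficients of least order are point
   derivations, a point derivation extends the evaluation to a map from a graded
   domain with a square-zero top monomial, and such a map is determined by its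
   two projections by the universal property of the product.  Hence the lift Z
   of d/dt commutes with the lift Y1 of Y, and Y1 restricts to Y along t = 0.

   If Y1 theta^* = theta^* Y, then theta^* [X, Y] = [Z, Y1] theta^* = 0, and
   [X, Y] = 0 follows by restriction to t = 0.

   Conversely let [X, Y] = 0 and A f := Y1 theta^* f - theta^* Y f.  Then
   Z A f = +- A (X f), and A f vanishes along t = 0.  For k <> 0 the Taylor
   expansion of A f in t is therefore zero.  For k = 0 fix a formal point of M
   and move it along the line.  By induction on the order, the coefficients of
   least order of the jets of A f are point derivations v_s of M at theta (m, s)
   with d/ds v_s (f) = v_s (X f).  Near each point, point derivations are
   combinations of their values on finitely many functions, so these values solve
   a linear ODE on the interval of the flow domain, with zero initial value.  The
   nilpotent part of t is again dealt with by a Taylor expansion. *)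

Require Import Defs.
From HB Require Import structures.
From mathcomp Require Import all_boot all_order all_algebra.
From mathcomp Require Import all_classical all_reals all_analysis.
From mathcomp Require Import ring lra zify.

Set Implicit Arguments.
Unset Strict Implicit.
Unset Printing Implicit Defensive.

Import Order.TTheory GRing.Theory Num.Theory numFieldNormedType.Exports.

Local Open Scope classical_set_scope.
Local Open Scope ring_scope.

(** The product with the line is given by its universal property alone, so a section of it cannot be
    written as a series in t over [M]. What is available are maps into the product from other graded
    manifolds, and this forces the detour through formal points: identities between derivations
    become equalities of maps with the same projections. The property applies only to test spaces
    that are graded manifolds, which is why sections are tested on formal points without variables
    of degree 0. Ordinary points would not do, since they see only bodies. The price is that time
    has two components at a formal point: a real number, which can be moved continuously, and a part
    of positive order, which no such motion reaches. This is why degree 0 needs both an ODE and a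
    Taylor formula. Order means the number of variables in a monomial, not its degree: degrees may
    be negative or cancel, whereas a series that vanishes to all orders is zero. *)

Lemma addr_self0 (V : zmodType) (x : V) : x = x + x -> x = 0.
Proof. by move=> e; apply: (addrI x); rewrite addr0 -e. Qed.

(** * Koszul signs *)

Section Signs.
Variable R : realType.
Implicit Types i j k : int.

Lemma odd_abszD i j : odd (absz (i + j)) = odd (absz i) (+) odd (absz j).
Proof. lia. Qed.

Lemma gsign_odd i j : gsign R i j = (-1) ^+ (odd (absz i) && odd (absz j)).
Proof. by rewrite /gsign -signr_odd abszM oddM. Qed.

Lemma gsignDl i j k : gsign R (i + j) k = gsign R i k * gsign R j k.
Proof.
rewrite !gsign_odd odd_abszD -signr_addb.
by case: (odd (absz i)); case: (odd (absz j)); case: (odd (absz k)).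
Qed.

Lemma gsignC i j : gsign R i j = gsign R j i.
Proof. by rewrite !gsign_odd andbC. Qed.

Lemma gsignDr i j k : gsign R i (j + k) = gsign R i j * gsign R i k.
Proof. by rewrite ![gsign R i _]gsignC gsignDl. Qed.

Lemma gsign0l i : gsign R 0 i = 1.
Proof. by rewrite gsign_odd. Qed.

Lemma gsign0r i : gsign R i 0 = 1.
Proof. by rewrite gsignC gsign0l. Qed.

Lemma gsign_sq i j : gsign R i j * gsign R i j = 1.
Proof. by rewrite gsign_odd -signr_addb addbb. Qed.

Lemma gsign_suml (I : Type) (r : seq I) (x : I -> int) k :
  gsign R (\sum_(i <- r) x i) k = \prod_(i <- r) gsign R (x i) k.
Proof.
by elim/big_rec2: _ => [|i y1 y2 _ <-]; rewrite ?gsign0l ?gsignDl.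
Qed.

Lemma gsign_sumr (I : Type) (r : seq I) (x : I -> int) k :
  gsign R k (\sum_(i <- r) x i) = \prod_(i <- r) gsign R k (x i).
Proof.
by rewrite gsignC gsign_suml; apply: eq_bigr => i _; rewrite gsignC.
Qed.
End Signs.

(** * Formal power series in graded variables *)

Section Monomials.
Variables (q : nat).
Implicit Types a b c : mono q.

Definition mono0 : mono q := [ffun=> 0%N].

Definition mono_add a b : mono q := [ffun i => (a i + b i)%N].

Definition mono_le a b := [forall i, (a i <= b i)%N].

Definition mono_size a : nat := (\sum_i a i)%N.

(** The summation range of [series_mul], with the bounded functions replaced by exponents, so that
    sums can be reindexed by maps of exponents such as b |-> a - b. *)
Definition below a : seq (mono q) :=
  [seq [ffun i => val (b i)] | b : {ffun 'I_q -> 'I_(\sum_i a i).+1} <-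
     enum [pred b : {ffun 'I_q -> 'I_(\sum_i a i).+1} | [forall i, (b i <= a i)%N]]].

Lemma mono_leP a b : reflect (forall i, (a i <= b i)%N) (mono_le a b).
Proof. exact: forallP. Qed.

Lemma below_uniq a : uniq (below a).
Proof.
rewrite map_inj_uniq; first exact: enum_uniq.
move=> b c /ffunP e; apply/ffunP => i; apply/val_inj.
by have := e i; rewrite !ffunE.
Qed.

Lemma mem_below a b : (b \in below a) = mono_le b a.
Proof.
apply/mapP/mono_leP => [[c + ->] i|ba].
  by rewrite mem_enum inE ffunE => /forallP/(_ i).
have lt i : (b i < (\sum_j a j).+1)%N.
  by rewrite ltnS (bigD1 i) //=; apply: leq_trans (leq_addr _ _); exact: ba.
exists [ffun i => Ordinal (lt i)].
  by rewrite mem_enum inE; apply/forallP => i; rewrite ffunE; exact: ba.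
by apply/ffunP => i; rewrite !ffunE.
Qed.

Lemma mono_addC a b : mono_add a b = mono_add b a.
Proof. by apply/ffunP => i; rewrite !ffunE addnC. Qed.

Lemma mono_subK a b : mono_le b a -> mono_add b (mono_sub a b) = a.
Proof. by move=> /mono_leP ba; apply/ffunP => i; rewrite !ffunE subnKC. Qed.

Lemma mono_addK a b : mono_sub (mono_add a b) a = b.
Proof. by apply/ffunP => i; rewrite !ffunE addKn. Qed.

Lemma mono_add0 a : mono_add mono0 a = a.
Proof. by apply/ffunP => i; rewrite !ffunE. Qed.

Lemma mono_le_addr a b : mono_le a (mono_add a b).
Proof. by apply/mono_leP => i; rewrite ffunE leq_addr. Qed.

Lemma mono_le_sub a b : mono_le (mono_sub a b) a.
Proof. by apply/mono_leP => i; rewrite ffunE leq_subr. Qed.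

Lemma mono_lexx a : mono_le a a.
Proof. exact/mono_leP. Qed.

Lemma mono_le0 a : mono_le mono0 a.
Proof. by apply/mono_leP => i; rewrite ffunE. Qed.

Lemma mono_le_trans b a c : mono_le a b -> mono_le b c -> mono_le a c.
Proof. by move=> /mono_leP h /mono_leP h'; apply/mono_leP => i; apply: leq_trans (h' i). Qed.

Lemma mono_sizeD a b : mono_size (mono_add a b) = (mono_size a + mono_size b)%N.
Proof. by rewrite /mono_size -big_split; apply: eq_bigr => i _; rewrite ffunE. Qed.

Lemma mono_size_eq0 a : (mono_size a == 0%N) = (a == mono0).
Proof.
rewrite sum_nat_eq0; apply/forallP/eqP => [h|-> i]; last by rewrite ffunE.
by apply/ffunP => i; rewrite ffunE; exact/eqP/(implyP (h i)).
Qed.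

Lemma mono_sub0 a : mono_sub a mono0 = a.
Proof. by apply/ffunP => i; rewrite !ffunE subn0. Qed.

Lemma mono_subxx a : mono_sub a a = mono0.
Proof. by apply/ffunP => i; rewrite !ffunE subnn. Qed.

(** Both sides run over the decompositions a = c + e + x; on the left they are grouped by b = c + e.
    This is the combinatorial core of associativity. *)
Lemma sum_below_pair (V : nmodType) (F : mono q -> mono q -> mono q -> V) a :
  \sum_(b <- below a) \sum_(c <- below b) F c (mono_sub b c) (mono_sub a b) =
  \sum_(c <- below a) \sum_(e <- below (mono_sub a c))
    F c e (mono_sub (mono_sub a c) e).
Proof.
transitivity (\sum_(b <- below a) \sum_(c <- below a | mono_le c b)
    F c (mono_sub b c) (mono_sub a b)).
  apply: eq_big_seq => b; rewrite mem_below => ba.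
  rewrite -[RHS]big_filter.
 apply: perm_big; apply: uniq_perm.
  - exact: below_uniq.
  - exact/filter_uniq/below_uniq.
  - move=> c; rewrite mem_filter !mem_below.
    by case: (boolP (mono_le c b)) => // cb; rewrite (mono_le_trans cb).
rewrite (exchange_big_dep xpredT) //=; apply: eq_big_seq => c.
rewrite mem_below => ca; rewrite -big_filter.
rewrite (perm_big (map (mono_add c) (below (mono_sub a c)))); last first.
  apply: uniq_perm.
  - exact/filter_uniq/below_uniq.
  - rewrite map_inj_uniq ?below_uniq // => x y e.
    by rewrite -(mono_addK c x) e mono_addK.
  - move=> b; rewrite mem_filter mem_below; apply/andP/mapP.
      move=> [cb ba]; exists (mono_sub b c); last by rewrite mono_subK.
      rewrite mem_below; apply/mono_leP => i; rewrite !ffunE leq_sub2r //.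
      exact: (mono_leP _ _ ba).
    move=> [e]; rewrite mem_below => /mono_leP ea ->.
    split; first exact: mono_le_addr.
    apply/mono_leP => i; have := ea i; have := mono_leP _ _ ca i.
    by rewrite !ffunE; lia.
rewrite big_map; apply: eq_bigr => e _; rewrite mono_addK; congr F.
by apply/ffunP => i; rewrite !ffunE subnDA.
Qed.

Lemma sum_below_rev (V : nmodType) (F : mono q -> mono q -> V) a :
  \sum_(b <- below a) F b (mono_sub a b) = \sum_(b <- below a) F (mono_sub a b) b.
Proof.
have K b : mono_le b a -> mono_sub a (mono_sub a b) = b.
  move=> /mono_leP ba; apply/ffunP => i; rewrite !ffunE subKn //; exact: ba.
transitivity (\sum_(b <- map (mono_sub a) (below a)) F b (mono_sub a b)); last first.
  by rewrite big_map; apply: eq_big_seq => b; rewrite mem_below => /K ->.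
apply: perm_big; apply: uniq_perm; first exact: below_uniq.
  rewrite map_inj_in_uniq ?below_uniq // => x y; rewrite !mem_below => xa ya e.
  by rewrite -(K x) // e K.
move=> b; rewrite mem_below; apply/idP/mapP => [ba|[e _ ->]].
  by exists (mono_sub a b); rewrite ?mem_below ?mono_le_sub // K.
exact: mono_le_sub.
Qed.

Lemma sum_below1 (V : nmodType) (F : mono q -> V) a b : mono_le b a ->
  (forall c, mono_le c a -> c != b -> F c = 0) -> \sum_(c <- below a) F c = F b.
Proof.
move=> ba F0; rewrite (bigD1_seq b) ?mem_below ?below_uniq //= big1_seq ?addr0 //.
by move=> c /andP[cb]; rewrite mem_below => ca; exact: F0.
Qed.

End Monomials.

Arguments mono0 {q}.

Section Formal.
Variables (R : realType) (q : nat) (d : 'I_q -> int).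

(** The degree is a predicate on these series ([fhomog]) and not part of their type, so that sums
    and products need no degree equations. *)
Definition fps := mono q -> R^o.

Local Notation ok := (mono_ok d).
Local Notation sign := (mono_sign R d).
Local Notation deg := (mono_deg d).
Implicit Types (f g h : fps) (a b c : mono q) (i j k : int) (N : nat).

Definition fmul f g : fps := fun a =>
  if ok a then \sum_(b <- below a) sign b (mono_sub a b) * (f b * g (mono_sub a b))
  else 0.

Definition fone : fps := fun a => (a == mono0)%:R.

Definition fhomog i f := forall a, f a != 0 -> ok a /\ deg a = i.

(** The filtration for all the inductions on order. It is separated ([ford_all]) and multiplicative
    ([ford_mul]). *)
Definition ford N f := forall a, (mono_size a < N)%N -> f a = 0.

Lemma series_mulE n (f g : Defs.series R n q) a x :
  series_mul d f g a x = fmul (f^~ x) (g^~ x) a.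
Proof.
rewrite /series_mul /fmul; case: ifP => // _.
by rewrite /below big_map big_enum.
Qed.

Lemma mono_ok_le a b : mono_le a b -> ok b -> ok a.
Proof.
move=> /mono_leP ab /forallP okb; apply/forallP => i; apply/implyP => oi.
exact: leq_trans (ab i) (implyP (okb i) oi).
Qed.

Lemma mono_ok0 : ok mono0.
Proof. by apply/forallP => i; rewrite ffunE implybT. Qed.

Lemma mono_degD a b : deg (mono_add a b) = deg a + deg b.
Proof. by rewrite /mono_deg -big_split; apply: eq_bigr => i _; rewrite ffunE mulrnDr. Qed.

Lemma mono_deg0 : deg mono0 = 0.
Proof. by rewrite /mono_deg big1 // => i _; rewrite ffunE mulr0n. Qed.

Lemma mono_sign0l a : sign mono0 a = 1.
Proof. by apply: big1 => i _; apply: big1 => j _; rewrite ffunE mulr0n gsign0l. Qed.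

Lemma mono_sign0r a : sign a mono0 = 1.
Proof. by apply: big1 => i _; apply: big1 => j _; rewrite ffunE mulr0n gsign0r. Qed.

Lemma mono_signDl a b c : sign (mono_add a b) c = sign a c * sign b c.
Proof.
rewrite /mono_sign -big_split; apply: eq_bigr => i _ /=.
by rewrite -big_split; apply: eq_bigr => j _ /=; rewrite ffunE mulrnDr gsignDl.
Qed.

Lemma mono_signDr a b c : sign a (mono_add b c) = sign a b * sign a c.
Proof.
rewrite /mono_sign -big_split; apply: eq_bigr => i _ /=.
by rewrite -big_split; apply: eq_bigr => j _ /=; rewrite ffunE mulrnDr gsignDr.
Qed.

(** For i different from j exactly one of the two signs on the left contains the factor of the
    ordered pair (i, j). The diagonal factors on the right are 1, because an odd variable occurs at
    most once in xi^(a + b). *)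
Lemma mono_signC a b : ok (mono_add a b) ->
  sign a b * sign b a = gsign R (deg a) (deg b).
Proof.
move=> /forallP okab; rewrite gsign_suml.
under [RHS]eq_bigr do rewrite gsign_sumr.
rewrite {2}/mono_sign (exchange_big_dep xpredT) //= -big_split; apply: eq_bigr => i _ /=.
rewrite [RHS](bigID (fun j : 'I_q => (j < i)%N)) /=; congr (_ * _).
rewrite [RHS](bigID (pred1 i)) /= [X in _ = X * _](big_pred1 i); last first.
  by move=> j; rewrite /= -leqNgt; case: eqP => [->|_]; rewrite ?leqnn ?andbF.
rewrite [in RHS](_ : gsign R (d i *+ a i) (d i *+ b i) = 1) ?mul1r; last first.
  rewrite gsign_odd; have := okab i; rewrite ffunE.
  have [oi|ei] := boolP (odd (absz (d i))); last first.
    suff /negbTE -> : ~~ odd (absz (d i *+ a i)) by [].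
    by rewrite -mulr_natr abszM oddM (negbTE ei).
  move=> /= ab1; have [->|->] : a i = 0%N \/ b i = 0%N by move: (a i) (b i) ab1; lia.
    by rewrite mulr0n.
  by rewrite mulr0n andbF.
apply: eq_big => [j|j _]; last by rewrite gsignC.
by rewrite -leqNgt ltn_neqAle andbC eq_sym.
Qed.

Lemma fmul_linearr f : linear (fmul f).
Proof.
move=> r g h; apply/funext => a; rewrite /fmul.
have -> (x y : fps) : (r *: x + y) a = r * x a + y a by [].
case: ifP => _; last by rewrite mulr0 addr0.
rewrite mulr_sumr -big_split; apply: eq_bigr => b _ /=.
have -> : (r *: g + h) (mono_sub a b) = r * g (mono_sub a b) + h (mono_sub a b) by [].
ring.
Qed.

Lemma fmul_linearl g : linear (fmul^~ g).
Proof.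
move=> r f h; apply/funext => a; rewrite /fmul.
have -> (x y : fps) : (r *: x + y) a = r * x a + y a by [].
case: ifP => _; last by rewrite mulr0 addr0.
rewrite mulr_sumr -big_split; apply: eq_bigr => b _ /=.
have -> : (r *: f + h) b = r * f b + h b by [].
ring.
Qed.

Lemma fmulA f g h : fmul f (fmul g h) = fmul (fmul f g) h.
Proof.
apply/funext => a; rewrite /fmul; case: ifP => // oka.
transitivity (\sum_(c <- below a) \sum_(e <- below (mono_sub a c))
   sign c (mono_sub a c) * sign e (mono_sub (mono_sub a c) e) *
     (f c * g e * h (mono_sub (mono_sub a c) e))).
  apply: eq_bigr => c _; rewrite (mono_ok_le (mono_le_sub a c) oka).
  rewrite !mulr_sumr; apply: eq_bigr => e _; ring.
transitivity (\sum_(c <- below a) \sum_(e <- below (mono_sub a c))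
   sign c e * sign (mono_add c e) (mono_sub (mono_sub a c) e) *
     (f c * g e * h (mono_sub (mono_sub a c) e))).
  apply: eq_bigr => c _; apply: eq_big_seq => e; rewrite mem_below => eac.
  rewrite -{1}(mono_subK eac) mono_signDr mono_signDl; ring.
rewrite -(sum_below_pair (fun c e x => sign c e * sign (mono_add c e) x *
   (f c * g e * h x))).
apply: eq_big_seq => b; rewrite mem_below => ba; rewrite (mono_ok_le ba oka).
rewrite mulr_suml mulr_sumr; apply: eq_big_seq => c; rewrite mem_below => cb.
rewrite mono_subK //; ring.
Qed.

(** The substitution b |-> a - b exchanges the factors and [mono_signC] compares the signs. Only
    exponents at which both coefficients are nonzero matter, and there homogeneity gives the
    degrees. *)
Lemma fmulC i j f g : fhomog i f -> fhomog j g ->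
  fmul f g = gsign R i j *: fmul g f.
Proof.
move=> hf hg; apply/funext => a.
have -> (r : R) (x : fps) : (r *: x) a = r * x a by [].
rewrite /fmul; case: ifP => [oka|_]; last by rewrite mulr0.
rewrite (sum_below_rev (fun b c => sign b c * (f b * g c))) mulr_sumr.
apply: eq_big_seq => b; rewrite mem_below => ba.
have [/eqP fg0|] := boolP (f (mono_sub a b) * g b == 0).
  by rewrite fg0 [g b * _]mulrC fg0 !mulr0.
rewrite mulf_eq0 negb_or => /andP[/hf[_ <-] /hg[_ <-]].
rewrite -(mono_signC (a := mono_sub a b)); last by rewrite mono_addC mono_subK.
rewrite -[RHS]mulrA; congr (_ * _); rewrite mulrA [g b * _]mulrC.
have : sign b (mono_sub a b) * sign b (mono_sub a b) = 1.
  rewrite -mono_signDl /mono_sign big1 // => x _; rewrite big1 // => y _.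
  by rewrite ffunE mulrnDr gsignDl gsign_sq.
by move=> ->; rewrite mul1r.
Qed.

Lemma fmul1l f : (forall a, f a != 0 -> ok a) -> fmul fone f = f.
Proof.
move=> hf; apply/funext => a; rewrite /fmul; case: ifPn => [_|na]; last first.
  by apply/esym/eqP; apply: contraNT na => /hf.
rewrite (sum_below1 (b := mono0)) ?mono_le0 //.
  by rewrite mono_sign0l mono_sub0 /fone eqxx !mul1r.
by move=> c _ /negbTE nc; rewrite /fone nc mul0r mulr0.
Qed.

Lemma fmul1r f : (forall a, f a != 0 -> ok a) -> fmul f fone = f.
Proof.
move=> hf; apply/funext => a; rewrite /fmul; case: ifPn => [_|na]; last first.
  by apply/esym/eqP; apply: contraNT na => /hf.
rewrite (sum_below1 (b := a)) ?mono_lexx //.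
  by rewrite mono_subxx mono_sign0r /fone eqxx mul1r mulr1.
move=> c ca nca; rewrite /fone; case: eqP => [e|_]; last by rewrite !mulr0.
by case/eqP: nca; rewrite -(mono_subK ca) e mono_addC mono_add0.
Qed.

Lemma fhomog_one : fhomog 0 fone.
Proof.
move=> a; rewrite /fone; have [->|] := eqVneq a; last by rewrite eqxx.
by rewrite mono_ok0 mono_deg0.
Qed.

Lemma fhomog_mul i j f g : fhomog i f -> fhomog j g -> fhomog (i + j) (fmul f g).
Proof.
move=> hf hg a; rewrite /fmul; case: ifP => [oka nz|]; last by rewrite eqxx.
split=> //; have /hasP[b] : has (fun b => f b * g (mono_sub a b) != 0) (below a).
  apply: contraNT nz => /hasPn h; rewrite big1_seq // => b /andP[_ /h].
  by rewrite negbK => /eqP ->; rewrite mulr0.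
rewrite mem_below => ba; rewrite mulf_eq0 negb_or => /andP[/hf[_ <-] /hg[_ <-]].
by rewrite -mono_degD mono_subK.
Qed.

Lemma fmul0 f g : fmul f g mono0 = f mono0 * g mono0.
Proof.
rewrite /fmul mono_ok0 (sum_below1 (b := mono0)) ?mono_lexx ?mono_subxx ?mono_sign0l ?mul1r //.
move=> c /mono_leP c0 /eqP[]; apply/ffunP => i.
by have := c0 i; rewrite !ffunE leqn0 => /eqP.
Qed.

Lemma ford_mul M N f g : ford M f -> ford N g -> ford (M + N) (fmul f g).
Proof.
move=> hf hg a sa; rewrite /fmul; case: ifP => // _; apply: big1_seq => b /andP[_].
rewrite mem_below => ba; move: sa; rewrite -{1}(mono_subK ba) mono_sizeD => sa.
have [lt|ge] := ltnP (mono_size b) M; first by rewrite hf // mul0r mulr0.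
rewrite hg ?mulr0 //; lia.
Qed.

(** In its lowest order a product sees only the body of the other factor. Hence the leading
    coefficients of a derivation satisfy a Leibniz rule over the reals. *)
Lemma fmul_leadl N f g a : ford N f -> mono_size a = N -> ok a ->
  fmul f g a = f a * g mono0.
Proof.
move=> hf sa oka; rewrite /fmul oka (sum_below1 (b := a)) ?mono_lexx //.
  by rewrite mono_subxx mono_sign0r mul1r.
move=> c ca nca; rewrite hf ?mul0r ?mulr0 // -sa -(mono_subK ca) mono_sizeD.
rewrite -[X in (X < _)%N]addn0 ltn_add2l lt0n mono_size_eq0.
by apply: contraNneq nca => e; rewrite -(mono_subK ca) e mono_addC mono_add0.
Qed.

Lemma fmul_leadr N f g a : ford N g -> mono_size a = N -> ok a ->
  fmul f g a = f mono0 * g a.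
Proof.
move=> hg sa oka; rewrite /fmul oka (sum_below1 (b := mono0)) ?mono_le0 //.
  by rewrite mono_sub0 mono_sign0l mul1r.
move=> c ca nca; rewrite hg ?mulr0 // -sa -{2}(mono_subK ca) mono_sizeD.
by rewrite -[X in (X < _)%N]add0n ltn_add2r lt0n mono_size_eq0.
Qed.

Lemma ford_all f : (forall N, ford N f) -> f = 0.
Proof. by move=> h; apply/funext => a; rewrite (h (mono_size a).+1). Qed.

Lemma fhomog_lin i r f g : fhomog i f -> fhomog i g -> fhomog i (r *: f + g).
Proof.
move=> hf hg a; have [f0|/hf//] := eqVneq (f a) 0.
have [g0|/hg//] := eqVneq (g a) 0.
by rewrite [X in X != 0](_ : _ = r * f a + g a) // f0 g0 mulr0 addr0 eqxx.
Qed.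

Lemma fhomog_deg i f a : fhomog i f -> deg a != i -> f a = 0.
Proof. by move=> hf; apply: contraNeq => /hf[_ ->]. Qed.

Lemma fhomog0_ford i f : i != 0 -> fhomog i f -> ford 1 f.
Proof.
move=> i0 hf a; rewrite ltnS leqn0 mono_size_eq0 => /eqP ->.
by apply: fhomog_deg hf _; rewrite mono_deg0 eq_sym.
Qed.

End Formal.

Arguments fone {R q}.

(** * Directional derivatives as derivatives in one real variable *)

Section LineDerivative.
Variables (R : realType) (V : normedModType R).

Lemma is_derive_lineP (f : V -> R) x v (df : R) :
  is_derive x v f df <-> is_derive (0 : R) 1 (fun h => f (h *: v + x)) df.
Proof.
have e : 'D_v f x = 'D_1 (fun h : R => f (h *: v + x)) 0.
  rewrite /derive; set g1 := fun h => h^-1 *: _; set g2 := fun h => h^-1 *: _.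
  suff -> : g1 = g2 by [].
  rewrite funeqE /g1 /g2 => h /=.
  by rewrite addr0 scale0r add0r [_%:A]mulr1.
split=> -[d <-]; [rewrite e|rewrite -e]; apply: derivableP.
  exact: (iffLR (derivable1P _ _ _) d).
exact: (iffRL (derivable1P _ _ _) d).
Qed.

Lemma is_derive_comp1 (F : R -> R) (f : V -> R) x v (dF df : R) :
  is_derive (f x) 1 F dF -> is_derive x v f df ->
  is_derive x v (fun y => F (f y)) (dF * df).
Proof.
move=> HF /is_derive_lineP Hf; apply/is_derive_lineP.
apply: (@is_derive1_comp R F (fun h : R => f (h *: v + x))).
by rewrite scale0r add0r.
Qed.

End LineDerivative.

(** * Smooth functions and bump functions *)

Section SmoothComposition.
Variables (R : realType) (n : nat).
Implicit Types (W : set 'rV[R]_n) (f g : 'rV[R]_n -> R).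

Lemma class_C_derive r W f i : class_C r.+1 W f ->
  class_C r W (fun x => 'D_(delta_mx 0 i) f x).
Proof. by move=> [_ /(_ i)[]]. Qed.

Lemma class_C_cont r W f : class_C r W f -> forall x, W x -> {for x, continuous f}.
Proof. by case: r => [|r] []. Qed.

Lemma smooth_on_derive W f i : smooth_on W f ->
  smooth_on W (fun x => 'D_(delta_mx 0 i) f x).
Proof. by move=> sf r; apply: class_C_derive (sf r.+1). Qed.

Lemma smooth_on_derivable W f i x : smooth_on W f -> W x ->
  derivable f x (delta_mx 0 i).
Proof. by move=> sf; have [_ /(_ i)[+ _]] := sf 1%N; apply. Qed.

Lemma smooth_on_continuous W f x : smooth_on W f -> W x -> {for x, continuous f}.
Proof. by move=> sf; apply: class_C_cont (sf 0%N) x. Qed.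

(* F m.+1 is the derivative of F m on a set that contains the values of f. *)
Lemma class_C_comp r W (D : set R) (F : nat -> R -> R) f : open W ->
  (forall m t, D t -> is_derive t 1 (F m) (F m.+1 t)) ->
  smooth_on W f -> (forall x, W x -> D (f x)) ->
  forall m, class_C r W (fun x => F m (f x)).
Proof.
move=> oW dF sf fD; have cF m x : W x -> {for x, continuous (fun x => F m (f x))}.
  move=> Wx; apply: continuous_comp; first exact: smooth_on_continuous sf Wx.
  have [d _] := dF m _ (fD _ Wx).
  by apply: differentiable_continuous; exact/derivable1_diffP.
elim: r => [|r IH] m; split=> //; try exact: cF.
move=> i; have df x : W x -> is_derive x (delta_mx 0 i) (fun x => F m (f x))
    (F m.+1 (f x) * 'D_(delta_mx 0 i) f x).
  move=> Wx; apply: is_derive_comp1; first exact/dF/fD.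
  by apply: derivableP; apply: smooth_on_derivable sf Wx.
split=> [x /df[] //|].
apply: (@eq_class_C _ _ _ _ (fun x => F m.+1 (f x) * 'D_(delta_mx 0 i) f x)) => //.
  by move=> x /df[].
exact: class_CM (IH _) (smooth_on_derive i sf r).
Qed.

Lemma smooth_on_comp W (D : set R) (F : nat -> R -> R) f : open W ->
  (forall m t, D t -> is_derive t 1 (F m) (F m.+1 t)) ->
  smooth_on W f -> (forall x, W x -> D (f x)) ->
  smooth_on W (fun x => F 0%N (f x)).
Proof. by move=> oW dF sf fD r; exact: class_C_comp fD 0%N. Qed.

Lemma smooth_onV W f : open W -> smooth_on W f -> (forall x, W x -> f x != 0) ->
  smooth_on W (fun x => (f x)^-1).
Proof.
(* [F m] is the m-th derivative of 1/t. *)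
move=> oW sf f0; pose F (m : nat) (t : R) : R := (-1) ^+ m * m`!%:R * t^-1 ^+ m.+1.
have -> : (fun x => (f x)^-1) = (fun x => F 0%N (f x)).
  by apply/funext => x; rewrite /F expr0 fact0 !mul1r expr1.
apply: (smooth_on_comp (D := [set t | t != 0])) => // m t /= t0.
have := is_deriveV t0 (is_derive_id t 1).
move=> /(@is_deriveX _ _ _ m.+1) /(@is_deriveZ _ _ _ _ ((-1) ^+ m * m`!%:R)).
have -> : ((-1) ^+ m * m`!%:R) \*: (fun x => x^-1 : R) ^+ m.+1 = F m.
  by apply/funext => s; rewrite /F /= exprfctE.
move=> h; apply: (is_derive_eq h); rewrite /F factS natrM /GRing.scale /= !exprS -natr1.
by rewrite expr0 !mulr1 invfM; ring.
Qed.

End SmoothComposition.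

Section Flat.
Variable R : realType.

(* t |-> p(1/t) exp(-1/t), extended by 0 to t <= 0. *)
Definition flat (p : {poly R}) (t : R) : R :=
  if 0 < t then p.[t^-1] * expR (- t^-1) else 0.

(** The chain rule gives d/dt (p(1/t) exp(-1/t)) = r(1/t) exp(-1/t) with r = X^2 (p - p'), so all
    derivatives of a flat function are flat. *)
Definition flat_step (p : {poly R}) : {poly R} := 'X^2 * (p - p^`()).

Lemma expr_le_expR n (x : R) : 0 <= x -> x ^+ n <= n`!%:R * expR x.
Proof.
move=> x0; case: n => [|n].
  by rewrite expr0 fact0 mul1r (le_trans _ (expR_ge1Dx x)) // lerDl.
have := expR_ge1Dxn n x0; have f0 : (0 : R) < n.+1`!%:R by rewrite ltr0n fact_gt0.
by move=> h; rewrite mulrC -ler_pdivrMr // (le_trans _ h) // lerDr.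
Qed.

Lemma poly_le_expR (p : {poly R}) : exists C : R, 0 <= C /\
  forall x, 0 <= x -> `|p.[x]| <= C * expR x.
Proof.
exists (\sum_(i < size p) `|p`_i| * i`!%:R); split.
  by apply: sumr_ge0 => i _; rewrite mulr_ge0.
move=> x x0; rewrite horner_coef (le_trans (ler_norm_sum _ _ _)) // mulr_suml.
apply: ler_sum => i _; rewrite normrM -mulrA ler_wpM2l //.
by rewrite ger0_norm ?exprn_ge0 // expr_le_expR.
Qed.

(** The exponential dominates the polynomial X^2 p at 1/t. The square on the right makes the
    difference quotient at 0 tend to 0. *)
Lemma flat_le (p : {poly R}) : exists C : R, 0 <= C /\
  forall t, `|flat p t| <= C * t ^+ 2.
Proof.
have [C [C0 hC]] := poly_le_expR ('X^2 * p); exists C; split=> // t.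
rewrite /flat; case: ifPn => [t0|_]; last by rewrite normr0 mulr_ge0 // sqr_ge0.
have ti0 : 0 <= t^-1 by rewrite invr_ge0 ltW.
have := hC _ ti0; rewrite hornerM hornerXn normrM => h.
rewrite normrM (ger0_norm (expR_ge0 _)) expRN ler_pdivrMr ?expR_gt0 //.
rewrite -(@ler_pM2l _ (`|t^-1 ^+ 2|)) ?normr_gt0 ?expf_neq0 ?invr_neq0 ?gt_eqF //.
rewrite (le_trans h) // [`|_ ^+ 2|]ger0_norm ?sqr_ge0 //.
by rewrite le_eqVlt; apply/orP; left; apply/eqP; field; rewrite gt_eqF.
Qed.

Lemma is_derive_flat (p : {poly R}) (t : R) : is_derive t 1 (flat p) (flat (flat_step p) t).
Proof.
have [t0|t0|->] := ltgtP t 0.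
- have -> : flat (flat_step p) t = 0 by rewrite /flat ltNge ltW.
  apply: (@near_eq_is_derive R R R (cst 0)).
  near=> s; rewrite /flat ltNge ltW //; near: s; exact: lt_nbhsl.
- have d1 := is_deriveV (lt0r_neq0 t0) (is_derive_id t 1).
  have d2 : is_derive t 1 (fun s => p.[s^-1] * expR (- s^-1)) (flat (flat_step p) t).
    have d3 := @is_derive1_comp R (horner p) (fun s => s^-1) t _ _ (is_derive_poly _ _) d1.
    have d4 := @is_derive1_comp R expR (fun s => - s^-1) t _ _ (is_derive_expR _) (is_deriveN d1).
    have h := is_deriveM d3 d4; apply: (is_derive_eq h).
    rewrite /flat t0 /flat_step !hornerE /= /GRing.scale /=.
    by rewrite -exprVn; ring.
  apply: near_eq_is_derive d2.
  near=> s; rewrite /flat ifT //; near: s; exact: lt_nbhsr.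
- have -> : flat (flat_step p) 0 = 0 by rewrite /flat ltxx.
  have [C [C0 hC]] := flat_le p.
  have f0 : flat p 0 = 0 by rewrite /flat ltxx.
  suff cv : h^-1 *: (flat p (h + 0) - flat p 0) @[h --> 0^'] --> (0 : R).
    apply: DeriveDef; last first.
      rewrite /derive; apply/cvg_lim => //; under eq_fun do rewrite /= [_%:A]mulr1; exact: cv.
    apply/cvg_ex; exists 0; under eq_fun do rewrite /= [_%:A]mulr1; exact: cv.
  rewrite f0; under eq_fun do rewrite addr0 subr0.
  apply/cvgr0Pnorm_lt => e e0; near=> h.
  have h0 : h != 0 by near: h; exact: nbhs_dnbhs_neq.
  rewrite normrM normfV ltr_pdivrMl ?normr_gt0 // (le_lt_trans (hC h)) //.
  rewrite -[h ^+ 2]ger0_norm ?sqr_ge0 // normrX expr2 mulrCA ltr_pM2l ?normr_gt0 //.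
  (* [C] may be 0, hence the added 1. *)
  have hC1 : `|h| < e / (C + 1).
    near: h; apply: dnbhs0_lt; rewrite divr_gt0 // ltr_wpDl //.
  rewrite (@le_lt_trans _ _ ((C + 1) * `|h|)) ?ler_wpM2r ?lerDl //.
  by rewrite mulrC -ltr_pdivlMr // ltr_wpDl.
Unshelve. all: by end_near.
Qed.

End Flat.

Section Bump.
Variables (R : realType) (n : nat).

Lemma smooth_flat (W : set 'rV[R]_n) (p : {poly R}) f : open W ->
  smooth_on W f -> smooth_on W (fun x => flat p (f x)).
Proof.
move=> oW sf.
apply: (@smooth_on_comp _ _ W setT (fun m => flat (iter m (@flat_step R) p))) => //.
by move=> m t _; rewrite iterS; exact: is_derive_flat.
Qed.

Lemma flat1_gt0 (t : R) : 0 < t -> 0 < flat 1 t.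
Proof. by move=> t0; rewrite /flat t0 hornerC mul1r expR_gt0. Qed.

Lemma flat_le0 (p : {poly R}) (t : R) : t <= 0 -> flat p t = 0.
Proof. by rewrite /flat ltNge => ->. Qed.

Lemma flat1_ge0 (t : R) : 0 <= flat 1 t.
Proof. by have [/flat_le0 ->|/flat1_gt0/ltW] := leP t 0. Qed.

(** With [u] the squared Euclidean distance to [x0] in units of [e], the quotient of flat(2 - u) by
    flat(2 - u) + flat(u - 1) is 1 for u <= 1 and 0 for u >= 2, and its denominator never vanishes.
    The norm is the sup norm: beyond distance 2e a single coordinate gives u >= 4. The choice e = r
    / 3 keeps the ball of radius 2e inside [W]. *)
Lemma exists_bump (x0 : 'rV[R]_n) (W : set 'rV[R]_n) : open W -> W x0 ->
  exists (chi : 'rV[R]_n -> R) (B K : set 'rV[R]_n),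
    [/\ smooth_on setT chi, open B /\ B x0, forall x, B x -> chi x = 1,
        compact K /\ K `<=` W & forall x, ~ K x -> chi x = 0].
Proof.
move=> oW Wx; have /nbhs_ballP[r /= r0 rW] := open_nbhs_nbhs (conj oW Wx).
pose e := r / 3; have e0 : 0 < e by rewrite divr_gt0.
pose u (x : 'rV[R]_n) := \sum_i e^-1 * e^-1 * ((x 0 i + - x0 0 i) * (x 0 i + - x0 0 i)).
have oT := @openT 'rV[R]_n.
have su : smooth_on setT u.
  apply: smooth_on_sum => // i; apply: smooth_onM => //; first exact: smooth_on_cst.
  by apply: smooth_onM => //; (apply: smooth_onD => //;
     [exact: smooth_on_coord | exact: smooth_on_cst]).
pose a x := 2 + (-1) * u x; pose b x := u x + (-1).
have sa : smooth_on setT a.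
  apply: smooth_onD => //; first exact: smooth_on_cst.
  by apply: smooth_onM => //; exact: smooth_on_cst.
have sb : smooth_on setT b by apply: smooth_onD => //; exact: smooth_on_cst.
have den x : 0 < flat 1 (a x) + flat 1 (b x).
  have [a0|a0] := ltP 0 (a x); first by rewrite ltr_wpDr ?flat1_ge0 ?flat1_gt0.
  by rewrite ltr_wpDl ?flat1_ge0 ?flat1_gt0 //; rewrite /a /b in a0 *; lra.
exists (fun x => flat 1 (a x) * (flat 1 (a x) + flat 1 (b x))^-1).
exists (u @^-1` [set t | t < 1]), [set x | `|x0 - x| <= 2 * e].
have cu : continuous u by move=> x; exact: smooth_on_continuous su I.
split.
- apply: smooth_onM => //; first exact: smooth_flat.
  apply: smooth_onV => //; last by move=> x _; rewrite gt_eqF.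
  by apply: smooth_onD => //; exact: smooth_flat.
- split; first by apply: open_comp => [x _|]; [exact: cu | exact: open_lt].
  by rewrite /= /u big1 // => i _; rewrite subrr !mulr0.
- move=> x /= ux; rewrite [flat 1 (b x)]flat_le0 ?addr0 ?divff //.
    by rewrite gt_eqF // flat1_gt0 // /a; lra.
  by rewrite /b; lra.
- split; last first.
    by move=> x /= h; apply: rW; rewrite -ball_normE /=; apply: le_lt_trans h _; rewrite /e; lra.
  apply: bounded_closed_compact.
    exists (2 * e + `|x0|); split; first by rewrite num_real.
    move=> M hM x /= hx; apply: ltW; apply: le_lt_trans hM.
    by have := ler_normB x0 (x0 - x); rewrite subKr; lra.
  rewrite (_ : mkset _ = (fun x => `|x0 - x|) @^-1` [set t | t <= 2 * e]) //.
  apply: closed_comp; last exact: closed_le.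
  move=> x _; apply: (@continuous_comp _ _ _ (fun y : 'rV[R]_n => x0 - y)); last exact: norm_continuous.
  by apply: (@continuousB _ _ _ (cst x0) id x); [exact: cst_continuous|exact: cvg_id].
- move=> x /= /negP; rewrite -ltNge => hx; rewrite flat_le0 ?mul0r //.
  have hn : mx_norm (x0 - x) != 0.
    by rewrite gt_eqF //; apply: le_lt_trans hx; rewrite mulr_ge0 // ltW.
  have [[j i] /= hi] := mx_norm_neq0 hn; rewrite ord1 in hi.
  have : 4 <= u x.
    rewrite /u (bigD1 i) //= ler_wpDr //.
      by apply: sumr_ge0 => k _; rewrite -!expr2 mulr_ge0 ?sqr_ge0.
    have : 2 * e <= `|x 0 i + - x0 0 i|.
      by rewrite distrC; move: hx; rewrite [`|x0 - x|]hi !mxE => /ltW.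
    move=> h; rewrite -invfM mulrC ler_pdivlMr ?mulr_gt0 //.
    have -> : 4 * (e * e) = (2 * e) * (2 * e) by ring.
    rewrite -!expr2 -[X in _ <= X]ger0_norm ?sqr_ge0 // normrX.
    by rewrite ler_sqr // nnegrE mulr_ge0 // ltW.
  by rewrite /a; lra.
Qed.

End Bump.

(** * A uniqueness lemma for linear ODEs *)

Section LinearODE.
Variable R : realType.

(* Gronwall on an interval of length less than 1/C: the maximum of the v j is
   at most C times the length times itself. *)
Lemma linear_ode_step (I : finType) (v : I -> R -> R) (c : I -> I -> R -> R)
    (a b C s0 : R) :
  (forall j s, s \in `[a, b] -> is_derive s 1 (v j) (\sum_i c i j s * v i s)) ->
  (forall i j s, s \in `[a, b] -> `|c i j s| <= C) -> 0 <= C ->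
  (b - a) * (#|I|%:R * C) < 1 -> s0 \in `[a, b] -> (forall j, v j s0 = 0) ->
  forall j s, s \in `[a, b] -> v j s = 0.
Proof.
move=> dv hc C0 small s0ab v0.
have ab : a <= b by move: s0ab; rewrite in_itv /= => /andP[]; exact: le_trans.
have cv j : {within `[a, b], continuous (v j)}.
  apply: derivable_within_continuous => s sab; by have [] := dv j s sab.
(* [M] is specified as the least nonnegative common bound, which also makes sense when [I] is
   empty. *)
have [M [M0 hM Mleast]] : exists M : R,
    [/\ 0 <= M, forall j s, s \in `[a, b] -> `|v j s| <= M &
      forall N, 0 <= N -> (forall j s, s \in `[a, b] -> `|v j s| <= N) -> M <= N].
  suff h (l : seq I) : exists M : R, [/\ 0 <= M, forall j, j \in l ->
      forall s, s \in `[a, b] -> `|v j s| <= M &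
      forall N, 0 <= N -> (forall j s, s \in `[a, b] -> `|v j s| <= N) -> M <= N].
    have [M [M0 hM Ml]] := h (enum I); exists M; split=> // j.
    by apply: hM; rewrite mem_enum.
  elim: l => [|j l [M [M0 hM Ml]]]; first by exists 0; split.
  have cn : {within `[a, b], continuous (fun s => `|v j s|)}.
    move=> s; apply: continuous_comp; [exact: cv|exact: norm_continuous].
  have [c0 c0ab hc0] := EVT_max ab cn.
  exists (Num.max M `|v j c0|); split; first by rewrite le_max M0.
    move=> i; rewrite inE => /orP[/eqP -> s /hc0|il s /(hM _ il)];
    by rewrite le_max => ->; rewrite ?orbT.
  by move=> N N0 hN; rewrite ge_max Ml // hN.
have step (N : R) : 0 <= N -> (forall j s, s \in `[a, b] -> `|v j s| <= N) ->
    forall j s, s \in `[a, b] -> `|v j s| <= (b - a) * (#|I|%:R * C) * N.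
  move=> N0 hN.
  have der j s : s \in `[a, b] -> `|\sum_i c i j s * v i s| <= #|I|%:R * C * N.
    move=> sab; rewrite (le_trans (ler_norm_sum _ _ _)) //.
    rewrite (le_trans (y := \sum_(i : I) C * N)) //; last first.
      by rewrite sumr_const -[_ *+ _]mulr_natl mulrA.
    by apply: ler_sum => i _; rewrite normrM ler_pM ?hc ?hN.
  have main j x y : x \in `[a, b] -> y \in `[a, b] -> x <= y ->
      `|v j y - v j x| <= (b - a) * (#|I|%:R * C) * N.
    move=> xab yab xy.
    have sub s : s \in `[x, y] -> s \in `[a, b].
      move: xab yab; rewrite !in_itv /= => /andP[ax _] /andP[_ yb] /andP[xs sy].
      by rewrite (le_trans ax xs) (le_trans sy yb).
    have dxy s : s \in `]x, y[ -> is_derive s 1 (v j) (\sum_i c i j s * v i s).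
      by move=> sxy; apply: dv; apply: sub; apply: subset_itv_oo_cc.
    have cxy : {within `[x, y], continuous (v j)}.
      by apply: derivable_within_continuous => s /sub sab; have [] := dv j s sab.
    have [z zxy ->] := MVT_segment xy dxy cxy.
    rewrite normrM mulrC -mulrA ler_pM //; last exact/der/sub.
    rewrite ger0_norm ?subr_ge0 //; move: xab yab; rewrite !in_itv /=; lra.
  move=> j s sab; rewrite -[v j s]subr0 -(v0 j).
  have [le|/ltW le] := leP s0 s; first exact: main.
  by rewrite distrC; exact: main.
move=> j s sab; set k := (b - a) * (#|I|%:R * C) in small step.
have k0 : 0 <= k by rewrite mulr_ge0 ?subr_ge0 ?mulr_ge0.
suff M00 : M = 0 by apply/eqP; rewrite -normr_le0 -M00 hM.
have := Mleast _ (mulr_ge0 k0 M0) (step M M0 hM).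
move=> h; apply/eqP; rewrite eq_le M0 andbT.
have : (1 - k) * M <= 0 by lra.
by rewrite pmulr_rle0 // subr_gt0.
Qed.

End LinearODE.

(** * Hadamard's lemma *)

Section ParametricIntegral.
Variable R : realType.
Local Notation mu := (@lebesgue_measure R).
Local Notation I01 := (`[0 : R, 1]%classic).

Lemma continuous_normr (T : topologicalType) (f : T -> R) :
  continuous f -> continuous (fun x => `|f x|).
Proof.
move=> cf x; apply: (@continuous_comp _ _ _ f (fun y => `|y|)); first exact: cf.
exact: norm_continuous.
Qed.

Definition int01 (f : R -> R) : R := (\int[mu]_(u in I01) f u)%R.

Lemma integrable01 (f : R -> R) : continuous f -> mu.-integrable I01 (EFin \o f).
Proof.
move=> cf; apply: continuous_compact_integrable; first exact: segment_compact.
exact: continuous_subspaceT.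
Qed.

(** A tube lemma: by compactness of [0, 1] the given neighbourhoods of the points (x0, u) contain a
    common strip over a neighbourhood of x0. *)
Lemma near01 (T : topologicalType) (x0 : T) (P : T -> R -> Prop) :
  (forall u : R, \forall p \near ((x0, u) : (T * R)%type), P p.1 p.2) ->
  \forall x \near x0, forall u, I01 u -> P x u.
Proof.
move=> h; have /compact_near_coveringP nc : compact I01 by exact: segment_compact.
apply: nc => u _; have /= [[A B] /= [Ax Bu] AB] := h u.
by exists (B, A) => // -[a b] [/= Ba Ab]; exact: (AB (b, a)).
Qed.

Lemma int01_near (f g : R -> R) e : continuous f -> continuous g ->
  (forall u, I01 u -> `|f u - g u| <= e) -> `|int01 f - int01 g| <= e.
Proof.
move=> cf cg fg; have mI : measurable I01 by exact: measurable_itv.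
rewrite /int01 -RintegralB //; try exact: integrable01.
have cfg : continuous (fun u => f u - g u).
  by move=> u; apply: (@continuousB _ _ _ f g); [exact: cf|exact: cg].
apply: (le_trans (le_normr_Rintegral _ _)) => //; first exact: integrable01.
apply: (le_trans (le_Rintegral (f2 := fun=> e) _ _ _ _)) => //.
- by apply: integrable01; exact: continuous_normr.
- by apply: integrable01; exact: cst_continuous.
have m1 : lebesgue_measure I01 = 1%E.
  by rewrite lebesgue_measure_itv /= lte_fin ltr01 oppr0 adde0.
by rewrite Rintegral_cst //= m1 mulr1.
Qed.

Lemma continuous_slice (T : topologicalType) (phi : T * R -> R) x :
  continuous phi -> continuous (fun u => phi (x, u)).
Proof.
move=> c u; apply: (@continuous_comp _ _ _ (fun u => (x, u)) phi); last exact: c.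
exact: (cvg_pair (cvg_cst x) cvg_id).
Qed.

Lemma int01_continuous (T : topologicalType) (phi : T * R -> R) :
  continuous phi -> continuous (fun x => int01 (fun u => phi (x, u))).
Proof.
move=> c x0; apply/cvgrPdist_le => e e0.
have : \forall x \near x0, forall u, I01 u -> `|phi (x0, u) - phi (x, u)| <= e.
  apply: (near01 (P := fun x u => `|phi (x0, u) - phi (x, u)| <= e)) => u.
  have e2 : 0 < e / 2 by rewrite divr_gt0.
  have /cvgrPdist_le/(_ _ e2) h1 := c (x0, u).
  have h2 : \forall p \near (x0, u), `|phi (x0, u) - phi (x0, p.2)| <= e / 2.
    have /cvgrPdist_le/(_ _ e2) hh := @continuous_slice _ _ x0 c u.
    exists (setT, [set t | `|phi (x0, u) - phi (x0, t)| <= e / 2]) => /=.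
      by split => //; exact: filterT.
    by move=> p [_].
  near=> p; have : `|phi (x0, u) - phi p| <= e / 2 by near: p.
  have : `|phi (x0, u) - phi (x0, p.2)| <= e / 2 by near: p.
  rewrite -surjective_pairing; move=> a b.
  rewrite (le_trans (ler_distD (phi (x0, u)) _ _)) //.
  by rewrite [`|_ - phi (x0, u)|]distrC; lra.
move=> h; near=> x; apply: int01_near; try exact: continuous_slice.
by near: x.
Unshelve. all: by end_near.
Qed.

Lemma int01_derive (phi psi : R * R -> R) :
  continuous phi -> continuous psi ->
  (forall h u : R, is_derive h 1 (fun h => phi (h, u)) (psi (h, u))) ->
  is_derive (0 : R) 1 (fun h => int01 (fun u => phi (h, u))) (int01 (fun u => psi (0, u))).
Proof.
move=> cphi cpsi d.
(* The integrable majorant for differentiation under the integral sign comes from the tube lemma. *)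
have [e /= e0 he] : \forall h \near (0 : R), forall u, I01 u ->
    `|psi (h, u)| <= `|psi (0, u)| + 1.
  apply: (near01 (P := fun h u => `|psi (h, u)| <= `|psi (0, u)| + 1)) => u.
  have h1 : continuous (fun p : R * R => `|psi p| - `|psi (0, p.2)|).
    move=> p; apply: (@continuousB _ _ _ (fun p => `|psi p|) (fun p : R * R => `|psi (0, p.2)|)).
      exact: continuous_normr.
    apply: (@continuous_comp _ _ _ (fun p : R * R => p.2) (fun u => `|psi (0, u)|)).
      exact: cvg_snd.
    by apply: continuous_normr; exact: continuous_slice.
  have /cvgrPdist_le/(_ _ ltr01) := h1 (0, u); apply: filterS => -[a b] /=.
  by rewrite subrr sub0r normrN ler_norml => /andP[_]; rewrite lerBlDl.
pose f h u := phi (h, u).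
have Ia : `]- e, e[%classic (0 : R) by rewrite /= in_itv /= oppr_lt0 e0.
have G0 u : 0 <= `|psi (0, u)| + 1 by rewrite addr_ge0.
have cG : continuous (fun u => `|psi (0, u)| + 1).
  move=> u; apply: (@continuousD _ _ _ (fun u => `|psi (0, u)|) (cst 1)); last exact: cst_continuous.
  by apply: continuous_normr; exact: continuous_slice.
have d1E h u : (f ^~ u)^`()%classic h = psi (h, u) by rewrite derive1E; have [_ ->] := d h u.
have A1 h : `]- e, e[%classic h -> mu.-integrable I01 (EFin \o f h).
  by move=> _; apply: integrable01; exact: continuous_slice.
have A2 h u : `]- e, e[%classic h -> I01 u -> derivable (f ^~ u) h 1.
  by move=> _ _; have [] := d h u.
have A3 h u : `]- e, e[%classic h -> I01 u ->
    `|partial1of2 f h u| <= `|psi (0, u)| + 1.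
  move=> Ih Iu; rewrite /partial1of2 d1E; apply: he => //=.
  by rewrite sub0r normrN ltr_norml; move: Ih; rewrite /= in_itv.
have D := @derivable_under_integral R _ _ mu f I01 (measurable_itv _) _ _ _ Ia A1 A2 (fun u => `|psi (0, u)| + 1) G0 (integrable01 cG) A3.
have E := @differentiation_under_integral R _ _ mu f I01 (measurable_itv _) _ _ _ Ia A1 A2 (fun u => `|psi (0, u)| + 1) G0 (integrable01 cG) A3.
apply: DeriveDef; first exact: D.
rewrite -derive1E E; apply: eq_Rintegral => u _.
by rewrite /partial1of2 d1E.
Qed.

End ParametricIntegral.

Section Hadamard.
Variables (R : realType) (n : nat).
Implicit Types (x z : 'rV[R]_n) (c : 'I_n -> R -> R) (w : R -> R).
Local Notation e i := (delta_mx 0 i : 'rV[R]_n).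

(** Each coordinate of x - z has its own scaling [c i u], so that paths which move one coordinate at
    a time are covered. *)
Definition stretch z c x (u : R) : 'rV[R]_n := z + \sum_i (c i u * (x 0 i - z 0 i)) *: e i.

Lemma stretchE z c x u i : stretch z c x u 0 i = z 0 i + c i u * (x 0 i - z 0 i).
Proof.
rewrite /stretch mxE summxE (bigD1 i) //= big1 ?addr0.
  by rewrite !mxE !eqxx mulr1.
by move=> j /negbTE ji; rewrite !mxE eqxx /= eq_sym ji mulr0.
Qed.

Lemma stretch_shift z c x u i (h : R) :
  stretch z c (h *: e i + x) u = h *: (c i u *: e i) + stretch z c x u.
Proof.
apply/rowP => j; rewrite stretchE [RHS]mxE stretchE !mxE eqxx /=.
by case: eqP => [->|_]; rewrite ?mulr1 ?mulr0; ring.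
Qed.

Lemma stretch_continuous z c : (forall i, continuous (c i)) ->
  continuous (fun p : 'rV[R]_n * R => stretch z c p.1 p.2).
Proof.
move=> cc p; rewrite /stretch.
apply: (@continuousD _ _ _ (cst z) (fun p : 'rV[R]_n * R =>
  \sum_i (c i p.2 * (p.1 0 i - z 0 i)) *: e i)); first exact: cst_continuous.
apply: cvg_big => [|i _]; first exact: add_continuous.
apply: (@continuousZr_tmp _ _ _ (fun p : 'rV[R]_n * R => c i p.2 * (p.1 0 i - z 0 i)) (e i)).
apply: (@continuousM _ _ (fun p : 'rV[R]_n * R => c i p.2)
  (fun p : 'rV[R]_n * R => p.1 0 i - z 0 i)).
  by apply: (@continuous_comp _ _ _ (fun p : 'rV[R]_n * R => p.2) (c i));
     [exact: cvg_snd|exact: cc].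
apply: (@continuousB _ _ _ (fun p : 'rV[R]_n * R => p.1 0 i) (cst (z 0 i)));
  last exact: cst_continuous.
apply: (@continuous_comp _ _ _ (fun p : 'rV[R]_n * R => p.1)
  (fun x : 'rV[R]_n => x 0 i)); first exact: cvg_fst.
exact: coord_continuous.
Qed.

Lemma is_derive_line_at (f : 'rV[R]_n -> R) x v (h df : R) :
  is_derive (h *: v + x) v f df -> is_derive h 1 (fun t : R => f (t *: v + x)) df.
Proof.
move=> /is_derive_lineP d; apply/is_derive_lineP.
suff -> : (fun t : R => f ((t *: (1 : R) + h) *: v + x)) =
    (fun t => f (t *: v + (h *: v + x))) by [].
by apply/funext => t; rewrite [t *: _]mulr1 scalerDl addrA.
Qed.

Lemma is_derive_scale (f : 'rV[R]_n -> R) x v (a df : R) :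
  is_derive x v f df -> is_derive x (a *: v) f (a * df).
Proof.
move=> /is_derive_lineP d; apply/is_derive_lineP.
suff -> : (fun h : R => f (h *: (a *: v) + x)) =
    (fun h => (fun h => f (h *: v + x)) (a * h)).
  rewrite mulrC; apply: (@is_derive1_comp R (fun h => f (h *: v + x)) (fun h => a * h) 0).
    by rewrite mulr0.
  by have h := is_deriveZ a (is_derive_id (0 : R) 1); apply: (is_derive_eq h); rewrite [_%:A]mulr1.
by apply/funext => h; rewrite scalerA [h * a]mulrC.
Qed.

(** The weight [w] makes this class of functions closed under partial derivatives: the i-th one
    multiplies the weight by [c i]. Smoothness then follows by induction. *)
Definition stretch_mean z c w (g : 'rV[R]_n -> R) x : R :=
  int01 (fun u => w u * g (stretch z c x u)).

Lemma stretch_integrand_continuous z c w g : (forall i, continuous (c i)) ->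
  continuous w -> continuous g ->
  continuous (fun p : 'rV[R]_n * R => w p.2 * g (stretch z c p.1 p.2)).
Proof.
move=> cc cw cg p.
apply: (@continuousM _ _ (fun p : 'rV[R]_n * R => w p.2)
  (fun p : 'rV[R]_n * R => g (stretch z c p.1 p.2))).
  by apply: (@continuous_comp _ _ _ (fun p : 'rV[R]_n * R => p.2) w);
     [exact: cvg_snd|exact: cw].
by apply: (@continuous_comp _ _ _ (fun p : 'rV[R]_n * R => stretch z c p.1 p.2) g);
   [exact: stretch_continuous|exact: cg].
Qed.

Lemma smooth_continuous (g : 'rV[R]_n -> R) : smooth_on setT g -> continuous g.
Proof. by move=> sg x; exact: smooth_on_continuous sg I. Qed.

Lemma stretch_mean_derive z c w g x i : (forall i, continuous (c i)) ->
  continuous w -> smooth_on setT g ->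
  is_derive x (e i) (stretch_mean z c w g)
    (stretch_mean z c (fun u => w u * c i u) (fun y => 'D_(e i) g y) x).
Proof.
move=> cc cw sg; apply/is_derive_lineP.
have cline (F : 'rV[R]_n * R -> R) : continuous F ->
    continuous (fun p : R * R => F (p.1 *: e i + x, p.2)).
  move=> cF p; apply: (@continuous_comp _ _ _ (fun p : R * R => (p.1 *: e i + x, p.2)) F);
    last exact: cF.
  have h1 : {for p, continuous (fun p : R * R => p.1 *: e i + x)}.
    apply: (@continuousD _ _ _ (fun p : R * R => p.1 *: e i) (cst x)); last exact: cst_continuous.
    by apply: (@continuousZr_tmp _ _ _ (fun p : R * R => p.1) (e i)); exact: cvg_fst.
  exact: (cvg_pair h1 (@cvg_snd _ _ _ _ _)).
have cwc : continuous (fun u => w u * c i u).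
  by move=> u; apply: (@continuousM _ _ w (c i)); [exact: cw|exact: cc].
have := @int01_derive R
  (fun p => w p.2 * g (stretch z c (p.1 *: e i + x) p.2))
  (fun p => w p.2 * c i p.2 * 'D_(e i) g (stretch z c (p.1 *: e i + x) p.2)).
rewrite /= scale0r add0r; apply.
- by apply: (cline (fun p => w p.2 * g (stretch z c p.1 p.2)));
    apply: stretch_integrand_continuous => //; exact: smooth_continuous.
- apply: (cline (fun p => w p.2 * c i p.2 * 'D_(e i) g (stretch z c p.1 p.2))).
  apply: (@stretch_integrand_continuous z c (fun u => w u * c i u)
    (fun y => 'D_(e i) g y) cc cwc).
  by apply: smooth_continuous; exact: smooth_on_derive.
move=> h u; rewrite -mulrA.
have -> : (fun h : R => w u * g (stretch z c (h *: e i + x) u)) =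
    w u \*: (fun h : R => g (h *: (c i u *: e i) + stretch z c x u)).
  by apply/funext => t; rewrite stretch_shift.
apply: is_deriveZ; rewrite stretch_shift; apply: is_derive_line_at.
by apply: is_derive_scale; apply: derivableP; exact: smooth_on_derivable sg I.
Qed.

Lemma smooth_stretch_mean z c w g : (forall i, continuous (c i)) ->
  continuous w -> smooth_on setT g -> smooth_on setT (stretch_mean z c w g).
Proof.
move=> cc + + r; elim: r w g => [|r IH] w g cw sg; split=> //.
- move=> x _; apply: (int01_continuous (phi := fun p => w p.2 * g (stretch z c p.1 p.2))).
  by apply: stretch_integrand_continuous => //; exact: smooth_continuous.
- move=> x _; apply: (int01_continuous (phi := fun p => w p.2 * g (stretch z c p.1 p.2))).
  by apply: stretch_integrand_continuous => //; exact: smooth_continuous.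
move=> i; have d x := stretch_mean_derive z x i cc cw sg.
split=> [x _|]; first by have [] := d x.
have -> : (fun x => 'D_(e i) (stretch_mean z c w g) x) =
    stretch_mean z c (fun u => w u * c i u) (fun y => 'D_(e i) g y).
  by apply/funext => x; have [_ ->] := d x.
apply: IH; last exact: smooth_on_derive.
by move=> u; apply: (@continuousM _ _ w (c i)); [exact: cw|exact: cc].
Qed.

(** The difference f x - f z telescopes over the corners [P k], which take their first k coordinates
    from x and the others from z. On the j-th edge the fundamental theorem of calculus leaves x_j -
    z_j times the mean of the j-th partial derivative. At x = z all edges shrink to z. *)
Lemma hadamard (f : 'rV[R]_n -> R) z : smooth_on setT f ->
  exists g : 'I_n -> 'rV[R]_n -> R,
    [/\ forall j, smooth_on setT (g j),
        forall j, g j z = 'D_(e j) f z &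
        forall x, f x = f z + \sum_j (x 0 j - z 0 j) * g j x].
Proof.
move=> sf.
(* [c j] describes the j-th edge: earlier coordinates are already those of x, the j-th one moves,
   later ones are still those of z. *)
pose c (j : 'I_n) (i : 'I_n) (u : R) : R :=
  if (i < j)%N then 1 else if i == j then u else 0.
have cc j i : continuous (c j i).
  rewrite /c; case: (i < j)%N; first exact: cst_continuous.
  by case: (i == j); [move=> ?; exact: cvg_id|exact: cst_continuous].
pose g j := stretch_mean z (c j) (fun=> 1) (fun y => 'D_(e j) f y).
have c1 : continuous (fun _ : R => 1 : R) by exact: cst_continuous.
have m1 : lebesgue_measure (`[0 : R, 1]%classic) = 1%E.
  by rewrite lebesgue_measure_itv /= lte_fin ltr01 oppr0 adde0.
exists g; split.
- by move=> j; apply: smooth_stretch_mean => //; exact: smooth_on_derive.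
- move=> j; rewrite /g /stretch_mean /int01.
  have zE u : stretch z (c j) z u = z.
    by apply/rowP => i; rewrite stretchE subrr mulr0 addr0.
  transitivity (\int[lebesgue_measure]_(u in `[0 : R, 1]%classic) 'D_(e j) f z)%R.
    by apply: eq_Rintegral => u _; rewrite mul1r zE.
  by rewrite Rintegral_cst //= m1 mulr1.
move=> x; pose P k : 'rV[R]_n := \row_i (if (i < k)%N then x 0 i else z 0 i).
have P0 : P 0%N = z by apply/rowP => i; rewrite mxE.
have Pn : P n = x by apply/rowP => i; rewrite mxE ltn_ord.
rewrite -{1}Pn -{1}P0.
rewrite -[LHS](subrK (f (P 0%N))) addrC; congr (_ + _).
rewrite -(telescope_sumr (fun k => f (P k)) (leq0n n)) big_mkord; apply: eq_bigr => j _.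
have s0 : stretch z (c j) x 0 = P j.
  apply/rowP => i; rewrite stretchE mxE /c; case: ifP => _; first by ring.
  by case: ifP => _; ring.
have s1 : stretch z (c j) x 1 = P j.+1.
  apply/rowP => i; rewrite stretchE mxE /c.
  have -> : (i < j.+1)%N = (i < j)%N || (i == j) by rewrite ltnS leq_eqVlt orbC.
  case: (i < j)%N => /=; first by ring.
  by case: (i == j); ring.
have su u : stretch z (c j) x u = u *: ((x 0 j - z 0 j) *: e j) + P j.
  apply/rowP => i; rewrite stretchE !mxE /c eqxx /=.
  have [ij|_] := ltnP i j.
    rewrite -val_eqE /= (ltn_eqF ij) mulr0n; ring.
  by case: eqP => [->|_]; rewrite ?mulr0n ?mulr1n; ring.
pose phi u := f (stretch z (c j) x u).
have dphi (u : R) : is_derive u 1 phi ((x 0 j - z 0 j) * 'D_(e j) f (stretch z (c j) x u)).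
  rewrite (_ : phi = fun u => f (u *: ((x 0 j - z 0 j) *: e j) + P j)); last first.
    by apply/funext => t; rewrite /phi su.
  rewrite su; apply: is_derive_line_at; apply: is_derive_scale; apply: derivableP.
  exact: smooth_on_derivable sf I.
have cphi : continuous phi.
  by move=> u; apply: differentiable_continuous; apply/derivable1_diffP; have [] := dphi u.
have cD : continuous (fun u => 'D_(e j) f (stretch z (c j) x u)).
  apply: (continuous_slice (phi := fun p : 'rV[R]_n * R => 'D_(e j) f (stretch z (c j) p.1 p.2))).
  move=> p; apply: (@continuous_comp _ _ _ (fun p : 'rV[R]_n * R => stretch z (c j) p.1 p.2)
     (fun y => 'D_(e j) f y)); first exact: stretch_continuous.
  by apply: smooth_continuous; exact: smooth_on_derive.
have cD' : continuous (fun u => (x 0 j - z 0 j) * 'D_(e j) f (stretch z (c j) x u)).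
  by move=> u; apply: (@continuousM _ _ (cst (x 0 j - z 0 j))
    (fun u => 'D_(e j) f (stretch z (c j) x u))); [exact: cst_continuous|exact: cD].
have ftc := @continuous_FTC2 R (fun u => (x 0 j - z 0 j) * 'D_(e j) f (stretch z (c j) x u))
  phi 0 1 ltr01 (continuous_subspaceT cD').
rewrite -s0 -s1 -/(phi 0) -/(phi 1) /g /stretch_mean.
have <- : int01 (fun u => (x 0 j - z 0 j) * 'D_(e j) f (stretch z (c j) x u)) = phi 1 - phi 0.
  rewrite /int01 /Rintegral ftc //.
    split=> [u _||]; first by have [] := dphi u.
      by apply: cvg_at_right_filter; exact: cphi.
    by apply: cvg_at_left_filter; exact: cphi.
  by move=> u _; rewrite derive1E; have [_ ->] := dphi u.
rewrite /int01 RintegralZl //; last exact: integrable01.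
by congr (_ * _); apply: eq_Rintegral => u _; rewrite mul1r.
Qed.

End Hadamard.

(** * Graded domains *)

Section GdomAlgebra.
Variables (R : realType) (n q : nat) (d : 'I_q -> int).
Local Notation G := (gdom R n d).
Implicit Types (U V : opens G) (i j k : int).

(** All coefficients at one base point. The operations on sections act pointwise in the base, so
    their laws are inherited from [fps]. *)
Definition cf U k (f : sect U k) (x : 'rV[R]_n) : fps R q := fun a => coef f a x.

Lemma gdom_sectP U k (f g : sect U k) : (forall x, cf f x = cf g x) -> f = g.
Proof.
move=> h; apply: (@val_inj _ _ (gdom_sect d U k)).
by apply/funext => a; apply/funext => x; exact: (congr1 (fun F => F a) (h x)).
Qed.

Lemma cf_lin U k (r : R) (f g : sect U k) x : cf (r *: f + g) x = r *: cf f x + cf g x.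
Proof. by []. Qed.

Lemma cfD U k (f g : sect U k) x : cf (f + g) x = cf f x + cf g x.
Proof. by []. Qed.

Lemma cfZ U k (r : R) (f : sect U k) x : cf (r *: f) x = r *: cf f x.
Proof. by []. Qed.

Lemma cf0 U k x : cf (0 : sect U k) x = 0.
Proof. by []. Qed.

Lemma cfN U k (f : sect U k) x : cf (- f) x = - cf f x.
Proof. by []. Qed.

Lemma cf_res U V (s : V `<=` U) k (f : sect U k) x :
  cf (gres s f) x = if x \in oset V then cf f x else 0.
Proof. by apply/funext => a; rewrite /cf /= /series_res; case: ifP. Qed.

Lemma cf_one U x : cf (gone U) x = if x \in oset U then fone else 0.
Proof.
apply/funext => a; rewrite /cf /= /series_one -/mono0.
by case: (x \in _); rewrite ?andbT ?andbF // /fone; case: eqP.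
Qed.

Lemma cf_mul U i j k (e : i + j = k) (f : sect U i) (g : sect U j) x :
  cf (gmul e f g) x = fmul d (cf f x) (cf g x).
Proof. by apply/funext => a; rewrite /cf /= series_mulE. Qed.

Lemma cf_homog U k (f : sect U k) x : fhomog d k (cf f x).
Proof. by move=> a; have /asboolP[_ h] := coefP f; move=> /h[]. Qed.

Lemma cf_smooth U k (f : sect U k) a : smooth_on (oset U) (fun x => cf f x a).
Proof. by have /asboolP[h _] := coefP f; exact: h. Qed.

Lemma cf_out U k (f : sect U k) x : ~ oset U x -> cf f x = 0.
Proof.
move=> nU; apply/funext => a; apply/eqP/negP => /negP.
by have /asboolP[_ h] := coefP f; move=> /h[].
Qed.

Lemma is_sectionP (U : opens 'rV[R]_n) k (F : Defs.series R n q) :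
  (forall a, smooth_on (oset U) (F a)) ->
  (forall x, oset U x -> fhomog d k (F^~ x)) ->
  (forall x, ~ oset U x -> F^~ x = 0) -> F \in section_pred d U k.
Proof.
move=> sF hF oF; apply/asboolP; split=> // a x nz.
have Ux : oset U x.
  apply: contrapT => /oF e; move: nz.
  by have /= -> := congr1 (fun g => g a) e; rewrite eqxx.
by have [] := hF x Ux a nz.
Qed.

Lemma gdom_algebras : graded_commutative_algebras G.
Proof.
split.
- move=> U i j k e f r g h; apply: gdom_sectP => x.
  by rewrite cf_lin !cf_mul cf_lin fmul_linearr.
- move=> U i j k e g r f h; apply: gdom_sectP => x.
  by rewrite cf_lin !cf_mul cf_lin fmul_linearl.
- by move=> U i j k ij jk m eij ejk e e' f g h; apply: gdom_sectP => x; rewrite !cf_mul fmulA.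
- move=> U k e f; apply: gdom_sectP => x; rewrite cf_mul cf_one.
  case: ifPn => [_|/negP nx].
    by apply: fmul1l => a /cf_homog[].
  have nU : ~ oset U x by move=> Ux; apply: nx; rewrite inE.
  rewrite (cf_out _ nU); apply/funext => a.
  by rewrite /fmul; case: ifP => // _; rewrite big1 // => b _; rewrite mul0r mulr0.
- move=> U i j k e e' f g; apply: gdom_sectP => x.
  by rewrite cfZ !cf_mul (fmulC (i := i) (j := j)) //; exact: cf_homog.
Qed.

Lemma eq_smooth_local (W : set 'rV[R]_n) (f : 'rV[R]_n -> R) : open W ->
  (forall x, W x -> exists B : set 'rV[R]_n, [/\ open B, B x & smooth_on B f]) ->
  smooth_on W f.
Proof.
move=> oW + r; elim: r f => [|r IH] f h; split=> //.
- by move=> x Wx; have [B [_ Bx sf]] := h x Wx; exact: smooth_on_continuous sf Bx.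
- by move=> x Wx; have [B [_ Bx sf]] := h x Wx; exact: smooth_on_continuous sf Bx.
move=> i; split.
  by move=> x Wx; have [B [_ Bx sf]] := h x Wx; exact: smooth_on_derivable sf Bx.
apply: IH => x Wx; have [B [oB Bx sf]] := h x Wx; exists B; split=> //.
exact: smooth_on_derive.
Qed.

Lemma gdom_sheaf : is_sheaf G.
Proof.
move=> U I V s cov k f comp.
have loc x (i j : I) : oset (V i) x -> oset (V j) x -> cf (f i) x = cf (f j) x.
  move=> Vi Vj; pose W := Opens (openI (oopen (V i)) (oopen (V j))).
  have /(congr1 (fun g => cf g x)) := comp i j W (@subIsetl _ _ _) (@subIsetr _ _ _).
  by rewrite !cf_res mem_set.
(* One member of the cover is chosen at each point of [U]; [None] serves for the points outside
   [U]. *)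
have ch x : exists i : option I, oset U x -> if i is Some i then oset (V i) x else False.
  have [/cov[i _ Vi]|nU] := pselect (oset U x); [by exists (Some i)|by exists None].
have [c hc] := choice ch.
pose F : Defs.series R n q := fun a x =>
  if x \in oset U then (if c x is Some i then cf (f i) x a else 0) else 0.
have FE (i : I) x : oset (V i) x -> F^~ x = cf (f i) x.
  move=> Vi; have Ux := s i x Vi; apply/funext => a; rewrite /F mem_set //.
  by have := hc x Ux; case: (c x) => // j Vj; rewrite (loc x j i).
have PF : F \in section_pred d U k.
  apply: is_sectionP => [a|x Ux|x nU].
  - apply: eq_smooth_local; first exact: oopen.
    move=> x Ux; have [i _ Vi] := cov x Ux; exists (V i); split=> //; first exact: oopen.
    apply: (@eq_smooth_on _ _ _ (fun x => cf (f i) x a)); first exact: oopen.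
      by move=> y Vy; have := FE i y Vy => /(congr1 (fun g => g a)).
    exact: cf_smooth.
  - by have [i _ Vi] := cov x Ux; rewrite (FE i x Vi); exact: cf_homog.
  - by apply/funext => a; rewrite /F memNset.
exists (GDomSect PF); split.
  move=> i; apply: gdom_sectP => x; rewrite cf_res; case: ifPn => [/set_mem Vi|/negP nV].
    by rewrite -(FE i x Vi).
  by rewrite cf_out // => Vi; apply: nV; rewrite inE.
move=> g hg; apply: gdom_sectP => x.
have [Ux|nU] := pselect (oset U x); last by rewrite !cf_out.
have [i _ Vi] := cov x Ux; rewrite [LHS](FE i x Vi) -(hg i) cf_res mem_set //.
Qed.

Lemma gdom_hausdorff : hausdorff_space G.
Proof. exact: norm_hausdorff. Qed.

Lemma gdom_second_countable : @second_countable G.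
Proof.
pose c (p : 'rV[rat]_n * nat) : set 'rV[R]_n :=
  ball (map_mx (@ratr R) p.1) (p.2.+1%:R^-1).
exists (range c); first exact: (sub_countable (card_image_le c setT) (countableP _)).
split; first by move=> _ [p _ <-]; exact: ball_open.
move=> x A /nbhs_ballP[e /= e0 xA].
have [N hN] : exists N : nat, N.+1%:R^-1 < e / 2.
  have [//|N hN] := @ltr_add_invr R 0 (e / 2) _; first by rewrite divr_gt0.
  by exists N; rewrite add0r in hN.
have N0 : (0 : R) < N.+1%:R^-1 by rewrite invr_gt0.
have ch (i : 'I_n) : exists r : rat, `|x 0 i - ratr r| < N.+1%:R^-1.
  have [r _ /andP[r1 r2]] : exists2 r : rat, true & x 0 i - N.+1%:R^-1 < ratr r < x 0 i + N.+1%:R^-1.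
    have lt : x 0 i - N.+1%:R^-1 < x 0 i + N.+1%:R^-1.
      by rewrite ltrBlDr -addrA ltrDl addr_gt0.
    by have [r hr] := rat_in_itvoo lt; exists r => //; move: hr; rewrite in_itv.
  exists r; rewrite ltr_norml.
  move: (x 0 i) (ratr r : R) (N.+1%:R^-1 : R) r1 r2 => a b c' r1 r2.
  by apply/andP; split; lra.
have [r hr] := choice ch.
have cx : c (\row_i r i, N) x.
  rewrite /c /=; split=> // i j; rewrite ord1 !mxE -ball_normE /=.
  by rewrite distrC; exact: hr.
exists (c (\row_i r i, N)); first by split=> //; exists (\row_i r i, N).
move=> y cy; apply: xA; apply: (@le_ball _ _ x (N.+1%:R^-1 + N.+1%:R^-1)); first by rewrite [e]splitr lerD // ltW.
by apply: (@ball_triangle _ _ (map_mx (@ratr R) (\row_i r i))) => //; exact/ball_sym.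
Qed.

End GdomAlgebra.

Arguments cf_homog {R n q d U k} f x.

Section GdomManifold.
Variables (R : realType).

Lemma gres_comp (M : gspace R) (U V W : opens M) (s : V `<=` U) (t : W `<=` V) k
    (f : sect U k) : gres t (gres s f) = gres (subset_trans t s) f.
Proof. exact: gres_gres. Qed.

Lemma gres_irr (M : gspace R) (U V : opens M) (s t : V `<=` U) k (f : sect U k) :
  gres s f = gres t f.
Proof. by rewrite (Prop_irrelevance s t). Qed.

Lemma giso_refl (M : gspace R) : giso M M.
Proof.
exists (gid M), (gid M).
have h : gmap_eq (gcomp (gid M) (gid M)) (gid M).
  by split=> // V k f W s s'; rewrite /= !gres_comp; exact: gres_irr.
by split.
Qed.

Lemma gdom_manifold n q (d : 'I_q -> int) : (forall i, d i != 0) ->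
  gmanifold (gdom R n d).
Proof.
move=> d0; split.
- exact: gdom_hausdorff.
- exact: gdom_second_countable.
- exact: gdom_algebras.
- exact: gdom_sheaf.
- move=> m; exists (opensT _), n, q, d, (opensT _); split=> //.
  exact: giso_refl.
Qed.

End GdomManifold.

(** * Inverses of power series and invertible germs *)

Section FpsInverse.
Variables (R : realType) (q : nat) (d : 'I_q -> int).
Implicit Types (F G H : fps R q).

Lemma fpsDE F G a : (F + G) a = F a + G a. Proof. by []. Qed.

Lemma fpsNE F a : (- F) a = - F a. Proof. by []. Qed.

Lemma fpsZE (r : R) F a : (r *: F) a = r * F a. Proof. by []. Qed.

Lemma fone0 : (fone : fps R q) mono0 = 1.
Proof. by rewrite /fone eqxx. Qed.

Definition fpow F m : fps R q := iter m (fmul d F) fone.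

(** The geometric series of 1 - F / F_0, divided by the body F_0. Its m-th power has order at least
    m, so the coefficient at [a] needs only finitely many powers, in a number depending on [a]. *)
Definition finv F : fps R q := fun a =>
  (F mono0)^-1 * (\sum_(m < (mono_size a).+1) fpow (fone - (F mono0)^-1 *: F) m) a.

Lemma fmulDr F G H : fmul d F (G + H) = fmul d F G + fmul d F H.
Proof. by have := fmul_linearr d F 1 G H; rewrite !scale1r. Qed.

Lemma fmulDl F G H : fmul d (F + G) H = fmul d F H + fmul d G H.
Proof. by have := fmul_linearl d H 1 F G; rewrite !scale1r. Qed.

Lemma fmul0r F : fmul d F 0 = 0.
Proof. by have := fmulDr F 0 0; rewrite !addr0; exact: addr_self0. Qed.

Lemma fmul0l F : fmul d 0 F = 0.
Proof. by have := fmulDl 0 0 F; rewrite !addr0; exact: addr_self0. Qed.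

Lemma fmulZr r F G : fmul d F (r *: G) = r *: fmul d F G.
Proof. by have := fmul_linearr d F r G 0; rewrite !addr0 fmul0r addr0. Qed.

Lemma fmulZl r F G : fmul d (r *: F) G = r *: fmul d F G.
Proof. by have := fmul_linearl d G r F 0; rewrite !addr0 fmul0l addr0. Qed.

Lemma fmulNr F G : fmul d F (- G) = - fmul d F G.
Proof. by rewrite -scaleN1r fmulZr scaleN1r. Qed.

Lemma fmulNl F G : fmul d (- F) G = - fmul d F G.
Proof. by rewrite -scaleN1r fmulZl scaleN1r. Qed.

Lemma fmul_sumr F (I : Type) (r : seq I) (G : I -> fps R q) :
  fmul d F (\sum_(i <- r) G i) = \sum_(i <- r) fmul d F (G i).
Proof. by elim/big_rec2: _ => [|i x y _ <-]; rewrite ?fmul0r ?fmulDr. Qed.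

Lemma fmul_suml F (I : Type) (r : seq I) (G : I -> fps R q) :
  fmul d (\sum_(i <- r) G i) F = \sum_(i <- r) fmul d (G i) F.
Proof. by elim/big_rec2: _ => [|i x y _ <-]; rewrite ?fmul0l ?fmulDl. Qed.

Lemma fps_sumE (I : Type) (r : seq I) (G : I -> fps R q) a :
  (\sum_(i <- r) G i) a = \sum_(i <- r) G i a.
Proof. by elim/big_rec2: _ => [|i x y _ <-]. Qed.

Lemma ford_sum N (I : Type) (r : seq I) (G : I -> fps R q) :
  (forall i, ford N (G i)) -> ford N (\sum_(i <- r) G i).
Proof. by move=> h a aN; rewrite fps_sumE big1 // => i _; exact: h. Qed.

Lemma ford_pow F m : ford 1 F -> ford m (fpow F m).
Proof. by move=> hF; elim: m => [|m IH] //; rewrite -add1n; exact: ford_mul. Qed.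

Lemma fhomog_pow F m : fhomog d 0 F -> fhomog d 0 (fpow F m).
Proof.
move=> hF; elim: m => [|m IH]; first exact: fhomog_one.
by rewrite -[0 : int]addr0; exact: fhomog_mul.
Qed.

Lemma finv_step F : fhomog d 0 F -> F mono0 != 0 ->
  ford 1 (fone - (F mono0)^-1 *: F) /\ fhomog d 0 (fone - (F mono0)^-1 *: F).
Proof.
move=> hF F0; split.
  move=> a; rewrite ltnS leqn0 mono_size_eq0 => /eqP ->.
  by rewrite fpsDE fpsNE fpsZE mulVf // /fone eqxx subrr.
by rewrite addrC -scaleNr; apply: fhomog_lin => //; exact: fhomog_one.
Qed.

Lemma fhomog_inv F : fhomog d 0 F -> F mono0 != 0 -> fhomog d 0 (finv F).
Proof.
move=> hF F0; have [_ hR] := finv_step hF F0; move=> a.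
rewrite /finv mulf_eq0 negb_or => /andP[_].
rewrite fps_sumE => nz; have /existsP[m] : [exists m : 'I_(mono_size a).+1,
    fpow (fone - (F mono0)^-1 *: F) m a != 0].
  by apply: contraNT nz; rewrite negb_exists => /forallP h; rewrite big1 // => i _; apply/eqP; have := h i; rewrite negbK.
exact: (fhomog_pow (m := m) hR).
Qed.

(** For the coefficient at [a], all truncations at exponents below [a] may be replaced by the one at
    [N]. The product then telescopes to 1 minus an N-th power, whose order exceeds the size of
    [a]. *)
Lemma fmul_inv F : fhomog d 0 F -> F mono0 != 0 -> fmul d F (finv F) = fone.
Proof.
move=> hF F0; have [oR hR] := finv_step hF F0.
set Rr := fone - _ in oR hR *; apply/funext => a; set N := (mono_size a).+1.
have okF b : F b != 0 -> mono_ok d b by move=> /hF[].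
have E (c : mono q) : mono_le c a ->
    finv F c = ((F mono0)^-1 *: \sum_(m < N) fpow Rr m) c.
  move=> ca; rewrite fpsZE.
  congr (_ * _); rewrite !fps_sumE.
  have cN : ((mono_size c).+1 <= N)%N.
    by rewrite ltnS; apply: leq_sum => i _; exact: (mono_leP _ _ ca).
  rewrite -!(big_mkord xpredT (fun m => fpow Rr m c)) [RHS](big_cat_nat (leq0n _) cN) /=.
  rewrite [X in _ = _ + X]big_nat [X in _ = _ + X]big1 ?addr0 // => m /andP[cm _].
  exact: (ford_pow oR).
transitivity (fmul d F ((F mono0)^-1 *: \sum_(m < N) fpow Rr m) a).
  rewrite /fmul; case: ifP => // _; apply: eq_big_seq => b; rewrite mem_below => ba.
  by rewrite E // mono_le_sub.
rewrite fmulZr -fmulZl.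
have -> : (F mono0)^-1 *: F = fone - Rr by rewrite /Rr opprB addrC subrK.
rewrite fmulDl fmulNl fmul1l; last first.
  move=> b; rewrite fps_sumE => nz; have /existsP[m] : [exists m : 'I_N, fpow Rr m b != 0].
    by apply: contraNT nz; rewrite negb_exists => /forallP h; rewrite big1 // => i _; apply/eqP; have := h i; rewrite negbK.
  by move=> /(fhomog_pow hR)[].
rewrite fmul_sumr.
under [X in _ - X]eq_bigr do rewrite -[fmul d Rr _]/(fpow Rr _.+1).
have tele : \sum_(m < N) fpow Rr m - \sum_(m < N) fpow Rr m.+1 = fone - fpow Rr N.
  elim: (N) => [|k IH]; first by rewrite !big_ord0 subr0 subrr.
  by rewrite !big_ord_recr /= opprD addrACA IH addrA subrK.
have z : fpow Rr N a = 0 by exact: (ford_pow (m := N) oR).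
by rewrite tele fpsDE fpsNE z subr0.
Qed.

Lemma smooth_fmul n (W : set 'rV[R]_n) (F G : 'rV[R]_n -> fps R q) : open W ->
  (forall a, smooth_on W (fun x => F x a)) -> (forall a, smooth_on W (fun x => G x a)) ->
  forall a, smooth_on W (fun x => fmul d (F x) (G x) a).
Proof.
move=> oW sF sG a; rewrite /fmul; case: (mono_ok d a); last exact: smooth_on_cst.
elim: (below a) => [|b s IH].
  by under eq_fun do rewrite big_nil; exact: smooth_on_cst.
under eq_fun do rewrite big_cons; apply: smooth_onD => //.
apply: smooth_onM => //; first exact: smooth_on_cst.
exact: smooth_onM.
Qed.

Lemma smooth_finv n (W : set 'rV[R]_n) (F : 'rV[R]_n -> fps R q) : open W ->
  (forall a, smooth_on W (fun x => F x a)) -> (forall x, W x -> F x mono0 != 0) ->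
  forall a, smooth_on W (fun x => finv (F x) a).
Proof.
move=> oW sF F0 a; have si : smooth_on W (fun x => (F x mono0)^-1) by exact: smooth_onV.
apply: smooth_onM => //; under eq_fun do rewrite fps_sumE.
apply: smooth_on_sum => // m.
have sR b : smooth_on W (fun x => (fone - (F x mono0)^-1 *: F x) b).
  rewrite (_ : (fun x => _) = (fun x => fone b + (-1) * ((F x mono0)^-1 * F x b))).
    apply: smooth_onD => //; first exact: smooth_on_cst.
    by apply: smooth_onM => //; [exact: smooth_on_cst|exact: smooth_onM].
  by apply/funext => x; rewrite mulN1r.
have : forall b, smooth_on W (fun x => fpow (fone - (F x mono0)^-1 *: F x) m b).
  elim: (m : nat) => [|k IH] b; first exact: smooth_on_cst.
  exact: (smooth_fmul oW sR IH).
exact.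
Qed.

End FpsInverse.

Section GdomUnits.
Variables (R : realType) (n q : nat) (d : 'I_q -> int).
Local Notation G := (gdom R n d).

Lemma gunit_coef (U : opens G) k (f : sect U k) x :
  gunit_at f x -> cf f x mono0 != 0.
Proof.
move=> [W [s [g [Wx /(congr1 (fun h => cf h x mono0))]]]].
rewrite cf_mul fmul0 cf_one cf_res mem_set // /fone eqxx => e.
apply/eqP => f0; move: e; rewrite f0 mul0r => /eqP.
by rewrite eq_sym oner_eq0.
Qed.

(** The body stays nonzero near x, and there the inverse series has smooth coefficients. So the
    invertible germs are those with nonzero body, which makes the locality condition of [gmap]
    checkable on bodies. *)
Lemma coef_gunit (U : opens G) k (f : sect U k) x :
  oset U x -> cf f x mono0 != 0 -> gunit_at f x.
Proof.
move=> Ux f0; have k0 : k = 0.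
  by have [_ <-] := cf_homog f x mono0 f0; rewrite mono_deg0.
subst k.
pose W0 : set 'rV[R]_n := oset U `&` [set y | cf f y mono0 != 0].
have oW0 : open W0.
  rewrite openE => y [Uy fy].
  have cy : {for y, continuous (fun y => cf f y mono0)}.
    exact: smooth_on_continuous (cf_smooth f mono0) Uy.
  apply: filterI; first exact: (open_nbhs_nbhs (conj (oopen U) Uy)).
  have := cy [set t | t != 0]; apply; apply: open_nbhs_nbhs; split=> //.
pose W : opens G := Opens oW0.
have s : W `<=` U by move=> y [].
pose F : Defs.series R n q := fun a y => if y \in oset W then finv d (cf f y) a else 0.
have PF : F \in section_pred d W (- 0).
  rewrite oppr0; apply: is_sectionP => [a|y Wy|y nW].
  - apply: (@eq_smooth_on _ _ _ (fun y => finv d (cf f y) a)); first exact: oopen.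
      by move=> y Wy; rewrite /F mem_set.
    apply: smooth_finv; first exact: oopen; last by move=> y [].
    by move=> b; apply: smooth_onS s (cf_smooth f b).
  - rewrite (_ : F^~ y = finv d (cf f y)); first exact: (fhomog_inv (cf_homog f y) (proj2 Wy)).
    by apply/funext => a; rewrite /F mem_set.
  - by apply/funext => a; rewrite /F memNset.
exists W, s, (GDomSect PF); split => //; apply: gdom_sectP => y.
rewrite cf_mul cf_one cf_res; case: ifPn => [/set_mem Wy|_]; last by rewrite fmul0l.
have -> : cf (GDomSect PF : sect W (- 0)) y = finv d (cf f y).
  by apply/funext => a; rewrite /cf /= /F mem_set.
exact: (fmul_inv (cf_homog f y) (proj2 Wy)).
Qed.

End GdomUnits.

(** * Maps between graded domains *)

Section GdomMap.
Variables (R : realType) (n1 n2 q1 q2 : nat) (d1 : 'I_q1 -> int) (d2 : 'I_q2 -> int).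
Variables (h : 'rV[R]_n1 -> 'rV[R]_n2) (T : fps R q2 -> fps R q1).
Hypothesis hc : forall V, open V -> open (h @^-1` V).
Hypothesis T_linear : linear T.
Hypothesis T_one : T fone = fone.
Hypothesis T_mul : forall i j F G, fhomog d2 i F -> fhomog d2 j G ->
  T (fmul d2 F G) = fmul d1 (T F) (T G).
Hypothesis T_homog : forall i F, fhomog d2 i F -> fhomog d1 i (T F).
Hypothesis T_mono0 : forall F, T F mono0 = F mono0.
Hypothesis T_smooth : forall (V : opens (gdom R n2 d2)) k (f : sect V k) a,
  smooth_on (h @^-1` V) (fun x => T (cf f (h x)) a).

Lemma gdom_map_raw_in (V : opens (gdom R n2 d2)) k (f : sect V k) :
  (fun a x => if x \in (h @^-1` V) then T (cf f (h x)) a else 0)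
    \in section_pred d1 (Opens (hc (oopen V))) k.
Proof.
apply: is_sectionP => /= [a|x Vx|x nV].
- apply: (@eq_smooth_on _ _ _ (fun x => T (cf f (h x)) a)); last exact: T_smooth.
    exact: hc (oopen V).
  by move=> x Vx; rewrite mem_set.
- rewrite (_ : (fun _ => _) = T (cf f (h x))); first exact: (T_homog (cf_homog f (h x))).
  by apply/funext => a; rewrite mem_set.
- by apply/funext => a; rewrite memNset.
Qed.

Definition gdom_map_pull (V : opens (gdom R n2 d2)) k (f : sect V k) :
    sect (preimage_opens hc V : opens (gdom R n1 d1)) k :=
  GDomSect (gdom_map_raw_in f).

Lemma cf_gdom_map_pull (V : opens (gdom R n2 d2)) k (f : sect V k) x :
  cf (gdom_map_pull f) x = if x \in (h @^-1` V) then T (cf f (h x)) else 0.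
Proof. by apply/funext => a; rewrite /cf /=; case: ifP. Qed.

(** The same [T] acts over every base point, which is enough for inclusions of fibres, projections
    and truncation to the body. Locality holds since [T] preserves bodies. *)
Definition gdom_map : gmap (gdom R n1 d1) (gdom R n2 d2).
Proof.
refine (@GMap R (gdom R n1 d1) (gdom R n2 d2) h hc gdom_map_pull _ _ _ _ _).
- move=> V k r f g; apply: gdom_sectP => x; rewrite cf_lin !cf_gdom_map_pull cf_lin.
  by case: ifP => _; [rewrite T_linear|rewrite scaler0 addr0].
- move=> V; apply: gdom_sectP => x; rewrite cf_gdom_map_pull !cf_one /=.
  by case: ifPn => // /set_mem Vx; rewrite mem_set.
- move=> V i j k e f g; apply: gdom_sectP => x.
  rewrite cf_mul !cf_gdom_map_pull cf_mul; case: ifP => _; last by rewrite fmul0l.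
  exact: T_mul (cf_homog f (h x)) (cf_homog g (h x)).
- move=> V W s s' k f; apply: gdom_sectP => x.
  rewrite cf_res !cf_gdom_map_pull cf_res /=.
  case: ifPn => // /set_mem Wx; rewrite mem_set // mem_set //; exact: s.
- move=> V k f x Vx /gunit_coef.
  by rewrite cf_gdom_map_pull mem_set // T_mono0; exact: coef_gunit.
Defined.

Lemma cf_gdom_map (V : opens (gdom R n2 d2)) k (f : sect V k) x : oset V (h x) ->
  cf (gpull gdom_map f) x = T (cf f (h x)).
Proof. by move=> Vx; rewrite [LHS]cf_gdom_map_pull mem_set. Qed.

End GdomMap.

Section ConcreteMaps.
Variables (R : realType).

Lemma rV0_eq (x y : 'rV[R]_0) : x = y.
Proof. by apply/rowP => -[]. Qed.

Lemma open_preimage_cst (T S : topologicalType) (z : S) (V : set S) :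
  open V -> open ((fun _ : T => z) @^-1` V).
Proof.
move=> oV; have [Vz|nV] := pselect (V z).
  by rewrite (_ : _ @^-1` _ = setT); [exact: openT|apply/seteqP; split].
by rewrite (_ : _ @^-1` _ = set0); [exact: open0|apply/seteqP; split].
Qed.

Section Fibre.
Variables (n q : nat) (d : 'I_q -> int) (x0 : 'rV[R]_n).

(** Freezing the base point and keeping all formal variables gives a formal point whose jets are the
    full coefficient series at [x0]; such formal points detect sections of a domain. *)
Lemma fibre_exists : exists phi : gmap (gdom R 0 d) (gdom R n d),
  (forall x, phi x = x0) /\
  forall (V : opens (gdom R n d)) k (f : sect V k) x, oset V x0 ->
    cf (gpull phi f) x = cf f x0.
Proof.
unshelve eexists.
  apply: (@gdom_map R 0 n q q d d (fun=> x0) id) => //.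
    by move=> V; exact: open_preimage_cst.
  by move=> V k f a; exact: smooth_on_cst.
by split=> // V k f x Vx; rewrite cf_gdom_map.
Qed.

End Fibre.

Section Projection.
Variables (q : nat) (d : 'I_q -> int).

Lemma line_proj_exists : exists phi : gmap (gdom R 1 d) (gdom R 0 d),
  forall (V : opens (gdom R 0 d)) k (f : sect V k) x, oset V 0 ->
    cf (gpull phi f) x = cf f 0.
Proof.
unshelve eexists.
  apply: (@gdom_map R 1 0 q q d d (fun=> 0) id) => //.
    by move=> V; exact: open_preimage_cst.
  by move=> V k f a; exact: smooth_on_cst.
by move=> V k f x Vx; rewrite cf_gdom_map.
Qed.

End Projection.

Definition fbody q1 q2 (F : fps R q2) : fps R q1 := F mono0 *: fone.
Arguments fbody q1 {q2} F.

Lemma fbody_linear q1 q2 : linear (@fbody q1 q2).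
Proof. by move=> r F G; rewrite /fbody fpsDE fpsZE scalerDl scalerA. Qed.

Lemma fbody_one q1 q2 : @fbody q1 q2 fone = fone.
Proof. by rewrite /fbody /fone eqxx scale1r. Qed.

Lemma fbody_mono0 q1 q2 F : @fbody q1 q2 F mono0 = F mono0.
Proof. by rewrite /fbody fpsZE /fone eqxx mulr1. Qed.

Lemma fbody_mul q1 q2 (d1 : 'I_q1 -> int) (d2 : 'I_q2 -> int) F G :
  @fbody q1 q2 (fmul d2 F G) = fmul d1 (fbody q1 F) (fbody q1 G).
Proof.
rewrite /fbody fmul0 fmulZl fmulZr fmul1l ?scalerA //.
by move=> a /(@fhomog_one R q1 d1)[].
Qed.

Lemma fbody_homog q1 q2 (d1 : 'I_q1 -> int) (d2 : 'I_q2 -> int) i F :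
  fhomog d2 i F -> fhomog d1 i (@fbody q1 q2 F).
Proof.
move=> hF a; rewrite /fbody fpsZE mulf_eq0 negb_or => /andP[F0 a0].
have [_ <-] := hF _ F0; rewrite mono_deg0; exact: fhomog_one a0.
Qed.

Lemma point_exists q (d : 'I_q -> int) : exists phi : gmap (gpoint R) (gdom R 0 d),
  forall (V : opens (gdom R 0 d)) k (f : sect V k) x, oset V 0 ->
    cf (gpull phi f) x = fbody 0 (cf f 0).
Proof.
unshelve eexists.
  apply: (@gdom_map R 0 0 0 q (fun=> 0) d (fun=> 0) (@fbody 0 q)) => //.
  - by move=> V; exact: open_preimage_cst.
  - exact: fbody_linear.
  - exact: fbody_one.
  - by move=> i j F G _ _; exact: fbody_mul.
  - by move=> i F; exact: fbody_homog.
  - by move=> F; exact: fbody_mono0.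
  - by move=> V k f a; exact: smooth_on_cst.
by move=> V k f x Vx; rewrite cf_gdom_map.
Qed.

Lemma line_coord_map_exists q (d : 'I_q -> int) : exists phi : gmap (gdom R 1 d) (gline R 0),
  (forall x, phi x = x) /\
  forall (V : opens (gline R 0)) k (f : sect V k) x, oset V x ->
    cf (gpull phi f) x = fbody q (cf f x).
Proof.
unshelve eexists.
  apply: (@gdom_map R 1 1 q 0 d (fun=> - 0) id (@fbody q 0)) => //.
  - exact: fbody_linear.
  - exact: fbody_one.
  - by move=> i j F G _ _; exact: fbody_mul.
  - by move=> i F; exact: fbody_homog.
  - by move=> F; exact: fbody_mono0.
  - move=> V k f a; apply: smooth_onM; first exact: oopen.
      exact: cf_smooth.
    exact: smooth_on_cst.
split=> // V k f x Vx; exact: cf_gdom_map.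
Qed.

End ConcreteMaps.

(** * Germs of sections *)

Section Germs.
Variables (R : realType) (N : gspace R).
Implicit Types (U V W : opens N) (z : N).

Definition opensI U V : opens N := Opens (openI (oopen U) (oopen V)).

(** Equality of germs. It has to be a relation, since sections over different opens have different
    types. *)
Definition eqnear z U V k (f : sect U k) (g : sect V k) : Prop :=
  exists (W : opens N) (s : W `<=` U) (t : W `<=` V), oset W z /\ gres s f = gres t g.

Lemma opensI_subl U V : opensI U V `<=` U. Proof. by move=> x []. Qed.
Lemma opensI_subr U V : opensI U V `<=` V. Proof. by move=> x []. Qed.
Lemma sub_opensT U : U `<=` opensT N. Proof. by []. Qed.

Lemma eqnear_res z U V (s : V `<=` U) k (f : sect U k) :
  oset V z -> eqnear z (gres s f) f.
Proof. by move=> Vz; exists V, (@subset_refl _ _), s; split=> //; rewrite gres_id. Qed.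

Lemma eqnear_refl z U k (f : sect U k) : oset U z -> eqnear z f f.
Proof. by move=> Uz; exists U, (@subset_refl _ _), (@subset_refl _ _). Qed.

Lemma eqnear_sym z U V k (f : sect U k) (g : sect V k) : eqnear z f g -> eqnear z g f.
Proof. by move=> [W [s [t [Wz e]]]]; exists W, t, s. Qed.

Lemma gres_sub U V W (s : V `<=` U) (t : W `<=` V) (s' : W `<=` U) k (f : sect U k) :
  gres t (gres s f) = gres s' f.
Proof. exact: gres_gres. Qed.

Lemma eqnear_trans z U V W k (f : sect U k) (g : sect V k) (h : sect W k) :
  eqnear z f g -> eqnear z g h -> eqnear z f h.
Proof.
move=> [A [s [t [Az e]]]] [B [s' [t' [Bz e']]]].
exists (opensI A B), (subset_trans (@opensI_subl A B) s),
  (subset_trans (@opensI_subr A B) t'); split=> //.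
rewrite -!gres_comp e -e' !gres_comp; exact: gres_irr.
Qed.

Lemma eqnear_lin z U V k (r : R) (f f' : sect U k) (g g' : sect V k) :
  eqnear z f g -> eqnear z f' g' -> eqnear z (r *: f + f') (r *: g + g').
Proof.
move=> [A [s [t [Az e]]]] [B [s' [t' [Bz e']]]].
exists (opensI A B), (subset_trans (@opensI_subl A B) s),
  (subset_trans (@opensI_subl A B) t); split=> //.
rewrite !gres_linear; congr (_ *: _ + _); first by rewrite -!gres_comp e.
rewrite (gres_irr _ (subset_trans (@opensI_subr A B) s')) -gres_comp e'.
by rewrite gres_comp; exact: gres_irr.
Qed.

Lemma eqnear_mul z U V i j k (e : i + j = k) (f : sect U i) (f' : sect U j)
    (g : sect V i) (g' : sect V j) :
  eqnear z f g -> eqnear z f' g' -> eqnear z (gmul e f f') (gmul e g g').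
Proof.
move=> [A [s [t [Az h]]]] [B [s' [t' [Bz h']]]].
exists (opensI A B), (subset_trans (@opensI_subl A B) s),
  (subset_trans (@opensI_subl A B) t); split=> //.
rewrite !gres_mul; congr (gmul _ _ _); first by rewrite -!gres_comp h.
rewrite (gres_irr _ (subset_trans (@opensI_subr A B) s')) -gres_comp h'.
by rewrite gres_comp; exact: gres_irr.
Qed.

Lemma gres0 U V (s : V `<=` U) k : gres s (0 : sect U k) = 0.
Proof.
have := gres_linear s 1 (0 : sect U k) 0; rewrite !scale1r !addr0; exact: addr_self0.
Qed.

Lemma eqnear_one z U V : oset U z -> oset V z -> eqnear z (gone U) (gone V).
Proof.
move=> Uz Vz; exists (opensI U V), (@opensI_subl U V), (@opensI_subr U V).
by split=> //; rewrite !gres_one.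
Qed.

Lemma gunit_res U V (s : V `<=` U) k (f : sect U k) z : oset V z ->
  gunit_at f z -> gunit_at (gres s f) z.
Proof.
move=> Vz [W [t [g [Wz e]]]].
exists (opensI V W), (@opensI_subl V W), (gres (@opensI_subr V W) g); split=> //.
rewrite (gres_sub _ _ (subset_trans (@opensI_subr V W) t)) -gres_comp.
by rewrite -gres_mul e gres_one.
Qed.

Lemma gunit_unres U V (s : V `<=` U) k (f : sect U k) z :
  gunit_at (gres s f) z -> gunit_at f z.
Proof.
move=> [W [t [g [Wz e]]]]; exists W, (subset_trans t s), g; split=> //.
by rewrite -e gres_comp.
Qed.

Lemma gunit_eqnear z U V k (f : sect U k) (g : sect V k) :
  eqnear z f g -> gunit_at f z -> gunit_at g z.
Proof.
move=> [W [s [t [Wz e]]]] /(gunit_res s Wz); rewrite e; exact: gunit_unres.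
Qed.

End Germs.

Lemma gunit_pull (R : realType) (M N : gspace R) (phi : gmap M N) (U : opens N) k
    (f : sect U k) x : gunit_at f (phi x) -> gunit_at (gpull phi f) x.
Proof.
move=> [W [s [g [Wx e]]]].
have s' : preimage_opens (gfun_continuous phi) W `<=` preimage_opens (gfun_continuous phi) U.
  by move=> y /s.
exists (preimage_opens (gfun_continuous phi) W), s', (gpull phi g); split=> //.
by rewrite -(gpull_res s s') -gpull_mul e gpull_one.
Qed.

Lemma gpull0 (R : realType) (M N : gspace R) (phi : gmap M N) (U : opens N) k :
  gpull phi (0 : sect U k) = 0.
Proof.
have := gpull_linear phi 1 (0 : sect U k) 0; rewrite !scale1r !addr0; exact: addr_self0.
Qed.

Lemma eqnear_pull (R : realType) (M N : gspace R) (phi : gmap M N) (U V : opens N) k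
    (f : sect U k) (g : sect V k) x :
  eqnear (phi x) f g -> eqnear x (gpull phi f) (gpull phi g).
Proof.
move=> [W [s [t [Wx e]]]].
exists (preimage_opens (gfun_continuous phi) W).
have s' : preimage_opens (gfun_continuous phi) W `<=` preimage_opens (gfun_continuous phi) U.
  by move=> y /s.
have t' : preimage_opens (gfun_continuous phi) W `<=` preimage_opens (gfun_continuous phi) V.
  by move=> y /t.
by exists s', t'; split=> //; rewrite -(gpull_res s s') -(gpull_res t t') e.
Qed.

Lemma gmap_eq_near (R : realType) (M N : gspace R) (phi psi : gmap M N) (U : opens N) k
    (f : sect U k) x :
  gmap_eq phi psi -> oset U (phi x) -> eqnear x (gpull phi f) (gpull psi f).
Proof.
move=> [e1 e2] Ux; exists (opensI (preimage_opens (gfun_continuous phi) U)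
   (preimage_opens (gfun_continuous psi) U)).
exists (@opensI_subl _ _ _ _), (@opensI_subr _ _ _ _); split; last exact: e2.
by split=> //=; rewrite -e1.
Qed.

Section Factor.
Variables (R : realType) (Q N : gspace R) (phi : gmap Q N) (U : opens N).
Hypothesis phiU : forall x, oset U (phi x).

Definition gfactor_fun (x : Q) : grestrict U := SigSub (mem_set (phiU x)).

Lemma gfactor_continuous (V : set (grestrict U)) : open V -> open (gfactor_fun @^-1` V).
Proof.
move=> [A oA <-]; exact: (gfun_continuous phi oA).
Qed.

Lemma gfactor_sub (V : opens (grestrict U)) :
  preimage_opens gfactor_continuous V `<=`
  preimage_opens (gfun_continuous phi) (image_opens V).
Proof. by move=> x Vx; exists (gfactor_fun x). Qed.

(** Sections of [grestrict U] are sections of [N] over images, so the pullback is that of [phi],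
    followed by a restriction between opens that agree only as sets. *)
Definition gfactor : gmap Q (grestrict U).
Proof.
refine (@GMap R Q (grestrict U) gfactor_fun gfactor_continuous
  (fun V k f => gres (@gfactor_sub V) (gpull phi (f : sect (image_opens V) k))) _ _ _ _ _).
- by move=> V k r f g; rewrite gpull_linear gres_linear.
- by move=> V; rewrite gpull_one gres_one.
- by move=> V i j k e f g; rewrite [gpull _ _]gpull_mul gres_mul.
- move=> V W s s' k f /=.
  have t : preimage_opens (gfun_continuous phi) (image_opens W) `<=`
           preimage_opens (gfun_continuous phi) (image_opens V).
    by move=> x; apply: image_subset.
  rewrite (gpull_res (image_opensS s) t) !gres_comp; exact: gres_irr.
- move=> V k f x Vx /gunit_unres u.
  have [|W [s [g [Wx e]]]] := gpull_local _ u; first by exists (gfactor_fun x).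
  have oW : open ((set_val : grestrict U -> N) @^-1` W) by exists W => //; exact: oopen.
  pose W' : opens (grestrict U) := Opens oW.
  have s' : W' `<=` V.
    by move=> y /s [y' Vy' e']; have <- : y' = y by apply: val_inj.
  have t : image_opens W' `<=` W by move=> _ [y Wy <-].
  exists W', s', (gres t g); split=> //=.
  by rewrite (gres_irr _ (subset_trans t s)) -gres_comp -gres_mul e gres_one.
Defined.

Lemma gpull_gfactor (V : opens (grestrict U)) k (f : sect V k) x : oset V (gfactor x) ->
  eqnear x (gpull gfactor f) (gpull phi (f : sect (image_opens V) k)).
Proof. by move=> Vx; exact: eqnear_res. Qed.

End Factor.

(** * Bump functions on graded manifolds *)

Section ManifoldBump.
Variable R : realType.

Lemma glue2 (N : gspace R) (hN : is_sheaf N) (U Z : opens N) k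
    (f : sect U k) (g : sect Z k) :
  (forall x, oset U x \/ oset Z x) ->
  (forall (A : opens N) (s : A `<=` U) (t : A `<=` Z), gres s f = gres t g) ->
  exists h : sect (opensT N) k,
    gres (@sub_opensT _ _ U) h = f /\ gres (@sub_opensT _ _ Z) h = g.
Proof.
move=> cov fg; pose V (b : bool) := if b then U else Z.
pose F (b : bool) : sect (V b) k := if b return sect (V b) k then f else g.
have [||h [hh _]] := @hN (opensT N) bool V (fun b => @sub_opensT _ _ (V b)) _ k F.
- by move=> x _; have [Ux|Zx] := cov x; [exists true|exists false].
- move=> [] [] W si sj; [exact: gres_irr|exact: fg|exact/esym/fg|exact: gres_irr].
by exists h; split; [exact: (hh true)|exact: (hh false)].
Qed.

Lemma gdom_bump n q (d : 'I_q -> int) (U : opens (gdom R n d)) x0 : oset U x0 ->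
  exists (chi : sect (opensT (gdom R n d)) 0) (W : opens (gdom R n d)) (K : set 'rV[R]_n),
    [/\ oset W x0, W `<=` U, gres (@sub_opensT _ _ W) chi = gone W,
        compact K /\ K `<=` U & forall x, ~ K x -> cf chi x = 0].
Proof.
move=> Ux0; have [chi [B [K [schi [oB Bx] chi1 KU chi0]]]] := exists_bump (oopen U) Ux0.
pose F : Defs.series R n q := fun a x => chi x * fone a.
have PF : F \in section_pred d (opensT (gdom R n d)) 0.
  apply: is_sectionP => [a|x _|x nT]; last by case: nT.
    by apply: smooth_onM; [exact: openT|exact: schi|exact: smooth_on_cst].
  by move=> a; rewrite /F mulf_eq0 negb_or => /andP[_]; exact: fhomog_one.
exists (GDomSect PF), (@opensI R (gdom R n d) (Opens oB) U), K; split=> //.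
  by move=> x [].
  apply: gdom_sectP => x; rewrite cf_res cf_one; case: ifPn => // /set_mem[Bx' _].
  by apply/funext => a; rewrite /cf /= /F chi1 // mul1r.
by move=> x /chi0 c0; apply/funext => a; rewrite /cf /= /F c0 mul0r.
Qed.

Lemma compact_subtype (T : topologicalType) (V K : set T) : compact K -> K `<=` V ->
  compact ((set_val : set_type V -> T) @^-1` K).
Proof.
move=> cK KV F PF FK.
have [p [Kp clp]] := cK (set_val @ F) _ FK.
exists (SigSub (mem_set (KV p Kp)) : set_type V); split=> // A B FA nB.
move: nB; rewrite nbhsE => -[C [[D oD <-] Dp] DB].
have FA' : F (set_val @^-1` (set_val @` A)).
  by apply: (@filterS _ F _ A _ _ FA) => a Aa; exists a.
have [q [[a Aa aq] Dq]] := clp _ D FA' (open_nbhs_nbhs (conj oD Dp)).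
rewrite -aq in Dq.
by exists a; split=> //; exact: DB.
Qed.

Lemma gmap_continuous (M N : gspace R) (phi : gmap M N) : continuous phi.
Proof. by apply/continuousP => A; exact: gfun_continuous. Qed.

(** A bump function of a chart is extended by zero. Its support is compact in the chart, so the
    image [K'] is compact in [N] and closed because [N] is Hausdorff; this makes [Z], the complement
    of [K'], open, and the two pieces to be glued agree on the overlap. *)
Lemma manifold_bump (N : gspace R) (hN : gmanifold N) (U : opens N) z : oset U z ->
  exists (chi : sect (opensT N) 0) (W Z : opens N),
    [/\ oset W z, W `<=` U, gres (@sub_opensT _ _ W) chi = gone W,
        forall x, oset U x \/ oset Z x & gres (@sub_opensT _ _ Z) chi = 0].
Proof.
move=> Uz; have [U0 [n [q [d [V0 [U0z d0 [phi [psi [e1 e2]]]]]]]]] := gmanifold_local hN z.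
pose z' : grestrict U0 := SigSub (mem_set U0z).
pose Phi := gcomp (gincl V0) phi; pose Psi := gcomp (gincl U0) psi.
have PsiPhi (m : grestrict U0) : Psi (phi m) = set_val m.
  exact: (congr1 (fun x : grestrict U0 => set_val x) (e1.1 m)).
have PhiPsi (w : grestrict V0) : Phi (psi w) = set_val w.
  exact: (congr1 (fun x : grestrict V0 => set_val x) (e2.1 w)).
pose U1 : opens (gdom R n d) := image_opens (preimage_opens (gfun_continuous Psi) U).
have U1y : oset U1 (Phi z') by exists (phi z') => //; move: Uz; rewrite -[z]/(set_val z') -PsiPhi.
have [chi0 [W0 [K [W0y W0U1 chiW [cK KU1] chiK]]]] := gdom_bump U1y.
have KV : K `<=` V0 by move=> y /KU1[w _ <-]; exact: set_valP.
pose K' := Psi @` ((set_val : grestrict V0 -> _) @^-1` K).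
have clK' : closed K'.
  apply: compact_closed; first exact: gmanifold_hausdorff.
  apply: continuous_compact; last exact: compact_subtype.
  by apply: continuous_subspaceT; exact: gmap_continuous.
have K'P (m : grestrict U0) : K (Phi m) <-> K' (set_val m).
  split=> [Km|[w Kw e]]; first by exists (phi m).
  have -> : m = psi w by apply: val_inj; exact: esym e.
  by rewrite PhiPsi.
pose Z : opens N := Opens (closed_openC clK').
have K'U : K' `<=` U.
  by move=> _ [w /KU1[w' Uw' e] <-]; have -> : w = w' by apply: val_inj.
have K'U0 : K' `<=` U0 by move=> _ [w _ <-]; exact: set_valP.
pose O1 := image_opens (preimage_opens (gfun_continuous Phi) (opensT (gdom R n d))).
pose chi1 : sect O1 0 := gpull Phi chi0.
have oY : open (~` K : set (gdom R n d)).
  by apply: closed_openC; apply: compact_closed; first exact: gdom_hausdorff.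
pose Y : opens (gdom R n d) := Opens oY.
have chiY : gres (@sub_opensT _ _ Y) chi0 = 0.
  by apply: gdom_sectP => x; rewrite cf_res; case: ifPn => // /set_mem /chiK ->.
have pullE (A : opens (gdom R n d)) (s : image_opens (preimage_opens (gfun_continuous Phi) A) `<=` O1) :
    gres s chi1 = gpull Phi (gres (@sub_opensT _ _ A) chi0) :> sect (image_opens _) 0.
  have t : preimage_opens (gfun_continuous Phi) A `<=`
           preimage_opens (gfun_continuous Phi) (opensT _) by [].
  rewrite (gpull_res (@sub_opensT _ _ A) t).
  exact: (gres_irr s (image_opensS t) chi1).
have [|A s t|chi [hO hZ]] := @glue2 N (gmanifold_sheaf hN) O1 Z 0 chi1 0.
- move=> x; have [K'x|nK] := pselect (K' x); [left|by right].
  by exists (SigSub (mem_set (K'U0 x K'x))).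
- rewrite gres0; set B := image_opens (preimage_opens (gfun_continuous Phi) Y).
  have sB : B `<=` O1 by apply: image_subset.
  have AB : A `<=` B.
    move=> x Ax; have [m _ e] := s x Ax; exists m => //= Km.
    by apply: (t x Ax); rewrite -e; exact/K'P.
  rewrite -(gres_sub sB AB) pullE chiY.
  by rewrite gpull0 gres0.
pose W := image_opens (preimage_opens (gfun_continuous Phi) W0).
have WO1 : W `<=` O1 by apply: image_subset.
exists chi, W, Z; split=> //.
- by exists z'.
- move=> _ [m Wm <-]; have [w Uw e] := W0U1 _ Wm.
  have ew : w = phi m by apply: val_inj.
  by rewrite -PsiPhi -ew.
- have -> : gres (@sub_opensT _ _ W) chi = gres WO1 (gres (@sub_opensT _ _ O1) chi).
    by rewrite gres_comp; exact: gres_irr.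
  by rewrite hO pullE chiW gpull_one.
- by move=> x; have [/K'U|nK] := pselect (K' x); [left|right].
Qed.

Lemma gmul0l (N : gspace R) (hN : graded_commutative_algebras N) (U : opens N) i j k
    (e : i + j = k) (g : sect U j) : gmul e 0 g = 0.
Proof.
have := gmul_linearl hN e g 1 0 0; rewrite !scale1r !addr0; exact: addr_self0.
Qed.

(** Multiplication by a bump function makes every germ global. This gives access to germs for vector
    fields and point derivations, which act on sections over a fixed open set only. *)
Lemma extend_germ (N : gspace R) (hN : gmanifold N) (U : opens N) z k (f : sect U k) :
  oset U z -> exists g : sect (opensT N) k, eqnear z f g.
Proof.
move=> Uz; have [chi [W [Z [Wz WU chiW cov chiZ]]]] := manifold_bump hN Uz.
have A := gmanifold_algebras hN.
have [A' s t|g [hU hZ]] := @glue2 N (gmanifold_sheaf hN) U Z k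
  (gmul (add0r k) (gres (@sub_opensT _ _ U) chi) f) 0 cov.
  rewrite gres0 gres_mul gres_comp.
  rewrite (gres_irr _ (subset_trans t (@sub_opensT _ _ Z))) -gres_comp chiZ gres0.
  exact: gmul0l.
exists g, W, WU, (@sub_opensT _ _ W); split=> //.
rewrite -(gres_sub (@sub_opensT _ _ U) WU) hU gres_mul gres_comp.
by rewrite (gres_irr _ (@sub_opensT _ _ W)) chiW gmul1.
Qed.

End ManifoldBump.

(** * Jets along formal points *)

Section Jets.
Variables (R : realType).

(* A map iota from a graded domain over the one-point space is a formal point of N. *)
Definition jet (N : gspace R) q (d : 'I_q -> int) (iota : gmap (gdom R 0 d) N)
  (U : opens N) k (f : sect U k) : fps R q := cf (gpull iota f) 0.

Lemma cf_near n q (d : 'I_q -> int) (U V : opens (gdom R n d)) k (f : sect U k)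
    (g : sect V k) x : eqnear x f g -> cf f x = cf g x.
Proof.
by move=> [W [s [t [W0 /(congr1 (fun h => cf h x))]]]]; rewrite !cf_res mem_set.
Qed.

Section JetTheory.
Variables (N : gspace R) (q : nat) (d : 'I_q -> int) (iota : gmap (gdom R 0 d) N).
Implicit Types (U V : opens N).

Lemma jet_lin U k (r : R) (f g : sect U k) :
  jet iota (r *: f + g) = r *: jet iota f + jet iota g.
Proof. by rewrite /jet gpull_linear cf_lin. Qed.

Lemma jet_one U : oset U (iota 0) -> jet iota (gone U) = fone.
Proof. by move=> Uz; rewrite /jet gpull_one cf_one mem_set. Qed.

Lemma jet_mul U i j k (e : i + j = k) (f : sect U i) (g : sect U j) :
  jet iota (gmul e f g) = fmul d (jet iota f) (jet iota g).
Proof. by rewrite /jet gpull_mul cf_mul. Qed.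

Lemma jet_homog U k (f : sect U k) : fhomog d k (jet iota f).
Proof. exact: cf_homog. Qed.

Lemma jet_near U V k (f : sect U k) (g : sect V k) :
  eqnear (iota 0) f g -> jet iota f = jet iota g.
Proof.
by move=> /eqnear_pull; exact: cf_near.
Qed.

Lemma jet0 U k : jet iota (0 : sect U k) = 0.
Proof.
have := jet_lin 1 (0 : sect U k) 0; rewrite !scale1r !addr0; exact: addr_self0.
Qed.

Lemma jetZ U k (r : R) (f : sect U k) : jet iota (r *: f) = r *: jet iota f.
Proof. by rewrite -[r *: f]addr0 jet_lin jet0 addr0. Qed.

Lemma jetD U k (f g : sect U k) : jet iota (f + g) = jet iota f + jet iota g.
Proof. by have := jet_lin 1 f g; rewrite !scale1r. Qed.

Lemma jetB U k (f g : sect U k) : jet iota (f - g) = jet iota f - jet iota g.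
Proof. by rewrite jetD -scaleN1r jetZ scaleN1r. Qed.

End JetTheory.
Arguments jet_homog {N q d} iota {U k} f.

Lemma jet_gmap_eq (N : gspace R) q (d : 'I_q -> int) (iota iota' : gmap (gdom R 0 d) N)
    (U : opens N) k (f : sect U k) :
  gmap_eq iota iota' -> oset U (iota 0) -> jet iota f = jet iota' f.
Proof.
by move=> e Uz; exact: cf_near (gmap_eq_near f e Uz).
Qed.

(* A section vanishing at one formal point above z cannot be a unit at z. *)
Lemma jet_body_unique (N : gspace R) q (d : 'I_q -> int) (iota : gmap (gdom R 0 d) N)
    q' (d' : 'I_q' -> int) (iota' : gmap (gdom R 0 d') N) (U : opens N) k (f : sect U k) :
  iota 0 = iota' 0 -> oset U (iota 0) -> jet iota f mono0 = jet iota' f mono0.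
Proof.
move=> e Uz; have [k0|kn0] := eqVneq k 0; last first.
  by rewrite !(fhomog_deg (jet_homog _ f)) // mono_deg0 eq_sym.
subst k; pose c := jet iota f mono0; pose g := (- c) *: gone U + f.
have Uz' : oset U (iota' 0) by rewrite -e.
have jg : jet iota g mono0 = 0.
  by rewrite jet_lin jet_one // fpsDE fpsZE /fone eqxx mulr1 addrC subrr.
have jg' : jet iota' g mono0 = jet iota' f mono0 - c.
  by rewrite jet_lin jet_one // fpsDE fpsZE /fone eqxx mulr1 addrC.
have [g0|gn0] := eqVneq (jet iota' g mono0) 0.
  by apply/esym/eqP; rewrite -subr_eq0 -/c -jg' g0.
have u : gunit_at g (iota' 0).
  by apply: (@gpull_local _ _ _ iota' U 0 g 0) => //; apply: coef_gunit.
rewrite -e in u; have := gunit_coef (gunit_pull u).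
by rewrite -/(jet iota g) jg eqxx.
Qed.

Lemma gdom_fibre_jets n q (d : 'I_q -> int) (U : opens (gdom R n d)) k (g : sect U k) :
  (forall iota : gmap (gdom R 0 d) (gdom R n d), (forall x, oset U (iota x)) ->
     jet iota g = 0) -> g = 0.
Proof.
move=> hj; apply: gdom_sectP => y.
have [Uy|nU] := pselect (oset U y); last exact: cf_out.
have [fib [fibE fibP]] := fibre_exists d y.
by rewrite cf0 -(hj fib) => [|x]; rewrite ?fibE // /jet fibP.
Qed.

Lemma gdom_restrict_jets n q (d : 'I_q -> int) (V0 : opens (gdom R n d))
    (P : opens (grestrict V0)) k (g : sect P k) :
  (forall iota : gmap (gdom R 0 d) (grestrict V0), oset P (iota 0) -> jet iota g = 0) ->
  g = 0.
Proof.
move=> hj; pose g' : @sect R (gdom R n d) (image_opens P) k := g.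
suff g0 : g' = 0 by exact: g0.
have hj' (iota : gmap (gdom R 0 d) (grestrict V0)) : oset P (iota 0) -> jet iota g = 0 := hj iota.
have e (iota : gmap (gdom R 0 d) (gdom R n d)) (iV : forall x, oset V0 (iota x)) :
    oset P (gfactor iV 0) -> jet (gfactor iV) g = jet iota g'.
  by move=> Pi; exact: (cf_near (gpull_gfactor g Pi)).
clearbody g'; clear hj.
apply: gdom_fibre_jets => iota Pi.
have iV x : oset V0 (iota x) by have [w _ <-] := Pi x; exact: set_valP.
have Pw : oset P (gfactor iV 0).
  by have [w Pw e'] := Pi 0; have <- : w = gfactor iV 0 by apply: val_inj.
by rewrite -(e iota iV Pw) hj'.
Qed.

Lemma gpull_inv (A B : gspace R) (phi : gmap A B) (psi : gmap B A) (P : opens A) k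
    (f : sect P k) x : gmap_eq (gcomp psi phi) (gid A) -> oset P x ->
  eqnear x (gpull phi (gpull psi f)) f.
Proof.
move=> e Px; have Px' : oset P (gcomp psi phi x) by rewrite (e.1 x).
have h1 := gmap_eq_near f e Px'.
have h2 : eqnear x (gpull (gid A) f) f by exact: eqnear_res.
exact: (eqnear_trans h1 h2).
Qed.

Lemma eqnear_restrict (N : gspace R) (U : opens N) (P Q : opens (grestrict U)) k
    (f : sect P k) (g : sect Q k) z : eqnear z f g ->
  eqnear (set_val z) (f : sect (image_opens P) k) (g : sect (image_opens Q) k).
Proof.
move=> [W [s [t [Wz e]]]]; exists (image_opens W), (image_opensS s), (image_opensS t).
by split; [exists z|].
Qed.

Lemma gpull_gincl (N : gspace R) (U : opens N) (V : opens N) k (f : sect V k)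
    (z : grestrict U) : oset V (set_val z) ->
  eqnear (set_val z) (gpull (gincl U) f : sect (image_opens _) k) f.
Proof.
move=> Vz; apply: eqnear_res; exists z => //.
Qed.

Lemma sheaf_zero (N : gspace R) (hN : is_sheaf N) (U : opens N) k (h : sect U k) :
  (forall z, oset U z -> exists W : opens N,
    oset W z /\ exists s : W `<=` U, gres s h = 0) -> h = 0.
Proof.
move=> loc; have [c hc] := choice (fun z : {z | oset U z} => loc (sval z) (svalP z)).
pose s (z : {z | oset U z}) := proj1_sig (cid (proj2 (hc z))).
have hs z : gres (s z) h = 0 := proj2_sig (cid (proj2 (hc z))).
have [||g [hg gu]] := @hN U {z | oset U z} c s _ k (fun z => 0).
- by move=> z Uz; exists (exist _ z Uz) => //; exact: (proj1 (hc (exist _ z Uz))).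
- by move=> i j W si sj; rewrite !gres0.
by rewrite -(gu h hs) (gu 0) // => i; rewrite gres0.
Qed.

(** By the sheaf property it suffices to work in a chart, and there the fibre over each point is a
    formal point that sees all coefficients. Its variables are those of the chart, hence of nonzero
    degrees. *)
Lemma chart_jets (N : gspace R) (hN : gmanifold N) (U : opens N) k (h : sect U k) :
  (forall q (d : 'I_q -> int) (iota : gmap (gdom R 0 d) N), (forall i, d i != 0) ->
     oset U (iota 0) -> jet iota h = 0) -> h = 0.
Proof.
move=> hj; apply: (sheaf_zero (gmanifold_sheaf hN)) => z.
move=> Uz; have [U0 [n [q [d [V0 [U0z d0 [phi [psi [e1 e2]]]]]]]]] := gmanifold_local hN z.
pose Psi := gcomp (gincl U0) psi.
have h1 : gpull Psi h = 0.
  apply: gdom_restrict_jets => iota Ui; exact: (hj q d (gcomp Psi iota) d0 Ui).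
pose z' : grestrict U0 := SigSub (mem_set U0z).
have Uz' : oset (preimage_opens (gfun_continuous (gincl U0)) U) z' by exact: Uz.
have n1 := gpull_inv (gpull (gincl U0) h) e1 Uz'.
have n2 : eqnear z' (0 : sect (preimage_opens (gfun_continuous phi)
    (preimage_opens (gfun_continuous psi) (preimage_opens (gfun_continuous (gincl U0)) U))) k)
    (gpull (gincl U0) h).
  move: n1; rewrite -[gpull psi _]/(gpull Psi h) h1.
  by rewrite -(gpull0 phi).
have [W [s [t [Wz e]]]] := eqnear_trans (eqnear_sym (gpull_gincl h Uz'))
  (eqnear_sym (eqnear_restrict n2)).
by exists W; split=> //; exists s; rewrite e gres0.
Qed.

End Jets.
Arguments jet_homog {R N q d} iota {U k} f.

(** * Maps out of formal points *)

Section Characters.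
Variables (R : realType) (N : gspace R) (hN : gmanifold N) (O : opens N) (z0 : N).
Hypothesis Oz0 : oset O z0.

Lemma extend_germ_in (V : opens N) k (f : sect V k) : oset V z0 ->
  exists g : sect O k, eqnear z0 f g.
Proof.
move=> Vz; have [g fg] := extend_germ hN f Vz.
by exists (gres (@sub_opensT _ _ O) g); apply: eqnear_trans fg (eqnear_sym (eqnear_res _ _ Oz0)).
Qed.

Variables (q : nat) (d : 'I_q -> int) (chi : forall k, sect O k -> fps R q).
Hypothesis chi_lin : forall k, linear (@chi k).
Hypothesis chi_one : chi (gone O) = fone.
Hypothesis chi_mul : forall i j k (e : i + j = k) (f : sect O i) (g : sect O j),
  chi (gmul e f g) = fmul d (chi f) (chi g).
Hypothesis chi_homog : forall k (f : sect O k), fhomog d k (chi f).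
Hypothesis chi_local : forall k (f : sect O k), eqnear z0 f (0 : sect O k) -> chi f = 0.
Hypothesis chi_unit : forall k (f : sect O k), chi f mono0 != 0 -> gunit_at f z0.

Lemma chi_near k (f g : sect O k) : eqnear z0 f g -> chi f = chi g.
Proof.
move=> fg; apply/eqP; rewrite -subr_eq0; apply/eqP.
have -> : chi f - chi g = chi ((-1) *: g + f) by rewrite chi_lin scaleN1r addrC.
apply: chi_local.
have := eqnear_lin (-1) (eqnear_refl g Oz0) fg.
by rewrite scaleN1r [X in eqnear _ _ X]addNr.
Qed.

Definition germ_ext (V : opens N) k (f : sect V k) : sect O k :=
  if pselect (oset V z0) is left h then sval (cid (extend_germ_in f h)) else 0.

Lemma germ_extP (V : opens N) k (f : sect V k) : oset V z0 -> eqnear z0 f (germ_ext f).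
Proof.
by move=> Vz; rewrite /germ_ext; case: pselect => // h; exact: svalP (cid _).
Qed.

Lemma chi_germ_ext (V : opens N) k (f : sect V k) (g : sect O k) : oset V z0 ->
  eqnear z0 f g -> chi (germ_ext f) = chi g.
Proof.
by move=> Vz fg; apply: chi_near; exact: eqnear_trans (eqnear_sym (germ_extP f Vz)) fg.
Qed.

Let cst0 : 'rV[R]_0 -> N := fun=> z0.
Let cst0_continuous (V : set N) : open V -> open (cst0 @^-1` V).
Proof. exact: open_preimage_cst. Qed.

Lemma character_section (V : opens N) k (f : sect V k) :
  (fun a x => if x \in cst0 @^-1` V then chi (germ_ext f) a else 0)
    \in section_pred d (Opens (cst0_continuous (oopen V))) k.
Proof.
apply: is_sectionP => /= [a|x Vx|x nV].
- apply: (@eq_smooth_on _ _ _ (fun=> chi (germ_ext f) a)); last exact: smooth_on_cst.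
    exact: cst0_continuous (oopen V).
  by move=> x Vx; rewrite mem_set.
- rewrite (_ : (fun _ => _) = chi (germ_ext f)); first exact: chi_homog.
  by apply/funext => a; rewrite mem_set.
- by apply/funext => a; rewrite memNset.
Qed.

Definition character_pull (V : opens N) k (f : sect V k) :
    sect (preimage_opens cst0_continuous V : opens (gdom R 0 d)) k :=
  GDomSect (character_section f).

Lemma cf_character_pull (V : opens N) k (f : sect V k) x :
  cf (character_pull f) x = if x \in cst0 @^-1` V then chi (germ_ext f) else 0.
Proof. by apply/funext => a; rewrite /cf /=; case: ifP. Qed.

(** A homomorphism into series which depends only on the germ at [z0] and reflects units is the
    pullback of a formal point over [z0]. A section over any [V] is first replaced by one over [O]
    with the same germ; if [z0] is not in [V], the preimage is empty and 0 is the only section. *)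
Definition character_map : gmap (gdom R 0 d) N.
Proof.
refine (@GMap R (gdom R 0 d) N cst0 cst0_continuous character_pull _ _ _ _ _).
- move=> V k r f g; apply: gdom_sectP => x; rewrite cf_lin !cf_character_pull.
  case: ifPn => [/set_mem Vz|_]; last by rewrite scaler0 addr0.
  rewrite -chi_lin; apply: chi_germ_ext => //.
  by apply: eqnear_lin; exact: germ_extP.
- move=> V; apply: gdom_sectP => x; rewrite cf_character_pull cf_one /=.
  case: ifPn => // /set_mem Vz; rewrite -chi_one; apply: chi_germ_ext => //.
  exact: eqnear_one.
- move=> V i j k e f g; apply: gdom_sectP => x.
  rewrite cf_mul !cf_character_pull; case: ifPn => [/set_mem Vz|_]; last by rewrite fmul0l.
  rewrite -(chi_mul e); apply: chi_germ_ext => //.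
  by apply: eqnear_mul; exact: germ_extP.
- move=> V W s s' k f; apply: gdom_sectP => x.
  rewrite cf_res !cf_character_pull /=; case: ifPn => // /set_mem Wz.
  have Vz : oset V z0 by exact: s.
  rewrite mem_set //; apply: chi_germ_ext => //.
  exact: eqnear_trans (eqnear_res s f Wz) (germ_extP f Vz).
- move=> V k f x Vz /gunit_coef; rewrite cf_character_pull mem_set // => /chi_unit.
  exact: gunit_eqnear (eqnear_sym (germ_extP f Vz)).
Defined.

Lemma character_map_exists : exists iota : gmap (gdom R 0 d) N,
  (forall x, iota x = z0) /\
  forall (V : opens N) k (f : sect V k) (g : sect O k), oset V z0 -> eqnear z0 f g ->
    jet iota f = chi g.
Proof.
exists character_map; split=> // V k f g Vz fg.
by rewrite /jet [LHS]cf_character_pull mem_set //; exact: chi_germ_ext.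
Qed.

End Characters.

(** * Equality of maps *)

Section MapEquality.
Variable R : realType.

(** The source has a single point, and every germ at its image is that of a global section. *)
Lemma gmap_eq_jets (N : gspace R) (hN : gmanifold N) q (d : 'I_q -> int)
    (iota iota' : gmap (gdom R 0 d) N) : iota 0 = iota' 0 ->
  (forall k (f : sect (opensT N) k), jet iota f = jet iota' f) -> gmap_eq iota iota'.
Proof.
move=> e0 e; split=> [x|V k f W s s']; first by rewrite (rV0_eq x 0).
apply: gdom_sectP => x; rewrite (rV0_eq x 0) !cf_res; case: ifPn => // /set_mem W0.
have Vz : oset V (iota 0) by exact: s.
have [g fg] := extend_germ hN f Vz.
rewrite -/(jet iota f) -/(jet iota' f) (jet_near fg) e; apply/esym.
by apply: jet_near; rewrite -e0.
Qed.

Lemma gmap_eq_refl (A B : gspace R) (f : gmap A B) : gmap_eq f f.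
Proof. by split=> // V k F W s t; exact: gres_irr. Qed.

Lemma gmap_eq_sym (A B : gspace R) (f g : gmap A B) : gmap_eq f g -> gmap_eq g f.
Proof. by move=> [h h']; split=> [x|V k F W s t]; [rewrite h|exact/esym/h']. Qed.

Lemma gmap_eq_trans (A B : gspace R) (f g h : gmap A B) :
  gmap_eq f g -> gmap_eq g h -> gmap_eq f h.
Proof.
move=> [a a'] [b b']; split=> [x|V k F W s t]; first by rewrite a b.
have s' : W `<=` preimage_opens (gfun_continuous g) V by move=> x /s /=; rewrite -a.
by rewrite (a' V k F W s s') (b' V k F W s' t).
Qed.

Lemma gproduct_ext (M N : gspace R) (P : gproduct M N) (Q : gspace R) (hQ : gmanifold Q)
    (f g : gmap Q P) :
  gmap_eq (gcomp (gfst P) f) (gcomp (gfst P) g) ->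
  gmap_eq (gcomp (gsnd P) f) (gcomp (gsnd P) g) -> gmap_eq f g.
Proof.
move=> e1 e2; have [h [_ _ hu]] := gprod_universal P hQ (gcomp (gfst P) f) (gcomp (gsnd P) f).
apply: gmap_eq_trans (hu f (gmap_eq_refl _) (gmap_eq_refl _)) _.
by apply: gmap_eq_sym; apply: hu; exact: gmap_eq_sym.
Qed.

End MapEquality.

Lemma eqnear_open (R : realType) (N : gspace R) (U V : opens N) k (f : sect U k) (g : sect V k) z :
  eqnear z f g -> \forall y \near z, eqnear y f g.
Proof.
move=> [W [s [t [Wz e]]]]; apply: filterS (open_nbhs_nbhs (conj (oopen W) Wz)) => y Wy.
by exists W, s, t.
Qed.

(** * Coordinates of graded domains *)

Section GdomCoordinates.
Variables (R : realType) (n q : nat) (d : 'I_q -> int).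
Local Notation G := (gdom R n d).
Local Notation C j := (@sect R G (opensT G) j).

Definition mono_delta (mu : 'I_q) : mono q := [ffun i => (i == mu) : nat].

Lemma mono_delta_ok mu : mono_ok d (mono_delta mu).
Proof. by apply/forallP => i; rewrite ffunE; case: (i == mu); rewrite ?implybT. Qed.

Lemma mono_delta_deg mu : mono_deg d (mono_delta mu) = d mu.
Proof.
rewrite /mono_deg (bigD1 mu) //= ffunE eqxx big1 ?addr0 // => i /negbTE imu.
by rewrite ffunE imu.
Qed.

Lemma mono_delta_le mu a : mono_le (mono_delta mu) a = (0 < a mu)%N.
Proof.
apply/mono_leP/idP => [/(_ mu)|a0 i]; first by rewrite ffunE eqxx.
by rewrite ffunE; case: eqP => [->|].
Qed.

Lemma body_section (h : 'rV[R]_n -> R) : smooth_on setT h ->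
  exists f : C 0, forall x, cf f x = h x *: fone.
Proof.
move=> sh; pose F : Defs.series R n q := fun a x => h x * fone a.
have PF : F \in section_pred d (opensT G) 0.
  apply: is_sectionP => [a|x _|x nT]; last by case: nT.
    by apply: smooth_onM; [exact: openT|exact: sh|exact: smooth_on_cst].
  by move=> a; rewrite /F mulf_eq0 negb_or => /andP[_]; exact: fhomog_one.
by exists (GDomSect PF).
Qed.

Lemma even_coordP (j : 'I_n) : exists f : C 0, forall x, cf f x = x 0 j *: fone.
Proof. apply: body_section; exact: smooth_on_coord. Qed.

Definition even_coord j : C 0 := sval (cid (even_coordP j)).

Lemma cf_even_coord j x : cf (even_coord j) x = x 0 j *: fone.
Proof. exact: (svalP (cid (even_coordP j))). Qed.

Lemma formal_coordP (mu : 'I_q) : exists f : C (d mu),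
  forall x, cf f x = fun a : mono q => (a == mono_delta mu)%:R.
Proof.
pose F : Defs.series R n q := fun a x => (a == mono_delta mu)%:R.
have PF : F \in section_pred d (opensT G) (d mu).
  apply: is_sectionP => [a|x _ a|x nT]; last by case: nT.
    exact: smooth_on_cst.
  rewrite /F; have [->|] := eqVneq a; last by rewrite eqxx.
  by rewrite mono_delta_ok mono_delta_deg.
by exists (GDomSect PF).
Qed.

Definition formal_coord mu : C (d mu) := sval (cid (formal_coordP mu)).

Lemma cf_formal_coord mu x : cf (formal_coord mu) x = fun a : mono q => (a == mono_delta mu)%:R.
Proof. exact: (svalP (cid (formal_coordP mu))). Qed.

(** No variable before xi_mu occurs in xi^a, so that xi_mu xi^a is already in increasing order and
    carries no sign. *)
Definition starts_at (mu : 'I_q) (a : mono q) := [forall i : 'I_q, (i < mu)%N ==> (a i == 0%N)].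

(** The quotient by xi_mu of those terms of F whose first variable is xi_mu. *)
Lemma formal_quotientP j (F : C j) (mu : 'I_q) : exists H : C (j - d mu),
  forall x a, cf H x a = if starts_at mu a then cf F x (mono_add (mono_delta mu) a) else 0.
Proof.
pose H : Defs.series R n q :=
  fun a x => if starts_at mu a then cf F x (mono_add (mono_delta mu) a) else 0.
have PH : H \in section_pred d (opensT G) (j - d mu).
  apply: is_sectionP => [a|x _ a|x nT]; last by case: nT.
    rewrite /H; case: (starts_at mu a); last exact: smooth_on_cst.
    exact: cf_smooth.
  rewrite /H; case: (starts_at mu a); last by rewrite eqxx.
  move=> /(cf_homog F x)[okb degb]; split.
    by apply: mono_ok_le okb; rewrite mono_addC; exact: mono_le_addr.
  by rewrite -degb mono_degD mono_delta_deg addrC addKr.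
by exists (GDomSect PH).
Qed.

Definition formal_quotient j (F : C j) mu : C (j - d mu) := sval (cid (formal_quotientP F mu)).

Lemma cf_formal_quotient j (F : C j) mu x a : cf (formal_quotient F mu) x a =
  if starts_at mu a then cf F x (mono_add (mono_delta mu) a) else 0.
Proof. exact: (svalP (cid (formal_quotientP F mu))). Qed.

Lemma cf_formal_quotient0 j (F : C j) mu x :
  cf (formal_quotient F mu) x mono0 = cf F x (mono_delta mu).
Proof.
rewrite cf_formal_quotient mono_addC mono_add0.
by have -> : starts_at mu mono0 by apply/forallP => i; rewrite ffunE implybT.
Qed.

Lemma fmul_delta mu (H : fps R q) (a : mono q) : mono_ok d a -> (0 < a mu)%N ->
  fmul d (fun a : mono q => (a == mono_delta mu)%:R) H a =
  mono_sign R d (mono_delta mu) (mono_sub a (mono_delta mu)) * H (mono_sub a (mono_delta mu)).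
Proof.
move=> oka amu; rewrite /fmul oka (sum_below1 (b := mono_delta mu)).
- by rewrite eqxx mul1r.
- by rewrite mono_delta_le.
- by move=> c _ /negbTE ->; rewrite mul0r mulr0.
Qed.

Lemma fmul_delta0 mu (H : fps R q) (a : mono q) : a mu = 0%N ->
  fmul d (fun a : mono q => (a == mono_delta mu)%:R) H a = 0.
Proof.
move=> amu; rewrite /fmul; case: ifP => // _; apply: big1_seq => b /andP[_].
rewrite mem_below => ba; case: eqP => [bE|_]; last by rewrite mul0r mulr0.
by move: ba; rewrite bE mono_delta_le amu.
Qed.

Lemma mono_sign_delta mu b : starts_at mu b -> mono_sign R d (mono_delta mu) b = 1.
Proof.
move=> /forallP st; apply: big1 => i _; apply: big1 => j ji; rewrite !ffunE.
case: eqP => [imu|_]; last by rewrite mulr0n gsign0l.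
by have := st j; rewrite -imu ji => /eqP ->; rewrite mulr0n gsign0r.
Qed.

Lemma cf_sum (I : finType) j (F : I -> C j) x : cf (\sum_i F i) x = \sum_i cf (F i) x.
Proof. by elim/big_rec2: _ => [|i y1 y2 _ <-]; [exact: cf0|rewrite cfD]. Qed.

(* The monomial xi^a is assigned to its first variable. *)
Lemma formal_decomposition j (F : C j) : (forall x, cf F x mono0 = 0) ->
  F = \sum_mu gmul (subrKC (d mu) j) (formal_coord mu) (formal_quotient F mu).
Proof.
move=> F0; apply: gdom_sectP => x; rewrite cf_sum; apply/funext => a.
rewrite fps_sumE; under eq_bigr do rewrite cf_mul cf_formal_coord.
have [->|an0] := eqVneq a mono0.
  by rewrite F0 big1 // => mu _; rewrite fmul_delta0 // ffunE.
have [oka|nok] := boolP (mono_ok d a); last first.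
  rewrite big1 => [|mu _]; last by rewrite /fmul (negbTE nok).
  by apply/eqP; apply: contraNT nok => /(cf_homog F x)[].
have [mu0 amu0] : exists mu : 'I_q, (0 < a mu)%N.
  apply/existsP; apply: contraNT an0; rewrite negb_exists => /forallP h.
  by apply/eqP/ffunP => i; rewrite ffunE; apply/eqP; rewrite -leqn0 leqNgt.
have [mu amu mmin] := @arg_minnP _ mu0 (fun mu => 0 < a mu)%N (fun mu => mu : nat) amu0.
have st : starts_at mu (mono_sub a (mono_delta mu)).
  apply/forallP => i; apply/implyP => imu; rewrite ffunE subn_eq0.
  by rewrite (leq_trans _ (leq0n _)) // leqNgt; apply: contraTN imu => /mmin; rewrite -leqNgt.
rewrite (bigD1 mu) //= big1 ?addr0 => [|nu nmu].
  by rewrite fmul_delta // mono_sign_delta // mul1r cf_formal_quotient st mono_subK // mono_delta_le.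
have [anu|] := posnP (a nu); first exact: fmul_delta0.
move=> anu; rewrite fmul_delta // cf_formal_quotient; case: ifP => [/forallP/(_ mu)|]; last by rewrite mulr0.
have munu : (mu < nu)%N by rewrite ltn_neqAle mmin // andbT eq_sym; apply: contraNneq nmu => e; apply/eqP/val_inj.
rewrite munu !ffunE [mu == nu]eq_sym (negbTE nmu) subn0 => /eqP a0.
by rewrite a0 in amu.
Qed.

(** These numbers are the coefficients with which every point derivation at x, applied to F, is
    expressed by its values on the coordinates ([gdom_point_derivation]). *)
Definition gdom_partial (U : opens G) j (F : sect U j) (x : 'rV[R]_n) (i : 'I_n + 'I_q) : R :=
  match i with
  | inl i => 'D_(delta_mx 0 i) (fun y => cf F y mono0) x
  | inr mu => cf F x (mono_delta mu)
  end.

Lemma gdom_partial_near (U V : opens G) j (F : sect U j) (F' : sect V j) x i :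
  eqnear x F F' -> gdom_partial F x i = gdom_partial F' x i.
Proof.
move=> FF; case: i => [i|mu] /=; last by rewrite (cf_near FF).
apply: near_eq_derive; apply: filterS (eqnear_open FF) => y FFy.
by rewrite (cf_near FFy).
Qed.

Lemma gdom_partial_continuous (U : opens G) j (F : sect U j) x i : oset U x ->
  {for x, continuous (gdom_partial F ^~ i)}.
Proof.
move=> Ux; case: i => [i|mu] /=.
  apply: smooth_on_continuous Ux; apply: smooth_on_derive; exact: cf_smooth.
exact: smooth_on_continuous (cf_smooth F (mono_delta mu)) Ux.
Qed.

End GdomCoordinates.

(** * Formal points of the line *)

Section LineMaps.
Variable R : realType.

Lemma gdom_jet_body n q (d : 'I_q -> int) q' (d' : 'I_q' -> int)
    (iota : gmap (gdom R 0 d') (gdom R n d)) (U : opens (gdom R n d)) k (f : sect U k) :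
  oset U (iota 0) -> jet iota f mono0 = cf f (iota 0) mono0.
Proof.
move=> Ui; have [fib [fibE fibP]] := fibre_exists d (iota 0).
by rewrite (jet_body_unique (iota' := fib)) ?fibE // /jet fibP.
Qed.

Lemma gline_manifold k : gmanifold (gline R k).
Proof.
apply: gdom_manifold => i; rewrite oppr_eq0.
by case: (k =P 0) i => [_ []|].
Qed.

(* Division by the coordinate t: f = c + (t - c0) g, where c0 is the value of t. *)
Definition coord_division n q (d : 'I_q -> int) m (t : sect (opensT (gdom R n d)) m) :=
  forall (x0 : gdom R n d), exists c0 : R,
  (forall q' (d' : 'I_q' -> int) (iota : gmap (gdom R 0 d') (gdom R n d)),
     iota 0 = x0 -> ford 1 (jet iota t - c0 *: fone)) /\
  forall j (f : sect (opensT (gdom R n d)) j), exists (c : R) (j' : int)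
    (g : sect (opensT (gdom R n d)) j'),
    forall q' (d' : 'I_q' -> int) (iota : gmap (gdom R 0 d') (gdom R n d)), iota 0 = x0 ->
      jet iota f = c *: fone + fmul d' (jet iota t - c0 *: fone) (jet iota g).

(** Without formal variables a section is a smooth function of one real variable, and the division
    is Hadamard's lemma. *)
Lemma even_coord_division (d : 'I_0 -> int) (t : sect (opensT (gdom R 1 d)) (- 0)) :
  (forall x, cf t x mono0 = x 0 0) -> coord_division t.
Proof.
move=> tE x0; exists (x0 0 0); split.
  move=> q d' iota ix a; rewrite ltnS leqn0 mono_size_eq0 => /eqP ->.
  by rewrite fpsDE fpsNE fpsZE gdom_jet_body // ix fone0 mulr1 tE subrr.
have a0 (a : mono 0) : a = mono0 by apply/ffunP => -[].
move=> j f; have [j0|jn0] := eqVneq j 0; last first.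
  exists 0, j, 0 => q d' iota _; rewrite jet0 fmul0r scale0r addr0.
  have -> : f = 0; last by rewrite jet0.
  apply: gdom_sectP => x; apply/funext => a; rewrite cf0.
  by apply: (fhomog_deg (cf_homog f x)); rewrite (a0 a) mono_deg0 eq_sym.
subst j; have sf : smooth_on setT (fun x : 'rV[R]_1 => cf f x mono0) by exact: (@cf_smooth R 1 0 d _ 0 f mono0).
have [g [sg _ gE]] := hadamard x0 sf.
have [h hE] := body_section d (sg 0).
have e0 : - 0 + 0 = 0 :> int by rewrite addr0 oppr0.
exists (cf f x0 mono0), 0, h => q d' iota ix.
have fE : f = cf f x0 mono0 *: gone _ + (gmul e0 t h + (- x0 0 0) *: h).
  apply: gdom_sectP => x; apply/funext => a; rewrite (a0 a).
  rewrite cfD !cfZ cfD cfZ cf_mul cf_one mem_set //.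
  rewrite !fpsDE !fpsZE fmul0 fone0 mulr1 tE gE big_ord1.
  rewrite hE fpsZE fone0; ring.
rewrite {1}fE !jetD !jetZ jet_one // jet_mul fmulDl -scaleNr fmulZl fmul1l //.
by move=> a /(jet_homog iota)[].
Qed.

(** With one formal variable [formal_decomposition] has a single term, so a section with vanishing
    body is divisible by t; over a point the body is a constant. The parity of [k] is arbitrary. *)
Lemma odd_coord_division k (kn0 : k != 0)
   (t : sect (opensT (gdom R 0 (fun _ : 'I_1 => - k))) (- k)) :
  (forall x, cf t x = fun a => (a == [ffun=> 1%N])%:R) -> coord_division t.
Proof.
move=> tE x0; exists 0; split.
  move=> q d iota _; rewrite scale0r subr0.
  by apply: fhomog0_ford (jet_homog iota t); rewrite oppr_eq0.
move=> j f; pose c := cf f 0 mono0.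
have tC : t = formal_coord R 0 (fun _ => - k) ord0.
  apply: gdom_sectP => x; rewrite tE cf_formal_coord; apply/funext => a.
  by congr (_ == _)%:R; apply/ffunP => i; rewrite !ffunE (ord1 i).
have [f0 fE] : exists f0 : sect (opensT (gdom R 0 (fun _ : 'I_1 => - k))) j,
    (forall x, cf (f - f0) x mono0 = 0) /\ forall q' (d' : 'I_q' -> int)
    (iota : gmap (gdom R 0 d') (gdom R 0 (fun _ : 'I_1 => - k))), jet iota f0 = c *: fone.
  have [j0|jn0] := eqVneq j 0; last first.
    have f00 x : cf f x mono0 = 0 by rewrite (fhomog_deg (cf_homog f x)) // mono_deg0 eq_sym.
    exists 0; split=> [x|q' d' iota]; first by rewrite subr0.
    by rewrite jet0 /c f00 scale0r.
  subst j; exists (c *: gone _); split=> [x|q' d' iota]; last by rewrite jetZ jet_one.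
  by rewrite cfD cfN cfZ cf_one mem_set // fpsDE fpsNE fpsZE fone0 mulr1 (rV0_eq x 0) subrr.
have [f00 f0j] := fE; have := formal_decomposition f00; rewrite big_ord1 => fdec.
exists c, (j - - k), (formal_quotient (f - f0) ord0) => q d iota _.
rewrite scale0r subr0 -(f0j _ _ iota) tC -(jet_mul iota (subrKC (- k) j)) -fdec.
by rewrite jetB addrC subrK.
Qed.

Lemma line_division k : coord_division (line_coord R k).
Proof.
have cE (x : 'rV[R]_0) : (fun a => if a == [ffun=> 1%N] then \prod_(i < 0) x 0 i else 0) =
    (fun a : mono 1 => (a == [ffun=> 1%N])%:R : R).
  by apply/funext => a; rewrite big_ord0; case: eqP.
case: k => [[|m]|m].
- apply: even_coord_division => x; rewrite /cf /= /line_coord_series.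
  by rewrite (_ : _ == _ = true) ?big_ord1 //; apply/eqP/ffunP => -[].
- by apply: odd_coord_division => // x; exact: cE.
- by apply: odd_coord_division => // x; exact: cE.
Qed.

(** If two formal points agree on t, division shows that their difference on f is t - c0, which has
    order 1, times their difference on the quotient g. Each division gains one order. *)
Lemma gline_maps_eq k q (d : 'I_q -> int) (iota iota' : gmap (gdom R 0 d) (gline R k)) :
  jet iota (line_coord R k) = jet iota' (line_coord R k) -> gmap_eq iota iota'.
Proof.
move=> e; have e0 : iota 0 = iota' 0.
  have := congr1 (fun F => F mono0) e; rewrite !gdom_jet_body //.
  move: (iota 0) (iota' 0); clear; case: k => [[|m]|m] x y; try by move=> _; exact: rV0_eq.
  have cE (z : 'rV[R]_1) : cf (line_coord R 0) z mono0 = z 0 0.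
    rewrite /cf /= /line_coord_series (_ : _ == _ = true) ?big_ord1 //.
    by apply/eqP/ffunP => -[].
  rewrite (cE x) (cE y) => xy; apply/rowP => i; by rewrite (ord1 i).
apply: (gmap_eq_jets (gline_manifold k) e0).
have [c0 [ord1c hdiv]] := line_division (iota 0).
suff H m : forall j (f : sect (opensT (gline R k)) j), ford m (jet iota f - jet iota' f).
  by move=> j f; apply/eqP; rewrite -subr_eq0; apply/eqP/ford_all => m; exact: H.
elim: m => [|m IH] j f //.
have [c [j' [g hg]]] := hdiv j f; rewrite (hg _ _ iota) // (hg _ _ iota') //.
rewrite opprD addrACA subrr add0r -e -fmulNr -fmulDr -add1n.
by apply: ford_mul; [exact: ord1c|exact: IH].
Qed.

End LineMaps.

(** * Point derivations *)

Section PointDerivations.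
Variable R : realType.

(** A variable of degree w squares to zero only when w is odd. For even w, including 0, the product
    of two odd variables of degrees 1 and w - 1 is used, so the square-zero element is a top
    monomial in general. *)
Lemma odd_degrees (w : int) : exists q (d : 'I_q -> int),
  [/\ (0 < q)%N, forall i, odd (absz (d i)) & \sum_i d i = w].
Proof.
have [ow|ew] := boolP (odd (absz w)).
  by exists 1%N, (fun=> w); rewrite big_ord1.
exists 2%N, (fun i => if i == ord0 then 1 else w - 1); split=> //.
  by move=> i; case: ifP => // _; rewrite odd_abszD (negbTE ew).
by rewrite big_ord_recl big_ord1 /= addrC subrK.
Qed.

Lemma fhomog_scale q (d : 'I_q -> int) i w (r : R) (F : fps R q) :
  (r != 0 -> i = w) -> fhomog d w F -> fhomog d i (r *: F).
Proof.
by move=> rw hF a; rewrite fpsZE mulf_eq0 negb_or => /andP[/rw -> /hF].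
Qed.

Section TopMonomial.
Variables (q : nat) (d : 'I_q -> int).
Hypothesis q0 : (0 < q)%N.
Hypothesis oddd : forall i, odd (absz (d i)).

Definition top_mono : mono q := [ffun=> 1%N].
Definition top_fps : fps R q := fun a => (a == top_mono)%:R.

Lemma top_mono_neq0 : (top_mono == mono0) = false.
Proof. by apply/eqP => /ffunP/(_ (Ordinal q0)); rewrite !ffunE. Qed.

Lemma odd_degrees_neq0 i : d i != 0.
Proof. by apply: contraTneq (oddd i) => ->. Qed.

Lemma top_fps0 : top_fps mono0 = 0.
Proof. by rewrite /top_fps eq_sym top_mono_neq0. Qed.

Lemma top_fps1 : top_fps top_mono = 1.
Proof. by rewrite /top_fps eqxx. Qed.

Lemma fone_top : (fone : fps R q) top_mono = 0.
Proof. by rewrite /fone top_mono_neq0. Qed.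

Lemma top_fps_homog : fhomog d (\sum_i d i) top_fps.
Proof.
move=> a; rewrite /top_fps; have [->|] := eqVneq a; last by rewrite eqxx.
split; first by apply/forallP => i; rewrite ffunE implybT.
by rewrite /mono_deg; apply: eq_bigr => i _; rewrite ffunE.
Qed.

Lemma top_fps_sq : fmul d top_fps top_fps = 0.
Proof.
apply/funext => a; rewrite /fmul; case: ifP => // /forallP oka.
apply: big1_seq => b /andP[_]; rewrite mem_below => ba; rewrite /top_fps.
case: eqP => [b1|_]; last by rewrite mul0r mulr0.
case: eqP => [b2|_]; last by rewrite !mulr0.
have := oka (Ordinal q0); rewrite oddd /=.
by have <- := mono_subK ba; rewrite b2 b1 !ffunE.
Qed.

Lemma fmul_fone_top : fmul d fone top_fps = top_fps /\ fmul d top_fps fone = top_fps.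
Proof.
have h a : top_fps a != 0 -> mono_ok d a by move=> /top_fps_homog[].
by split; [exact: fmul1l|exact: fmul1r].
Qed.

End TopMonomial.
Arguments top_fps q : clear implicits.

(** The values are real, so only bodies of the factors enter. The sign of the graded Leibniz rule is
    invisible: where the body of f is nonzero, f has degree 0. *)
Definition point_derivation (N : gspace R) q (d : 'I_q -> int)
    (iota : gmap (gdom R 0 d) N) (O : opens N) (w : int) (v : forall j, sect O j -> R) :=
  [/\ forall j (r : R) (f g : sect O j), v j (r *: f + g) = r * v j f + v j g,
      forall j (f : sect O j), v j f != 0 -> j = w &
      forall i j k (e : i + j = k) (f : sect O i) (g : sect O j),
        v k (gmul e f g) = v i f * jet iota g mono0 + jet iota f mono0 * v j g].

Section Local.
Variables (N : gspace R) (hN : gmanifold N) (q : nat) (d : 'I_q -> int)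
  (iota : gmap (gdom R 0 d) N) (O : opens N) (w : int).
Hypothesis Oi : oset O (iota 0).

Lemma point_derivation_zero : point_derivation iota w (fun j (_ : sect O j) => 0).
Proof.
by split=> [j r f g|j f|i j k e f g]; rewrite ?eqxx // ?mulr0 ?mul0r ?addr0.
Qed.

(** For a bump function c that is 1 near the point and supported where f vanishes, c f = 0, and the
    Leibniz rule turns this into v f = 0. *)
Lemma point_derivation_local (v : forall j, sect O j -> R) :
  point_derivation iota w v ->
  forall j (f : sect O j), eqnear (iota 0) f (0 : sect O j) -> v j f = 0.
Proof.
move=> [lin hom leib] j f f0; have [W [s [t [Wz]]]] := f0; rewrite gres0 => fW.
have [chi [W' [Z [Wz' W'W chiW cov chiZ]]]] := manifold_bump hN Wz.
pose c := gres (@sub_opensT _ _ O) chi.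
have cf0 : gmul (add0r j) c f = 0.
  apply: (sheaf_zero (gmanifold_sheaf hN)) => z Oz; have [Wzz|Zz] := cov z.
    exists (opensI O W); split=> //; exists (@opensI_subl _ _ O W).
    rewrite gres_mul [X in gmul _ _ X](gres_irr _ (subset_trans (@opensI_subr _ _ O W) s)) -[X in gmul _ _ X]gres_comp.
    rewrite fW gres0.
    have := gmul_linearr (gmanifold_algebras hN) (add0r j) (gres (@opensI_subl _ _ O W) c) 1 0 0.
    rewrite !scale1r !addr0; exact: addr_self0.
  exists (opensI O Z); split=> //; exists (@opensI_subl _ _ O Z).
  rewrite gres_mul /c gres_comp.
  rewrite (gres_irr _ (subset_trans (@opensI_subr _ _ O Z) (@sub_opensT _ _ Z))) -gres_comp chiZ gres0.
  by apply: gmul0l; exact: gmanifold_algebras.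
have v0 : v j (0 : sect O j) = 0.
  have := lin j 1 0 0; rewrite scale1r mul1r addr0; exact: addr_self0.
have := leib _ _ _ (add0r j) c f; rewrite cf0 v0 (jet_near f0) jet0 mulr0 add0r.
have -> : jet iota c = fone; last by rewrite fone0 mul1r.
rewrite -(jet_one (iota := iota) (U := W')) //; apply: jet_near.
apply: eqnear_trans (eqnear_res _ _ Oi) _.
exists W', (@sub_opensT _ _ W'), (@subset_refl _ _); split=> //.
by rewrite chiW gres_one.
Qed.

(** With e the top monomial, e^2 = 0 turns the Leibniz rule into multiplicativity of f(z) + v(f) e.
    Units are reflected because the body of this series is f(z). *)
Lemma point_derivation_map (q1 : nat) (d1 : 'I_q1 -> int) (v : forall j, sect O j -> R) :
  (0 < q1)%N -> (forall i, odd (absz (d1 i))) -> \sum_i d1 i = w ->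
  point_derivation iota w v ->
  exists kappa : gmap (gdom R 0 d1) N,
    (forall x, kappa x = iota 0) /\
    forall (V : opens N) k (f : sect V k) (g : sect O k), oset V (iota 0) ->
      eqnear (iota 0) f g ->
      jet kappa f = jet iota g mono0 *: fone + v k g *: top_fps q1.
Proof.
move=> q10 odd1 sum1 pv; have [lin hom leib] := pv.
have [m1 m2] := fmul_fone_top d1.
apply: (character_map_exists hN Oi) => [k r f g| | i j k e f g|k f|k f f0|k f].
- rewrite lin jet_lin fpsDE fpsZE !scalerDl !scalerDr !scalerA.
  by rewrite -!addrA; congr (_ + _); rewrite addrCA.
- have v1 : v 0 (gone O) = 0.
    have := leib _ _ _ (addr0 0) (gone O) (gone O).
    rewrite gmul1; last exact: gmanifold_algebras.
    rewrite jet_one // fone0 mulr1 mul1r; exact: addr_self0.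
  by rewrite v1 jet_one // fone0 scale1r scale0r addr0.
- rewrite leib jet_mul fmul0 fmulDl !fmulDr !fmulZl !fmulZr m1 m2.
  rewrite (top_fps_sq q10 odd1) !scaler0 addr0 fmul1l; last by move=> a /(@fhomog_one R q1 d1)[].
  by rewrite !scalerA scalerDl -addrA; congr (_ + _); rewrite addrC [v i f * _]mulrC.
- rewrite -[_ *: fone]scale1r; apply: fhomog_lin.
    by apply: (fhomog_scale _ (@fhomog_one R q1 d1)) => /(jet_homog iota f)[_ <-]; rewrite mono_deg0.
  by apply: (fhomog_scale _ (@top_fps_homog q1 d1)) => /hom ->; rewrite sum1.
- by rewrite (jet_near f0) jet0 (point_derivation_local pv f0) !scale0r addr0.
- rewrite fpsDE !fpsZE fone0 (top_fps0 q10) mulr0 mulr1 addr0 => f0.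
  by apply: (@gpull_local _ _ _ iota O k f 0) => //; apply: coef_gunit.
Qed.

End Local.

End PointDerivations.

Section ProductWithLine.
Variables (R : realType) (k : int) (M : gspace R) (P : gproduct M (gline R k)).
Hypothesis hM : gmanifold M.
Variables (O : opens P).

Definition lift1 j (f : sect (opensT M) j) : sect O j :=
  gres (@sub_opensT _ _ O) (pullT (gfst P) f).

Definition lift_coord : sect O (- k) :=
  gres (@sub_opensT _ _ O) (pullT (gsnd P) (line_coord R k)).

Lemma lift1_near z j (f : sect (opensT M) j) : oset O z ->
  eqnear z (gpull (gfst P) f) (lift1 f).
Proof.
move=> Oz; apply: eqnear_sym; apply: eqnear_trans (eqnear_res _ _ Oz) _.
exact: eqnear_res.
Qed.

Lemma lift_coord_near z : oset O z -> eqnear z (gpull (gsnd P) (line_coord R k)) lift_coord.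
Proof.
move=> Oz; apply: eqnear_sym; apply: eqnear_trans (eqnear_res _ _ Oz) _.
exact: eqnear_res.
Qed.

Variables (q : nat) (d : 'I_q -> int) (iota : gmap (gdom R 0 d) P).
Hypothesis Oi : oset O (iota 0).

(** The maps built from [v] and from the zero derivation have the same projections, hence agree; the
    coefficient of the top monomial is [v f] in one and 0 in the other. *)
Lemma point_derivation_product w (v : forall j, sect O j -> R) :
  point_derivation iota w v ->
  (forall j (f : sect (opensT M) j), v j (lift1 f) = 0) -> v (- k) lift_coord = 0 ->
  forall j (f : sect O j), v j f = 0.
Proof.
move=> pv v1 v2; have [q1 [d1 [q10 odd1 sum1]]] := odd_degrees w.
have hP := gprod_manifold P.
have [kap [kapE kapP]] := point_derivation_map hP Oi q10 odd1 sum1 pv.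
have [kap0 [kap0E kap0P]] := point_derivation_map hP Oi q10 odd1 sum1
  (point_derivation_zero iota O w).
have e : gmap_eq kap kap0.
  apply: (gproduct_ext (gdom_manifold R 0 (odd_degrees_neq0 odd1))).
    apply: (gmap_eq_jets hM); first by rewrite /= kapE kap0E.
    move=> j f; rewrite -[LHS]/(jet kap (gpull (gfst P) f)).
    rewrite -[RHS]/(jet kap0 (gpull (gfst P) f)).
    rewrite (kapP _ _ _ (lift1 f)) //; last exact: lift1_near.
    rewrite (kap0P _ _ _ (lift1 f)) //; last exact: lift1_near.
    by rewrite v1.
  apply: gline_maps_eq.
  rewrite -[LHS]/(jet kap (gpull (gsnd P) (line_coord R k))).
  rewrite -[RHS]/(jet kap0 (gpull (gsnd P) (line_coord R k))).
  rewrite (kapP _ _ _ lift_coord) //; last exact: lift_coord_near.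
  rewrite (kap0P _ _ _ lift_coord) //; last exact: lift_coord_near.
  by rewrite v2.
move=> j f; have Ok : oset O (kap 0) by rewrite kapE.
have := congr1 (fun F => F (top_mono q1)) (jet_gmap_eq f e Ok).
rewrite (kapP _ _ _ f) //; last exact: eqnear_refl.
rewrite (kap0P _ _ _ f) //; last exact: eqnear_refl.
by rewrite !fpsDE !fpsZE fone_top // top_fps1 !mulr0 !mulr1 !add0r.
Qed.

Definition jet_derivation l (D : forall j, sect O j -> fps R q) :=
  [/\ forall j (r : R) (f g : sect O j), D j (r *: f + g) = r *: D j f + D j g,
      forall j (f : sect O j), fhomog d (j + l) (D j f) &
      forall i j n (e : i + j = n) (f : sect O i) (g : sect O j),
        D n (gmul e f g) = fmul d (D i f) (jet iota g) +
          gsign R l i *: fmul d (jet iota f) (D j g)].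

(* The coefficients of least order of a derivation are point derivations. *)
Lemma jet_derivation0 l (D : forall j, sect O j -> fps R q) :
  jet_derivation l D ->
  (forall j (f : sect (opensT M) j), D j (lift1 f) = 0) -> D (- k) lift_coord = 0 ->
  forall j (f : sect O j), D j f = 0.
Proof.
move=> [lin hom leib] D1 D2.
suff H n : forall j (f : sect O j), ford n (D j f) by move=> j f; apply: ford_all => n; exact: H.
elim: n => [|n IH] j f a //; rewrite ltnS leq_eqVlt => /orP[/eqP an|]; last exact: IH.
have [oka|nok] := boolP (mono_ok d a); last first.
  by apply/eqP; apply: contraNT nok => /hom[].
apply: (@point_derivation_product (mono_deg d a - l) (fun j f => D j f a)).
- split=> [i r g h|i g nz|i j' m e g h].
  + by rewrite lin fpsDE fpsZE.
  + by have [_ ->] := hom _ _ _ nz; rewrite addrK.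
  rewrite leib fpsDE fpsZE (fmul_leadl _ (IH _ g) an oka).
  rewrite (fmul_leadr _ (IH _ h) an oka).
  have [->|/(jet_homog iota g)[_]] := eqVneq (jet iota g mono0) 0.
    by rewrite !mul0r mulr0.
  rewrite mono_deg0 => e0; have -> : gsign R l i = 1 by rewrite -e0 gsign0r.
  by rewrite mul1r.
- by move=> i g; rewrite D1.
- by rewrite D2.
Qed.

End ProductWithLine.

(** * Taylor expansion along the line *)

Section Taylor.
Variables (R : realType) (k : int) (M : gspace R) (P : gproduct M (gline R k)).
Hypothesis hM : gmanifold M.
Variables (O : opens P) (q : nat) (d : 'I_q -> int) (iota iota0 : gmap (gdom R 0 d) P).
Hypothesis Oi : oset O (iota 0).
Hypothesis i0 : iota 0 = iota0 0.
Hypothesis fst_eq : forall j (f : sect (opensT M) j), jet iota (lift1 O f) = jet iota0 (lift1 O f).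
Variable c0 : R.
Hypothesis snd_cst : jet iota0 (lift_coord O) = c0 *: fone.
Variable Z : forall i j : int, i + k = j -> sect O i -> sect O j.
Hypothesis Z_lin : forall i j (e : i + k = j), linear (Z e).
Hypothesis Z_leib : forall i j n i' j' n' (e : i + j = n) (ei : i + k = i') (ej : j + k = j')
    (en : n + k = n') (el : i' + j = n') (er : i + j' = n') (f : sect O i) (g : sect O j),
    Z en (gmul e f g) = gmul el (Z ei f) g + gsign R k i *: gmul er f (Z ej g).
Hypothesis Z_fst : forall i j (e : i + k = j) (f : sect (opensT M) i), Z e (lift1 O f) = 0.
Hypothesis Z_snd : Z (addNr k) (lift_coord O) = gone O.

Let tau : fps R q := jet iota (lift_coord O) - c0 *: fone.

(** This is tau^m / m! times the jet of Z^m f at [iota0], where [tau] is the increment of t from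
    [iota0] to [iota]. The recursion on f keeps the growing degree of Z^m f inside the types. *)
Fixpoint taylor_coef m i (f : sect O i) : fps R q :=
  if m is m'.+1 then m'.+1%:R^-1 *: fmul d tau (taylor_coef m' (Z erefl f))
  else jet iota0 f.

Lemma taylor_coefS m i j (e : i + k = j) (f : sect O i) :
  taylor_coef m.+1 f = m.+1%:R^-1 *: fmul d tau (taylor_coef m (Z e f)).
Proof. by case: j / e. Qed.

Lemma tau_homog : fhomog d (- k) tau.
Proof.
rewrite /tau addrC -scaleNr.
have h : fhomog d (- k) (c0 *: fone : fps R q) by rewrite -snd_cst; exact: jet_homog.
by rewrite -[jet _ _]scale1r scaleNr -scaleN1r; apply: fhomog_lin => //; rewrite scale1r; exact: jet_homog.
Qed.

Lemma tau_ord : ford 1 tau.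
Proof.
move=> a; rewrite ltnS leqn0 mono_size_eq0 => /eqP ->.
by rewrite /tau -snd_cst fpsDE fpsNE (jet_body_unique _ i0 Oi) subrr.
Qed.

Lemma Z0 i j (e : i + k = j) : Z e (0 : sect O i) = 0.
Proof.
have := Z_lin e 1 0 0; rewrite !scale1r !addr0; exact: addr_self0.
Qed.

Lemma Z_one j (e : 0 + k = j) : Z e (gone O) = 0.
Proof.
have A := gmanifold_algebras (gprod_manifold P).
have e' : 0 + j = j by rewrite add0r.
have er : j + 0 = j by rewrite addr0.
have := Z_leib (addr0 0) e e e er e' (gone O) (gone O).
rewrite !(gmul1 A) gsign0r scale1r.
have -> : gmul er (Z e (gone O)) (gone O) = Z e (gone O).
  by rewrite (gmulC A er e') gsign0r scale1r (gmul1 A).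
exact: addr_self0.
Qed.

Lemma taylor_coef_lin m i (r : R) (f g : sect O i) :
  taylor_coef m (r *: f + g) = r *: taylor_coef m f + taylor_coef m g.
Proof.
elim: m i f g => [|m IH] i f g /=; first exact: jet_lin.
by rewrite Z_lin IH fmulDr fmulZr scalerDr !scalerA mulrC.
Qed.

Lemma taylor_coef0 m i : taylor_coef m (0 : sect O i) = 0.
Proof. by elim: m i => [|m IH] i /=; rewrite ?jet0 // Z0 IH fmul0r scaler0. Qed.

Lemma taylor_coef_homog m i (f : sect O i) : fhomog d i (taylor_coef m f).
Proof.
elim: m i f => [|m IH] i f /=; first exact: jet_homog.
apply: (fhomog_scale (w := i)) => //.
have e : - k + (i + k) = i by rewrite [i + k]addrC addKr.
by have := fhomog_mul tau_homog (IH _ (Z erefl f)); rewrite {1}e.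
Qed.

Lemma taylor_coef_ord m i (f : sect O i) : ford m (taylor_coef m f).
Proof.
elim: m i f => [|m IH] i f //= a am.
by rewrite fpsZE (ford_mul d tau_ord (IH _ _)) ?mulr0 // add1n.
Qed.

Lemma taylor_coef_step m i j (e : i + k = j) (f : sect O i) :
  fmul d tau (taylor_coef m (Z e f)) = m.+1%:R *: taylor_coef m.+1 f.
Proof. by rewrite (taylor_coefS _ e) scalerA divff ?scale1r // pnatr_eq0. Qed.

(** The m-th part of the multiplicativity of exp(tau Z). After multiplication by m + 1 the two
    halves of the Leibniz rule contribute the weights m + 1 - a and a. Moving [tau], of degree -k,
    past the first factor cancels the Leibniz sign. *)
Lemma taylor_coef_mul m i j n (e : i + j = n) (f : sect O i) (g : sect O j) :
  taylor_coef m (gmul e f g) =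
  \sum_(a < m.+1) fmul d (taylor_coef a f) (taylor_coef (m - a)%N g).
Proof.
elim: m i j n e f g => [|m IH] i j n e f g; first by rewrite big_ord1 /= jet_mul.
have m0 : m.+1%:R != 0 :> R by rewrite pnatr_eq0.
apply: (scalerI m0); rewrite -(taylor_coef_step m (erefl (n + k))).
have el : (i + k) + j = n + k by rewrite -e addrAC.
have er : i + (j + k) = n + k by rewrite -e addrA.
rewrite (Z_leib e erefl erefl erefl el er) [X in taylor_coef _ X]addrC taylor_coef_lin !IH fmulDr fmulZr !fmul_sumr.
pose H a := fmul d (taylor_coef a f) (taylor_coef (m.+1 - a)%N g).
transitivity (\sum_(a < m.+1) (m.+1 - a)%:R *: H a + \sum_(a < m.+1) a.+1%:R *: H a.+1).
  congr (_ + _).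
    rewrite scaler_sumr; apply: eq_bigr => a _.
    rewrite fmulA (fmulC tau_homog (@taylor_coef_homog a _ f)) fmulZl scalerA -fmulA.
    rewrite -gsignDl subrr gsign0l scale1r taylor_coef_step fmulZr /H.
    by rewrite subSn // -ltnS.
  apply: eq_bigr => a _; rewrite fmulA taylor_coef_step fmulZl /H.
  by rewrite subSS.
transitivity (\sum_(a < m.+2) (m.+1 - a)%:R *: H a + \sum_(a < m.+2) a%:R *: H a).
  rewrite [in RHS]big_ord_recr /= subnn scale0r addr0; congr (_ + _).
  by rewrite [in RHS]big_ord_recl /= scale0r add0r.
rewrite -big_split scaler_sumr; apply: eq_bigr => a _ /=.
by rewrite -scalerDl -natrD subnK // -ltnS.
Qed.

Lemma taylor_coef_lift1 m i (f : sect (opensT M) i) : taylor_coef m.+1 (lift1 O f) = 0.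
Proof. by rewrite /= Z_fst taylor_coef0 fmul0r scaler0. Qed.

Lemma taylor_coef_coord : taylor_coef 1 (lift_coord O) = tau /\
  forall m, taylor_coef m.+2 (lift_coord O) = 0.
Proof.
split=> [|m]; rewrite (taylor_coefS _ (addNr k)) Z_snd.
  rewrite /= invr1 scale1r jet_one -?i0 // fmul1r //.
  by move=> a /tau_homog[].
by rewrite /= Z_one taylor_coef0 fmul0r scaler0 fmul0r scaler0.
Qed.

Definition taylor_sum N i (f : sect O i) : fps R q := \sum_(m < N) taylor_coef m f.

Lemma taylor_sum0 N i (f : sect O i) : taylor_sum N.+1 f mono0 = jet iota f mono0.
Proof.
rewrite /taylor_sum big_ord_recl fpsDE fps_sumE big1 ?addr0 => [|m _].
  exact/esym/(jet_body_unique _ i0 Oi).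
by apply: (@taylor_coef_ord m.+1); rewrite (eqP (_ : mono_size mono0 == 0%N)) ?mono_size_eq0.
Qed.

(** The product of the truncated sums has the additional terms with a + b >= N, and these have order
    at least N. *)
Lemma taylor_sum_mul N i j n (e : i + j = n) (f : sect O i) (g : sect O j) :
  ford N (fmul d (taylor_sum N f) (taylor_sum N g) - taylor_sum N (gmul e f g)).
Proof.
pose F a b := fmul d (taylor_coef a f) (taylor_coef b g).
have -> : taylor_sum N (gmul e f g) = \sum_(a < N) \sum_(b < (N - a)%N) F a b.
  rewrite /taylor_sum; elim: (N) => [|m IH]; first by rewrite !big_ord0.
  rewrite !big_ord_recr /= IH subSnn big_ord1 taylor_coef_mul big_ord_recr /= subnn addrA.
  congr (_ + _); rewrite -big_split; apply: eq_bigr => a _ /=.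
  by rewrite subSn ?(ltnW (ltn_ord a)) // big_ord_recr.
rewrite fmul_suml -sumrB; apply: ford_sum => a.
have aN := ltnW (ltn_ord a).
rewrite -fmul_sumr -fmulNr -fmulDr -{1}(subnKC aN).
apply: ford_mul; first exact: taylor_coef_ord.
rewrite /taylor_sum -!(big_mkord xpredT (fun b => taylor_coef b g)).
rewrite (big_cat_nat (leq0n _) (leq_subr a N)) /= [X in X - _]addrC addrK.
move=> b bN; rewrite fps_sumE big_nat big1 // => m /andP[am _].
by apply: (@taylor_coef_ord m); exact: leq_trans am.
Qed.

(** Induction on the order: since the truncated sums are multiplicative up to higher order, the
    leading coefficients of the error are point derivations. They kill the functions of [M] and t,
    so [point_derivation_product] applies. *)
Lemma taylor_expansion N i (f : sect O i) : ford N (jet iota f - taylor_sum N f).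
Proof.
elim: N i f => [|N IH] i f a //; rewrite ltnS => aN.
pose E i (f : sect O i) := jet iota f - taylor_sum N.+1 f.
have Eord j (g : sect O j) : ford N (E j g).
  rewrite /E /taylor_sum big_ord_recr /= -/(taylor_sum N g) opprD addrA => b bN.
  by rewrite fpsDE fpsNE (IH j g) // taylor_coef_ord // subrr.
rewrite -/(E i f); move: aN; rewrite leq_eqVlt => /orP[/eqP an|]; last exact: Eord.
have [oka|nok] := boolP (mono_ok d a); last first.
  rewrite /E fpsDE fpsNE /taylor_sum fps_sumE.
  rewrite big1 => [|m _]; last by apply/eqP; apply: contraNT nok => /taylor_coef_homog[].
  by rewrite subr0; apply/eqP; apply: contraNT nok => /(jet_homog iota f)[].
have [a0|an0] := eqVneq a mono0.
  by rewrite a0 /E fpsDE fpsNE taylor_sum0 subrr.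
have : (0 < N)%N by rewrite -an lt0n mono_size_eq0.
(* From here on the sum has at least two terms: the coordinate t needs those of index 0 and 1. *)
case: N IH @E Eord an => // N IH E Eord an _.
apply: (point_derivation_product hM Oi (w := mono_deg d a) (v := fun j f => E j f a)).
- split=> [j r g h|j g nz|j j' m e g h].
  + rewrite /E /taylor_sum jet_lin; under eq_bigr do rewrite taylor_coef_lin.
    rewrite big_split -scaler_sumr /= !fpsDE !fpsNE !fpsDE !fpsZE.
    ring.
  + apply/esym; have [_ ->] // : mono_ok d a /\ mono_deg d a = j.
    have [] := boolP (jet iota g a == 0); last by move=> /(jet_homog iota g).
    move=> /eqP jg0; move: nz; rewrite /E fpsDE fpsNE jg0 sub0r oppr_eq0 /taylor_sum fps_sumE => nz.
    have /existsP[x /taylor_coef_homog //] : [exists x : 'I_N.+2, taylor_coef x g a != 0].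
    by apply: contraNT nz; rewrite negb_exists => /forallP z; rewrite big1 // => x _; apply/eqP; have := z x; rewrite negbK.
  have aN2 : (mono_size a < N.+2)%N by rewrite an.
  have /eqP := @taylor_sum_mul N.+2 _ _ _ e g h a aN2.
  rewrite fpsDE fpsNE subr_eq0 => /eqP tm.
  rewrite {1}/E fpsDE fpsNE -tm jet_mul.
  have -> : fmul d (jet iota g) (jet iota h) a - fmul d (taylor_sum N.+2 g) (taylor_sum N.+2 h) a =
     (fmul d (E _ g) (jet iota h) + fmul d (taylor_sum N.+2 g) (E _ h)) a.
    rewrite /E fmulDl fmulDr fmulNl fmulNr !fpsDE !fpsNE; ring.
  by rewrite fpsDE (fmul_leadl _ (Eord _ g) an oka) (fmul_leadr _ (Eord _ h) an oka) taylor_sum0.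
- move=> j g; rewrite /E fpsDE fpsNE /taylor_sum big_ord_recl big1 ?addr0 => [|x _].
    by rewrite /= fst_eq subrr.
  exact: taylor_coef_lift1.
have [c1 c2] := taylor_coef_coord.
rewrite /E fpsDE fpsNE /taylor_sum big_ord_recl big_ord_recl big1 ?addr0 => [|x _]; last exact: c2.
by rewrite fpsDE c1 /= snd_cst /tau !fpsDE !fpsNE !fpsZE; ring.
Qed.

Lemma taylor_zero i (f : sect O i) : (forall m, taylor_coef m f = 0) -> jet iota f = 0.
Proof.
move=> f0; apply: ford_all => N a aN.
have /= := taylor_expansion f aN; rewrite fpsDE fpsNE /taylor_sum fps_sumE big1 ?subr0 //.
by move=> m _; rewrite f0.
Qed.

End Taylor.

(** * Local frames of point derivations *)

Section GdomPointDerivation.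
Variables (R : realType) (n q : nat) (d : 'I_q -> int).
Local Notation G := (gdom R n d).
Local Notation C j := (@sect R G (opensT G) j).
Local Notation even_coord := (@even_coord R n q d).
Local Notation formal_coord := (formal_coord R n d).

Variables (q' : nat) (d' : 'I_q' -> int) (iota : gmap (gdom R 0 d') G) (w : int).
Variable v : forall j, C j -> R.
Hypothesis pv : point_derivation iota w v.

Lemma point_derivation0 j : v (0 : C j) = 0.
Proof.
have [lin _ _] := pv; have := lin j 1 0 0; rewrite scale1r mul1r addr0; exact: addr_self0.
Qed.

Lemma point_derivation_sum (I : finType) j (F : I -> C j) : v (\sum_i F i) = \sum_i v (F i).
Proof.
have [lin _ _] := pv; elim/big_rec2: _ => [|i y1 y2 _ <-]; first exact: point_derivation0.
by have := lin j 1 (F i) y2; rewrite scale1r mul1r.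
Qed.

Definition gdom_coord (i : 'I_n + 'I_q) : C (if i is inr mu then d mu else 0) :=
  match i with inl i => even_coord i | inr mu => formal_coord mu end.

Lemma gdom_point_derivation_formal j (F : C j) : (forall x, cf F x mono0 = 0) ->
  v F = \sum_mu cf F (iota 0) (mono_delta mu) * v (formal_coord mu).
Proof.
move=> F0; have [lin _ leib] := pv; rewrite {1}(formal_decomposition F0) point_derivation_sum.
apply: eq_bigr => mu _; rewrite leib !gdom_jet_body // cf_formal_quotient0.
rewrite cf_formal_coord (_ : _ == _ = false) ?mul0r ?addr0 1?mulrC //.
by apply/eqP => /ffunP/(_ mu); rewrite !ffunE eqxx.
Qed.

(** By Hadamard's lemma F is a constant plus a sum of products (x_i - x_i(0)) H_i; [v] kills
    constants, and the first factors vanish at the point. *)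
Lemma gdom_point_derivation_body (F : C 0) (h : 'rV[R]_n -> R) : smooth_on setT h ->
  (forall x, cf F x = h x *: fone) ->
  v F = \sum_i 'D_(delta_mx 0 i) h (iota 0) * v (even_coord i).
Proof.
move=> sh FE; have [lin _ leib] := pv; set x := iota 0.
have vD (F1 F2 : C 0) : v (F1 + F2) = v F1 + v F2.
  by have := lin 0 1 F1 F2; rewrite scale1r mul1r.
have vZ r (F1 : C 0) : v (r *: F1) = r * v F1.
  by have := lin 0 r F1 0; rewrite !addr0 point_derivation0 addr0.
have v1 : v (gone (opensT G)) = 0.
  have := leib _ _ _ (addr0 0) (gone (opensT G)) (gone (opensT G)).
  rewrite gmul1; last exact: gdom_algebras.
  rewrite jet_one // fone0 mulr1 mul1r; exact: addr_self0.
have [g [sg gx gE]] := hadamard x sh.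
have [H HE] := choice (fun i => body_section d (sg i)).
have -> : F = h x *: gone _ +
    \sum_i gmul (addr0 0) (even_coord i - x 0 i *: gone _) (H i).
  apply: gdom_sectP => y; rewrite cfD cfZ cf_one mem_set // cf_sum FE gE scalerDl scaler_suml.
  congr (_ + _); apply: eq_bigr => i _.
  rewrite cf_mul cfD cfN cfZ cf_one mem_set // cf_even_coord HE -scalerBl fmulZl fmulZr scalerA.
  by rewrite fmul1l // => a /(@fhomog_one R q d)[].
rewrite vD vZ v1 mulr0 add0r point_derivation_sum; apply: eq_bigr => i _.
rewrite leib !gdom_jet_body // -/x HE fpsZE fone0 mulr1 gx -scaleNr addrC vD vZ v1 mulr0 addr0.
rewrite cfD cfZ cf_one mem_set // cf_even_coord fpsDE !fpsZE fone0 !mulr1 addrN mul0r add0r.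
by rewrite mulrC.
Qed.

Lemma gdom_point_derivation j (F : C j) :
  v F = \sum_i gdom_partial F (iota 0) i * v (gdom_coord i).
Proof.
have [lin _ _] := pv.
rewrite big_sumType /=.
have [j0|jn0] := eqVneq j 0; last first.
  have F0 x : cf F x mono0 = 0 by rewrite (fhomog_deg (cf_homog F x)) // mono_deg0 eq_sym.
  rewrite (gdom_point_derivation_formal F0) [X in _ = X + _]big1 ?add0r // => i _.
  by under [X in 'D__ X _]eq_fun do rewrite F0; rewrite derive_cst mul0r.
subst j; have sF : smooth_on setT (fun x => cf F x mono0) by exact: (cf_smooth F mono0).
have [B BE] := body_section d sF.
have FE : F = B + (F - B) by rewrite addrC subrK.
have F0 x : cf (F - B) x mono0 = 0 by rewrite cfD cfN BE fpsDE fpsNE fpsZE fone0 mulr1 subrr.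
have -> : v F = v B + v (F - B).
  by rewrite {1}FE; have := lin 0 1 B (F - B); rewrite scale1r mul1r.
rewrite (gdom_point_derivation_body sF BE) (gdom_point_derivation_formal F0).
congr (_ + _); apply: eq_bigr => mu _; rewrite cfD cfN BE fpsDE fpsNE fpsZE /fone.
rewrite (_ : mono_delta mu == mono0 = false) ?mulr0 ?subr0 //.
by apply/eqP => /ffunP/(_ mu); rewrite !ffunE eqxx.
Qed.

End GdomPointDerivation.

Section Charts.
Variable R : realType.

Lemma gpull_gincl_image (N : gspace R) (U : opens N) (P : opens (grestrict U)) k
    (g : sect P k) y : oset P y ->
  eqnear y (gpull (gincl U) (g : sect (image_opens P) k)) g.
Proof.
move=> Py; pose Q := preimage_opens (gfun_continuous (gincl U)) (image_opens P).
have s : Q `<=` Q by [].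
have t : Q `<=` P by move=> x [x' Px' e]; have <- : x' = x by apply: val_inj.
exists Q, s, t; split; first by exists y.
have key : gres (image_opensS s) (gpull (gincl U) (g : sect (image_opens P) k) :
    @sect R N (image_opens Q) k) = gres (image_opensS t) (g : sect (image_opens P) k).
  by rewrite /= gres_comp; exact: gres_irr.
exact: key.
Qed.

Lemma formal_point_exists (N : gspace R) (hN : gmanifold N) z :
  exists q (d : 'I_q -> int) (iota : gmap (gdom R 0 d) N), iota 0 = z.
Proof.
have [U0 [n [q [d [V0 [U0z d0 [phi [psi [e1 e2]]]]]]]]] := gmanifold_local hN z.
pose z' : grestrict U0 := SigSub (mem_set U0z).
have [fib [fibE _]] := fibre_exists d (set_val (phi z')).
have fV x : oset V0 (fib x) by rewrite fibE; exact: set_valP.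
exists q, d, (gcomp (gcomp (gincl U0) psi) (gfactor fV)) => /=.
have -> : gfactor_fun fV 0 = phi z' by apply: val_inj; exact: fibE.
exact: (congr1 (fun x : grestrict U0 => set_val x) (e1.1 z')).
Qed.

Lemma chart_pull_near (N G : gspace R) (U0 : opens N) (V0 : opens G)
    (phi : gmap (grestrict U0) (grestrict V0)) (psi : gmap (grestrict V0) (grestrict U0))
    (P0 : opens (grestrict U0)) k (f : sect P0 k) y (V : opens G) (F : sect V k) :
  gmap_eq (gcomp psi phi) (gid _) -> oset P0 y -> oset P0 (psi (phi y)) ->
  eqnear (set_val (phi y)) F (gpull psi f : sect (image_opens _) k) ->
  eqnear y (gpull (gcomp (gincl V0) phi) F) f.
Proof.
move=> e1 Py Py' Ff.
have h1 := eqnear_pull (phi := gincl V0) Ff.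
have h2 := gpull_gincl_image (gpull psi f) (Py' : oset (preimage_opens (gfun_continuous psi) P0) _).
have h3 := eqnear_pull (phi := phi) (eqnear_trans h1 h2).
exact: (eqnear_trans h3 (gpull_inv f e1 Py)).
Qed.

(** F is the expression of f in the chart, and any section with the germ of F pulls back to the germ
    of f. In this form the inverse of the chart no longer has to be carried along. *)
Lemma chart_exists (N : gspace R) (hN : gmanifold N) z :
  exists n q (d : 'I_q -> int) (U0 : opens N) (Phi : gmap (grestrict U0) (gdom R n d)),
    [/\ forall i, d i != 0, oset U0 z &
    forall (V : opens N) k (f : sect V k),
    exists (V1 : opens (gdom R n d)) (F : sect V1 k), forall y : grestrict U0,
      oset V (set_val y) -> oset V1 (Phi y) /\
      forall (V2 : opens (gdom R n d)) (G : sect V2 k), eqnear (Phi y) G F ->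
      eqnear (set_val y) (gpull Phi G : sect (image_opens _) k) f].
Proof.
have [U0 [n [q [d [V0 [U0z d0 [phi [psi [e1 e2]]]]]]]]] := gmanifold_local hN z.
exists n, q, d, U0, (gcomp (gincl V0) phi); split=> // V k f.
exists (image_opens (preimage_opens (gfun_continuous psi)
  (preimage_opens (gfun_continuous (gincl U0)) V))), (gpull psi (gpull (gincl U0) f)) => y Vy.
have Vy' : oset V (set_val (psi (phi y))).
  by have e := e1.1 y; rewrite -[y]/(gid _ y) -e in Vy; exact: Vy.
split; first by exists (phi y).
move=> V2 G GF; apply: eqnear_trans (gpull_gincl f Vy); apply: eqnear_restrict.
exact: (chart_pull_near e1 _ _ GF).
Qed.

Lemma point_derivation_near (N : gspace R) (hN : gmanifold N) q (d : 'I_q -> int)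
    (iota : gmap (gdom R 0 d) N) (O : opens N) w (v : forall j, sect O j -> R)
    (Oi : oset O (iota 0)) : point_derivation iota w v ->
  forall j (f g : sect O j), eqnear (iota 0) f g -> v j f = v j g.
Proof.
move=> pv j f g fg; have [lin _ _] := pv.
apply/eqP; rewrite -subr_eq0; apply/eqP.
have -> : v j f - v j g = v j ((-1) *: g + f) by rewrite lin mulN1r addrC.
apply: (point_derivation_local hN Oi pv).
have := eqnear_lin (-1) (eqnear_refl g Oi) fg.
by rewrite scaleN1r [X in eqnear _ _ X]addNr.
Qed.

(** The [w a] are global sections with the germs of the chart coordinates, and [c] consists of the
    first-order coefficients of f in the chart. Their continuity gives the bound needed for the ODE.
    The neighbourhood [U], on which the [w a] still are the coordinates, does not depend on f; only
    the one of the bound does. *)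
Lemma point_derivation_frame (M : gspace R) (hM : gmanifold M) (z : M) :
  exists (I : finType) (e : I -> int) (w : forall a, sect (opensT M) (e a)) (U : set M),
    nbhs z U /\ forall j (f : sect (opensT M) j), exists (c : M -> I -> R) (C : R) (U' : set M),
    [/\ nbhs z U', forall y a, U' y -> `|c y a| <= C &
      forall q (d : 'I_q -> int) (iota : gmap (gdom R 0 d) M) wt
        (v : forall j, sect (opensT M) j -> R), point_derivation iota wt v -> U (iota 0) ->
      v j f = \sum_a c (iota 0) a * v _ (w a)].
Proof.
have [n [q [d [U0 [Phi [d0 U0z hPhi]]]]]] := chart_exists hM z.
pose z' : grestrict U0 := SigSub (mem_set U0z).
pose pullPhi k (F : @sect R (gdom R n d) (opensT (gdom R n d)) k) :=
  gpull Phi F : sect (image_opens _) k.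
have pullPhiT (y : grestrict U0) : oset (image_opens (preimage_opens (gfun_continuous Phi)
   (opensT (gdom R n d)))) (set_val y) by exists y.
have ext (a : 'I_n + 'I_q) : exists g : sect (opensT M) _, eqnear z (pullPhi _ (gdom_coord R d a)) g.
  by have := extend_germ hM (pullPhi _ (gdom_coord R d a)) (pullPhiT z').
have [w wP] : exists w : forall a : 'I_n + 'I_q, sect (opensT M) (if a is inr mu then d mu else 0),
    forall a, eqnear z (pullPhi _ (gdom_coord R d a)) (w a).
  by exists (fun a => sval (cid (ext a))) => a; exact: (svalP (cid (ext a))).
exists ('I_n + 'I_q)%type, (fun a => if a is inr mu then d mu else 0), w.
exists (fun y => oset U0 y /\ forall a, eqnear y (pullPhi _ (gdom_coord R d a)) (w a)); split.
  apply: filterI; first exact: (open_nbhs_nbhs (conj (oopen U0) U0z)).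
  by apply: (@filter_forall M _ (fun a y => eqnear y (pullPhi _ (gdom_coord R d a)) (w a)) (nbhs z)) => a; exact: eqnear_open.
move=> j f; have [V1 [F hF]] := hPhi _ _ f.
pose c (y : M) a := if pselect (oset U0 y) is left h
  then gdom_partial F (Phi (SigSub (mem_set h) : grestrict U0)) a else 0.
have cE (y : grestrict U0) a : c (set_val y) a = gdom_partial F (Phi y) a.
  rewrite /c; case: pselect => [h|[]]; last exact: set_valP.
  by congr (gdom_partial F (Phi _) a); apply: val_inj.
have gen (u u' : R) : `|u - u'| <= 1 -> `|u'| <= `|u| + 1.
  move=> uu; have -> : u' = u - (u - u') by rewrite subKr.
  by rewrite (le_trans (ler_normB _ _)) // lerD2l.
(* Near the point each coefficient stays within 1 of its value there; the sum bounds all of them at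
   once. *)
pose C := \sum_a (`|gdom_partial F (Phi z') a| + 1).
have Bx : \forall x \near Phi z', forall a, `|gdom_partial F x a| <= C.
  apply: (@filter_forall _ _ (fun a x => `|gdom_partial F x a| <= C) (nbhs (Phi z'))) => a.
  have [V1z _] := hF z' I.
  have /cvgrPdist_le/(_ 1 ltr01) := @gdom_partial_continuous R n q d V1 j F (Phi z') a V1z.
  apply: filterS => x xb.
  rewrite /C (bigD1 a) //= -[X in X <= _]addr0; apply: lerD; last first.
    by apply: sumr_ge0 => i _; rewrite addr_ge0.
  exact: gen xb.
have [B [[oB Bz] BC]] : exists B : set (gdom R n d), (open B /\ B (Phi z')) /\
    forall x, B x -> forall a, `|gdom_partial F x a| <= C.
  by have := Bx; rewrite /prop_near1 nbhsE => -[B oB BC]; exists B.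
pose U' := image_opens (preimage_opens (gfun_continuous Phi) (Opens oB)).
exists c, C, U'; split.
- by apply: open_nbhs_nbhs; split; [exact: oopen|exists z'].
- by move=> _ a [y By <-]; rewrite cE; exact: BC.
move=> q' d' iota wt v pv [U0i wi].
have iU x : oset U0 (iota x) by rewrite (rV0_eq x 0).
pose y := gfactor iU 0; have yE : set_val y = iota 0 by [].
pose iota' := gcomp Phi (gfactor iU).
have jE k (G : @sect R (gdom R n d) (opensT (gdom R n d)) k) g :
    eqnear (iota 0) (pullPhi _ G) g -> jet iota' G = jet iota (g : sect (opensT M) k).
  move=> Gg; rewrite -(jet_near Gg).
  exact: (cf_near (gpull_gfactor (gpull Phi G) (I : oset (preimage_opens _ (opensT _)) y))).
have hG k (G : @sect R (gdom R n d) (opensT (gdom R n d)) k) : exists g : sect (opensT M) k,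
    eqnear (iota 0) (pullPhi _ G) g.
  by have := extend_germ hM (pullPhi _ G) (pullPhiT y).
(* [v] is transported to the chart by applying it to any global section with the germ of the
   pullback; by locality the choice is immaterial. *)
pose v' k G := v k (sval (cid (hG k G))).
have OT : oset (opensT M) (iota 0) by [].
have v'E k G g : eqnear (iota 0) (pullPhi k G) g -> v' k G = v k g.
  move=> Gg; apply: (point_derivation_near hM OT pv).
  exact: eqnear_trans (eqnear_sym (svalP (cid (hG k G)))) Gg.
have pv' : point_derivation iota' wt v'.
  have [lin hom leib] := pv; split=> [k r G1 G2|k G|i k m e G1 G2].
  + have [[g1 h1] [g2 h2]] := (hG k G1, hG k G2).
    rewrite (v'E _ _ _ h1) (v'E _ _ _ h2) -lin; apply: v'E.
    rewrite /pullPhi gpull_linear; exact: eqnear_lin.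
  + by have [g h] := hG k G; rewrite (v'E _ _ _ h); exact: hom.
  + have [[g1 h1] [g2 h2]] := (hG i G1, hG k G2).
    rewrite (v'E _ _ _ h1) (v'E _ _ _ h2) (jE _ _ _ h1) (jE _ _ _ h2) -(leib _ _ _ e).
    by apply: v'E; rewrite /pullPhi gpull_mul; exact: eqnear_mul.
have [V1y Fy] := hF y I.
have [F' FF'] := extend_germ (gdom_manifold R n d0) F V1y.
have -> : v j f = v' j F' by apply/esym/v'E; exact: Fy (eqnear_sym FF').
rewrite (gdom_point_derivation pv'); apply: eq_bigr => a _.
rewrite -yE cE (gdom_partial_near a FF') [v _ (w a)](_ : _ = v' _ (gdom_coord R d a)) //.
by apply/esym/v'E; exact: wi.
Qed.
End Charts.

(** * Points of a product *)

Section ProductPoints.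
Variable R : realType.

(** The universal property speaks of maps, so points have to be turned into maps. Formal points over
    x and y may have different variables; truncation to bodies makes both of them maps from the
    one-point space, with equal projections. *)
Lemma product_point (M N : gspace R) (hM : gmanifold M) (hN : gmanifold N) (P : gproduct M N)
    (x y : P) : gfst P x = gfst P y -> gsnd P x = gsnd P y -> x = y.
Proof.
have [q [d [iota <-]]] := formal_point_exists (gprod_manifold P) x.
have [q' [d' [iota' <-]]] := formal_point_exists (gprod_manifold P) y.
have body (Q : gspace R) (hQ : gmanifold Q) (phi : gmap P Q) :
    phi (iota 0) = phi (iota' 0) -> forall (pt : gmap (gpoint R) (gdom R 0 d)) (pt' : gmap (gpoint R) (gdom R 0 d')),
    (forall (V : opens (gdom R 0 d)) k (f : sect V k) x, oset V 0 ->
      cf (gpull pt f) x = cf f 0 mono0 *: fone) ->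
    (forall (V : opens (gdom R 0 d')) k (f : sect V k) x, oset V 0 ->
      cf (gpull pt' f) x = cf f 0 mono0 *: fone) ->
    gmap_eq (gcomp phi (gcomp iota pt)) (gcomp phi (gcomp iota' pt') : gmap (gpoint R) _).
  move=> e pt pt' hp hp'; apply: (gmap_eq_jets hQ).
    by rewrite /= (rV0_eq (pt 0) 0) (rV0_eq (pt' 0) 0).
  move=> k f.
  have -> : jet (gcomp phi (gcomp iota pt)) f = jet (gcomp phi iota) f mono0 *: fone by exact: hp.
  have -> : jet (gcomp phi (gcomp iota' pt')) f = jet (gcomp phi iota') f mono0 *: fone by exact: hp'.
  by have -> := jet_body_unique (iota := gcomp phi iota) (iota' := gcomp phi iota') f e I.
move=> e1 e2; have [pt hp] := point_exists R d; have [pt' hp'] := point_exists R d'.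
have d0 (i : 'I_0) : (fun _ : 'I_0 => 0 : int) i != 0 by case: i.
have := gproduct_ext (gdom_manifold R 0 d0) (body _ hM (gfst P) e1 _ _ hp hp')
  (body _ hN (gsnd P) e2 _ _ hp hp').
move=> [e _]; have h : iota (pt 0) = iota' (pt' 0) := e 0.
have p0 : pt 0 = 0 := rV0_eq _ _; have p0' : pt' 0 = 0 := rV0_eq _ _.
by rewrite p0 p0' in h.
Qed.

End ProductPoints.

Section LinePoints.
Variables (R : realType) (q : nat) (d : 'I_q -> int).

Definition line_pt (s : R) : 'rV[R]_1 := const_mx s.

Lemma line_ptE s : line_pt s = s *: delta_mx 0 0 + 0.
Proof. by apply/rowP => i; rewrite (ord1 i) !mxE !eqxx mulr1 addr0. Qed.

Lemma rV1_line_pt (x : 'rV[R]_1) : x = line_pt (x 0 0).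
Proof. by apply/rowP => i; rewrite (ord1 i) mxE. Qed.

Lemma line_pt_continuous : continuous line_pt.
Proof.
move=> s; have -> : line_pt = fun s => s *: delta_mx 0 0 + 0 by apply/funext; exact: line_ptE.
apply: (@continuousD _ _ _ (fun s : R => s *: (delta_mx 0 0 : 'rV[R]_1)) (cst 0)).
  exact: scalel_continuous.
exact: cst_continuous.
Qed.

Lemma is_derive_fmul n (F G : 'rV[R]_n -> fps R q) (F' G' : fps R q) x v :
  (forall b, is_derive x v (fun y => F y b) (F' b)) ->
  (forall b, is_derive x v (fun y => G y b) (G' b)) ->
  forall a, is_derive x v (fun y => fmul d (F y) (G y) a)
    ((fmul d F' (G x) + fmul d (F x) G') a).
Proof.
move=> dF dG a; rewrite fpsDE /fmul; case: (mono_ok d a); last first.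
  by rewrite addr0; exact: is_derive_cst.
rewrite -big_split /=; elim: (below a) => [|b s IH].
  by rewrite big_nil; under eq_fun do rewrite big_nil; exact: is_derive_cst.
rewrite big_cons; under eq_fun do rewrite big_cons.
apply: is_deriveD.
have h := is_deriveZ (mono_sign R d b (mono_sub a b)) (is_deriveM (dF b) (dG (mono_sub a b))).
apply: (is_derive_eq h).
rewrite /GRing.scale /=; ring.
Qed.

End LinePoints.

(** * Formal points moving along the line *)

Section FlowLine.
Variables (R : realType) (M : gspace R) (P : gproduct M (gline R 0)).
Hypothesis hM : gmanifold M.
Variables (q : nat) (d : 'I_q -> int).

Lemma pullT_near (A B : gspace R) (phi : gmap A B) k (f : sect (opensT B) k) z :
  eqnear z (pullT phi f) (gpull phi f).
Proof. exact: eqnear_res. Qed.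

Lemma line_coord0E (x : 'rV[R]_1) : cf (line_coord R 0) x = x 0 0 *: fone.
Proof.
apply/funext => a; have -> : a = mono0 by apply/ffunP => -[].
rewrite fpsZE fone0 mulr1 /cf /= /line_coord_series (_ : _ == _ = true) ?big_ord1 //.
by apply/eqP/ffunP => -[].
Qed.

(** The pair formed by [zeta], constant in time, and the real coordinate of the line, without formal
    part, defines [kappa] by the universal property. Moving along it keeps the formal variables of
    [zeta] fixed. *)
Lemma flow_line_exists (d0 : forall i, d i != 0) (zeta : gmap (gdom R 0 d) M) :
  exists kappa : gmap (gdom R 1 d) P,
  [/\ forall x, gfst P (kappa x) = zeta 0, forall x, gsnd P (kappa x) = x,
    forall j (f : sect (opensT M) j) x, cf (gpull kappa (pullT (gfst P) f)) x = jet zeta f &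
    forall x, cf (gpull kappa (pullT (gsnd P) (line_coord R 0))) x = x 0 0 *: fone].
Proof.
have [pr prE] := line_proj_exists R d; have [lc [lcE lcP]] := line_coord_map_exists R d.
have [kappa [k1 k2 _]] := gprod_universal P (gdom_manifold R 1 d0) (gcomp zeta pr) lc.
exists kappa; split=> [x|x|j f x|x].
- by rewrite -[LHS]/(gcomp (gfst P) kappa x) k1.1 /= (rV0_eq (pr x) 0).
- by rewrite -[LHS]/(gcomp (gsnd P) kappa x) k2.1 lcE.
- rewrite (cf_near (eqnear_pull (phi := kappa) (pullT_near (gfst P) f (kappa x)))).
  have h := cf_near (gmap_eq_near f k1 (I : oset (opensT M) (gcomp (gfst P) kappa x))).
  by rewrite [LHS]h [LHS]prE.
rewrite (cf_near (eqnear_pull (phi := kappa) (pullT_near (gsnd P) _ (kappa x)))).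
have h := cf_near (gmap_eq_near (line_coord R 0) k2 (I : oset (opensT _) (gcomp (gsnd P) kappa x))).
by rewrite [LHS]h [LHS]lcP // line_coord0E /fbody fpsZE fone0 mulr1.
Qed.

Variables (O : opens P) (kappa : gmap (gdom R 1 d) P) (zeta : gmap (gdom R 0 d) M).
Hypothesis kappa_fst : forall j (f : sect (opensT M) j) x,
  cf (gpull kappa (pullT (gfst P) f)) x = jet zeta f.
Hypothesis kappa_snd : forall x,
  cf (gpull kappa (pullT (gsnd P) (line_coord R 0))) x = x 0 0 *: fone.
Variable Z : forall i j : int, i + 0 = j -> sect O i -> sect O j.
Hypothesis Z_lin : forall i j (e : i + 0 = j), linear (Z e).
Hypothesis Z_leib : forall i j n i' j' n' (e : i + j = n) (ei : i + 0 = i') (ej : j + 0 = j')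
    (en : n + 0 = n') (el : i' + j = n') (er : i + j' = n') (f : sect O i) (g : sect O j),
    Z en (gmul e f g) = gmul el (Z ei f) g + gsign R 0 i *: gmul er f (Z ej g).
Hypothesis Z_fst : forall i j (e : i + 0 = j) (f : sect (opensT M) i), Z e (lift1 O f) = 0.
Hypothesis Z_snd : Z (addNr 0) (lift_coord O) = gone O.

Let W : opens (gdom R 1 d) := preimage_opens (gfun_continuous kappa) O.
Let e0 : 'rV[R]_1 := delta_mx 0 0.

(** The derivative along the line and [Z] followed by the jet are derivations along the same formal
    point, and they agree on the functions of [M] and on t. *)
Lemma flow_line_partial i (g : sect O i) x a : oset O (kappa x) ->
  is_derive x e0 (fun y => cf (gpull kappa g) y a) (cf (gpull kappa (Z (addr0 i) g)) x a).
Proof.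
move=> Ox.
have dg j (f : sect O j) b : is_derive x e0 (fun y => cf (gpull kappa f) y b)
    ('D_e0 (fun y => cf (gpull kappa f) y b) x).
  by apply: derivableP; exact: (smooth_on_derivable (cf_smooth (gpull kappa f) b) (Ox : oset W x)).
have [fib [fibE fibP]] := fibre_exists d x.
pose iota := gcomp kappa fib.
have Oi : oset O (iota 0) by rewrite /= fibE.
have jE j (f : sect O j) : jet iota f = cf (gpull kappa f) x by exact: fibP.
pose D j (f : sect O j) : fps R q := fun b =>
  'D_e0 (fun y => cf (gpull kappa f) y b) x - cf (gpull kappa (Z (addr0 j) f)) x b.
have hD : jet_derivation iota 0 D.
  split=> [j r f f'|j f b|j j' n e f f'].
  - apply/funext => b; rewrite /D Z_lin.
    have -> : (fun y => cf (gpull kappa (r *: f + f')) y b) =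
        (r \*: (fun y => cf (gpull kappa f) y b)) + (fun y => cf (gpull kappa f') y b).
      by rewrite gpull_linear.
    have [_ ->] := is_deriveD (is_deriveZ r (dg j f b)) (dg j f' b).
    rewrite gpull_linear cf_lin !fpsDE !fpsZE /GRing.scale /=; ring.
  - have [//|no] := pselect (mono_ok d b /\ mono_deg d b = j + 0).
    have z0 (h : sect O j) y : cf (gpull kappa h) y b = 0.
      by apply/eqP/negP => /negP /(cf_homog (gpull kappa h) y); rewrite -{1}[j]addr0.
    rewrite /D z0; have -> : (fun y => cf (gpull kappa f) y b) = fun=> 0 by apply/funext => y; exact: z0.
    by rewrite derive_cst subrr eqxx.
  - apply/funext => b; rewrite /D.
    have -> : (fun y => cf (gpull kappa (gmul e f f')) y b) =
        fun y => fmul d (cf (gpull kappa f) y) (cf (gpull kappa f') y) b.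
      by apply/funext => y; rewrite gpull_mul cf_mul.
    have [_ ->] := is_derive_fmul d (dg j f) (dg j' f') b.
    have gD m (h h' : sect O m) : gpull kappa (h + h') = gpull kappa h + gpull kappa h'.
      by have := gpull_linear kappa 1 h h'; rewrite !scale1r.
    rewrite (Z_leib e (addr0 j) (addr0 j') (addr0 n) e e) !gsign0l !scale1r.
    rewrite gD cfD !gpull_mul !cf_mul !jE -/(D j f) -/(D j' f').
    have DE m (h : sect O m) : (fun b => 'D_e0 (fun y => cf (gpull kappa h) y b) x) =
        D m h + cf (gpull kappa (Z (addr0 m) h)) x.
      by apply/funext => c; rewrite fpsDE /D subrK.
    rewrite !DE fmulDl fmulDr !fpsDE; ring.
have -> : cf (gpull kappa (Z (addr0 i) g)) x a = 'D_e0 (fun y => cf (gpull kappa g) y a) x.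
  apply/esym/eqP; rewrite -subr_eq0; apply/eqP; rewrite -/(D i g a).
  have near_res j (f : sect (opensT P) j) y : oset O (kappa y) ->
      cf (gpull kappa (gres (@sub_opensT _ _ O) f)) y = cf (gpull kappa f) y.
    by move=> Oy; apply: cf_near; apply: (eqnear_pull (phi := kappa)); exact: eqnear_res.
  have Wx : \forall y \near x, oset W y by exact: (open_nbhs_nbhs (conj (oopen W) (Ox : oset W x))).
  rewrite (jet_derivation0 hM Oi hD) // => [j f|]; apply/funext => b; rewrite /D.
    rewrite Z_fst gpull0 cf0 (near_eq_derive (g := fun=> jet zeta f b)) ?derive_cst ?subr0 //.
    by apply: filterS Wx => y Oy; rewrite near_res // kappa_fst.
  have -> m (e : - 0 + 0 = m) : cf (gpull kappa (Z e (lift_coord O))) x = fone.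
    have m0 : 0 = m by rewrite -e addNr.
    by move: e; case: m / m0 => e; rewrite (Prop_irrelevance e (addNr 0)) Z_snd gpull_one cf_one mem_set.
  rewrite (near_eq_derive (g := fun y : 'rV[R]_1 => (fone : fps R q) b * y 0 0)); last first.
    by apply: filterS Wx => y Oy; rewrite near_res // kappa_snd fpsZE mulrC.
  have h : is_derive x e0 (fun y : 'rV[R]_1 => y 0 0) 1.
    apply/is_derive_lineP.
    have -> : (fun h : R => (h *: e0 + x) 0 0) = id + cst (x 0 0).
      by apply/funext => h; rewrite !mxE !eqxx mulr1.
    by apply: is_derive_eq; rewrite addr0.
  have [_ ->] := is_deriveZ ((fone : fps R q) b : R) h.
  by rewrite /GRing.scale /= mulr1 subrr.
exact: dg.
Qed.

Lemma flow_line_derive i (g : sect O i) s a : oset O (kappa (line_pt s)) ->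
  is_derive s 1 (fun s => cf (gpull kappa g) (line_pt s) a)
    (cf (gpull kappa (Z (addr0 i) g)) (line_pt s) a).
Proof.
move=> Os; have h := flow_line_partial g a Os; rewrite {1}line_ptE in h.
have := is_derive_line_at h.
by under eq_fun do rewrite -line_ptE.
Qed.

End FlowLine.

(** * Derivations along theta that vanish at time 0 *)

Section FlowLineVanishing.
Variables (R : realType) (M P : gspace R) (D : opens P) (theta : gmap (grestrict D) M).
Hypothesis hM : gmanifold M.
Local Notation O := (image_opens (opensT (grestrict D))).
Variables (l : int) (A : forall j, sect (opensT M) j -> @sect R P O (j + l)).
Hypothesis A_lin : forall j (r : R) (f g : sect (opensT M) j), A (r *: f + g) = r *: A f + A g.
Hypothesis A_leib : forall i j n (e : i + j = n) (el : i + l + j = n + l)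
  (er : i + (j + l) = n + l) (f : sect (opensT M) i) (g : sect (opensT M) j),
  A (gmul e f g) = gmul el (A f) (pullT theta g : @sect R P O j) +
    gsign R l i *: gmul er (pullT theta f : @sect R P O i) (A g).
Variable X : forall j, sect (opensT M) j -> sect (opensT M) j.
Variables (q : nat) (d : 'I_q -> int) (kappa : gmap (gdom R 1 d) P).
Hypothesis A_derive : forall j (f : sect (opensT M) j) s a, oset O (kappa (line_pt s)) ->
  is_derive s 1 (fun s => cf (gpull kappa (A f)) (line_pt s) a)
    (cf (gpull kappa (A (X f))) (line_pt s) a).

Let I := [set s | oset O (kappa (line_pt s))].

Lemma flow_line_point s : I s -> exists (y : grestrict D) (iota : gmap (gdom R 0 d) M),
  [/\ set_val y = kappa (line_pt s), iota 0 = theta y &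
    forall j (g : sect (opensT M) j),
      jet iota g = cf (gpull kappa (pullT theta g : @sect R P O j)) (line_pt s)].
Proof.
move=> [y _ ye]; have [fib [fibE fibP]] := fibre_exists d (line_pt s).
have Dk x : oset D (gcomp kappa fib x).
  by rewrite /= fibE -ye; exact: set_valP.
exists y, (gcomp theta (gfactor Dk)); split=> //.
  rewrite /=; congr (theta _); apply: val_inj.
  by rewrite /= fibE; exact: esym ye.
move=> j g; have yO : oset (opensT (grestrict D)) (gfactor Dk 0) by [].
have Os : oset O (kappa (line_pt s)) by exists y.
have h1 := cf_near (eqnear_pull (phi := gfactor Dk) (eqnear_sym (pullT_near theta g (gfactor Dk 0)))).
rewrite [LHS]h1 [LHS](cf_near (gpull_gfactor (pullT theta g) yO)).
exact: (fibP _ _ (gpull kappa (pullT theta g : @sect R P O j)) 0 Os).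
Qed.

Section Order.
Variables (N : nat).
Hypothesis A_ord : forall j (f : sect (opensT M) j) s, I s ->
  ford N (cf (gpull kappa (A f)) (line_pt s)).
Variable a : mono q.
Hypotheses (aN : mono_size a = N) (oka : mono_ok d a).

Let v s j (f : sect (opensT M) j) : R := cf (gpull kappa (A f)) (line_pt s) a.

Lemma flow_line_point_derivation s : I s -> exists (y : grestrict D) (iota : gmap (gdom R 0 d) M),
  [/\ set_val y = kappa (line_pt s), iota 0 = theta y &
    point_derivation iota (mono_deg d a - l) (v s)].
Proof.
move=> Is; have [y [iota [ye ie jE]]] := flow_line_point Is; exists y, iota; split=> //.
split=> [j r f g|j f|i j n e f g].
- by rewrite /v A_lin gpull_linear cf_lin fpsDE fpsZE.
- by move=> /(cf_homog (gpull kappa (A f)) (line_pt s))[_ ->]; rewrite addrK.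
have el : i + l + j = n + l by rewrite -e addrAC.
have er : i + (j + l) = n + l by rewrite -e addrA.
rewrite /v (A_leib e el er) [X in gpull kappa X]addrC gpull_linear !gpull_mul cf_lin !cf_mul fpsDE fpsZE.
rewrite (fmul_leadl _ (A_ord f Is) aN oka) (fmul_leadr _ (A_ord g Is) aN oka) -!jE.
rewrite addrC; congr (_ + _).
have [->|/(jet_homog iota f)[_]] := eqVneq (jet iota f mono0) 0.
  by rewrite !mul0r mulr0.
rewrite mono_deg0 => e0; have -> : gsign R l i = 1 by rewrite -e0 gsign0r.
by rewrite mul1r.
Qed.

(** The values of [v] on a finite frame near theta (y0) solve a linear system with bounded
    coefficients. Uniqueness is stated for two arbitrary nearby times, so that it makes both the
    zero set and its complement open. *)
Lemma flow_line_local s0 : I s0 -> exists2 e : R, 0 < e &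
  forall s s', `|s - s0| < e -> `|s' - s0| < e -> I s' /\
    ((forall j (f : sect (opensT M) j), v s f = 0) ->
      forall j (f : sect (opensT M) j), v s' f = 0).
Proof.
move=> Is0; have [y0 [iota0 [y0e _ _]]] := flow_line_point Is0.
have [F [e [w [U [nU frame]]]]] := point_derivation_frame hM (theta y0).
have hb b : exists T : (M -> F -> R) * (R * set M), [/\ nbhs (theta y0) T.2.2,
    forall y a, T.2.2 y -> `|T.1 y a| <= T.2.1 &
    forall q (d : 'I_q -> int) (iota : gmap (gdom R 0 d) M) wt
      (v : forall j, sect (opensT M) j -> R), point_derivation iota wt v -> U (iota 0) ->
    v _ (X (w b)) = \sum_a T.1 (iota 0) a * v _ (w a)].
  by have [c [C [U' [h1 h2 h3]]]] := frame _ (X (w b)); exists (c, (C, U')).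
have [T hT] := choice hb.
pose C := \sum_b `|(T b).2.1|.
pose V := U `&` [set y | forall b, (T b).2.2 y].
have nV : nbhs (theta y0) V.
  by apply: filterI => //; apply: (@filter_forall _ F (fun b y => (T b).2.2 y) (nbhs (theta y0))) => b; have [] := hT b.
have {nV}[V' [oV' V'0 V'V]] : exists V' : set M, [/\ open V', V' (theta y0) & V' `<=` V].
  by move: nV; rewrite nbhsE => -[B [oB By] BV]; exists B.
pose Q := image_opens (preimage_opens (gfun_continuous theta) (Opens oV')).
have nQ : \forall s \near s0, oset Q (kappa (line_pt s)).
  have oQ : open (@line_pt R @^-1` (kappa @^-1` Q)).
    by apply: open_comp => [x _|]; [exact: line_pt_continuous|exact: (gfun_continuous kappa (oopen Q))].
  by apply: open_nbhs_nbhs; split=> //; exists y0.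
have [r r0 rQ] : exists2 r : R, 0 < r & forall s, `|s - s0| < r -> oset Q (kappa (line_pt s)).
  have /nbhs_ballP[r /= r0 rQ] := nQ; exists r => // s sr; apply: rQ.
  by rewrite -ball_normE /= distrC.
have QI s : oset Q (kappa (line_pt s)) -> exists y : grestrict D,
    set_val y = kappa (line_pt s) /\ V (theta y).
  by move=> [y Vy ye]; exists y; split=> //; exact: V'V.
pose K := #|F|%:R * C.
have C0 : 0 <= C by apply: sumr_ge0.
have K0 : 0 <= K by rewrite mulr_ge0.
(* The closed interval of radius [del] stays within distance r of [s0]. Its length is at most 1 / (K
   + 1), so length times [K] is less than 1, as [linear_ode_step] requires; [K] itself may be 0. *)
pose del := Num.min (r / 2) ((K + 1)^-1 / 2).
have K1 : 0 < K + 1 by rewrite ltr_wpDl.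
have del0 : 0 < del by rewrite lt_min !divr_gt0 // invr_gt0.
have delr : del < r.
  by rewrite /del gt_min ltr_pdivrMr // ltr_pMr // ltr1n orTb.
exists del => // s s' sd sd'.
have good x : x \in `[s0 - del, s0 + del] -> oset Q (kappa (line_pt x)).
  rewrite in_itv /= => xd; apply: rQ; apply: le_lt_trans delr.
  by rewrite ler_distl.
have inI x : `|x - s0| < del -> x \in `[s0 - del, s0 + del].
  by rewrite in_itv /= => /ltW; rewrite ler_distl.
split; first by have [y [ye _]] := QI _ (good _ (inI _ sd')); exists y.
move=> vs0 j f.
(* The value outside [D] is a dummy: on the interval considered the line stays in [D]. *)
pose n x := if pselect (oset D (kappa (line_pt x))) is left h
  then theta (SigSub (mem_set h) : grestrict D) else theta y0.
have nE x (y : grestrict D) : set_val y = kappa (line_pt x) -> n x = theta y.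
  move=> ye; rewrite /n; case: pselect => [h|[]]; last by rewrite -ye; exact: set_valP.
  by congr (theta _); apply: val_inj.
have pd x : x \in `[s0 - del, s0 + del] -> exists (iota : gmap (gdom R 0 d) M),
    [/\ iota 0 = n x, V (n x), I x & point_derivation iota (mono_deg d a - l) (v x)].
  move=> xd; have [y [ye Vy]] := QI _ (good _ xd).
  have Ix : I x by exists y.
  have [y' [iota [ye' ie pv]]] := flow_line_point_derivation Ix.
  have yy : y' = y by apply: val_inj; exact: etrans ye' (esym ye).
  by exists iota; rewrite (nE _ _ ye) ie yy.
have w0 b : v s' (w b) = 0.
  have := @linear_ode_step R F (fun b x => v x (w b)) (fun i j x => (T j).1 (n x) i)
    (s0 - del) (s0 + del) C s.
  apply=> //.
  - move=> j' x xd; have [iota [ie [Un Un'] Ix pv]] := pd x xd.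
    have [_ _ h3] := hT j'; have := h3 _ _ _ _ _ pv; rewrite ie => /(_ Un) <-.
    exact: A_derive.
  - move=> i j' x xd; have [iota [ie [Un Un'] Ix pv]] := pd x xd.
    have [_ h2 _] := hT j'; apply: (le_trans (h2 _ i (Un' j'))).
    apply: (le_trans (ler_norm _)); rewrite /C (bigD1 j') //= lerDl.
    by apply: sumr_ge0.
  - rewrite -/K (_ : s0 + del - (s0 - del) = del * 2); last by ring.
    have : del * 2 <= (K + 1)^-1.
      by rewrite -ler_pdivlMr // /del ge_min lexx orbT.
    move=> h; apply: (le_lt_trans (ler_wpM2r K0 h)).
    by rewrite mulrC ltr_pdivrMr // mul1r ltrDl.
  - exact: inI.
  - exact: inI.
have [iota [ie [Un _] _ pv]] := pd s' (inI _ sd').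
have [c [C' [U' [_ _ h]]]] := frame _ f.
have := h _ _ _ _ _ pv; rewrite ie => /(_ Un) ->.
by apply: big1 => b _; rewrite w0 mulr0.
Qed.

(** The zero set is open and closed in the interval [I] and contains 0, so connectedness gives all
    of [I]. *)
Lemma flow_line_coef0 : is_interval I -> I 0 ->
  (forall j (f : sect (opensT M) j), v 0 f = 0) ->
  forall s, I s -> forall j (f : sect (opensT M) j), v s f = 0.
Proof.
move=> /connected_intervalP cI I0 v0.
pose Z s := forall j (f : sect (opensT M) j), v s f = 0.
have open_part (B : set R) : (forall s s' e, I s -> B s -> `|s' - s| < e ->
    (forall s', `|s' - s| < e -> I s' /\ (Z s <-> Z s')) -> B s') -> open (I `&` B).
  move=> hB; rewrite openE => s [Is Bs]; have [e e0 h] := flow_line_local Is.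
  apply/nbhs_ballP; exists e => // s'; rewrite -ball_normE /= distrC => s'e.
  have ss : `|s - s| < e by rewrite subrr normr0.
  have hZ x : `|x - s| < e -> I x /\ (Z s <-> Z x).
    move=> xe; have [Ix h1] := h s x ss xe; have [_ h2] := h x s xe ss.
    by split.
  by split; [have [] := hZ s' s'e|exact: hB hZ].
suff IZ : I `&` Z = I by move=> s Is; have [] : (I `&` Z) s by rewrite IZ.
apply: cI; first by exists 0.
  exists (I `&` Z); last by rewrite setIA setIid.
  by apply: open_part => s s' e _ Zs s'e h; apply/(h s' s'e).2.
exists (~` (I `&` ~` Z)).
  apply: open_closedC; apply: open_part => s s' e _ nZs s'e h Zs'.
  by apply: nZs; apply/(h s' s'e).2.
apply/seteqP; split=> [s [Is Zs]|s [Is ns]]; split=> //; first by case.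
by apply: contrapT => nZ; apply: ns.
Qed.

End Order.

Lemma flow_line_zero : is_interval I -> I 0 ->
  (forall j (f : sect (opensT M) j), cf (gpull kappa (A f)) (line_pt 0) = 0) ->
  forall s, I s -> forall j (f : sect (opensT M) j), cf (gpull kappa (A f)) (line_pt s) = 0.
Proof.
move=> intI I0 A0 s Is j f.
suff H N : forall j (f : sect (opensT M) j) s, I s -> ford N (cf (gpull kappa (A f)) (line_pt s)).
  by apply: ford_all => N; exact: H.
elim: N => [|N IH] {}j {}f {}s {}Is a //; rewrite ltnS leq_eqVlt => /orP[/eqP aN|]; last exact: IH.
have [oka|nok] := boolP (mono_ok d a); last first.
  by apply/eqP; apply: contraNT nok => /(cf_homog (gpull kappa (A f)) (line_pt s))[].
apply: (flow_line_coef0 IH aN oka) => // i g.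
by rewrite A0.
Qed.

End FlowLineVanishing.

(** * Lifts of vector fields and invariance *)

Section GlobalPullback.
Variables (R : realType) (M N Q : gspace R) (phi : gmap M N).

Lemma pullT_lin k (r : R) (f g : sect (opensT N) k) :
  pullT phi (r *: f + g) = r *: pullT phi f + pullT phi g.
Proof. by rewrite /pullT gpull_linear gres_linear. Qed.

Lemma pullT0 k : pullT phi (0 : sect (opensT N) k) = 0.
Proof. by rewrite /pullT gpull0 gres0. Qed.

Lemma pullTB k (f g : sect (opensT N) k) : pullT phi (f - g) = pullT phi f - pullT phi g.
Proof. by rewrite addrC -scaleN1r pullT_lin scaleN1r addrC. Qed.

Lemma pullTZ k (r : R) (f : sect (opensT N) k) : pullT phi (r *: f) = r *: pullT phi f.
Proof. by rewrite -[r *: f]addr0 pullT_lin pullT0 addr0. Qed.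

Lemma pullT_mul i j k (e : i + j = k) (f : sect (opensT N) i) (g : sect (opensT N) j) :
  pullT phi (gmul e f g) = gmul e (pullT phi f) (pullT phi g).
Proof. by rewrite /pullT gpull_mul gres_mul. Qed.

Lemma pullT_comp (psi : gmap N Q) k (f : sect (opensT Q) k) :
  pullT (gcomp psi phi) f = pullT phi (pullT psi f).
Proof.
have s : preimage_opens (gfun_continuous phi) (opensT N) `<=`
  preimage_opens (gfun_continuous phi) (preimage_opens (gfun_continuous psi) (opensT Q)) by [].
by rewrite /pullT (gpull_res _ s) gres_comp; exact: gres_irr.
Qed.

Lemma pullT_eq (psi : gmap M N) k (f : sect (opensT N) k) :
  gmap_eq phi psi -> pullT phi f = pullT psi f.
Proof. by move=> [_ h]; exact: h. Qed.

Lemma pullT_id k (f : sect (opensT M) k) : pullT (gid M) f = f.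
Proof. by rewrite /pullT /= gres_comp; exact: gres_id. Qed.

Lemma pullT_gincl (U : opens N) k (f : sect (opensT N) k) :
  (pullT (gincl U) f : @sect R N (image_opens (opensT (grestrict U))) k) =
  gres (@sub_opensT _ _ _) f.
Proof. by rewrite /pullT /= gres_comp; exact: gres_irr. Qed.

Lemma jet_pullT q (d : 'I_q -> int) (iota : gmap (gdom R 0 d) M) k (f : sect (opensT N) k) :
  jet iota (pullT phi f) = jet (gcomp phi iota) f.
Proof. by rewrite (jet_near (pullT_near phi f (iota 0))). Qed.

End GlobalPullback.

Lemma jet_gincl (R : realType) (N : gspace R) (U : opens N) q (d : 'I_q -> int)
    (iota : gmap (gdom R 0 d) (grestrict U)) k (g : sect (opensT (grestrict U)) k) :
  jet (gcomp (gincl U) iota) (g : @sect R N (image_opens (opensT (grestrict U))) k) = jet iota g.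
Proof.
have h := gpull_gincl_image g (I : oset (opensT (grestrict U)) (iota 0)).
exact: (jet_near h).
Qed.

Lemma restrict_jets (R : realType) (N : gspace R) (hN : gmanifold N) (U : opens N) k
    (g : sect (opensT (grestrict U)) k) :
  (forall q (d : 'I_q -> int) (iota : gmap (gdom R 0 d) (grestrict U)), (forall i, d i != 0) ->
    jet iota g = 0) -> g = 0.
Proof.
move=> hj; apply: (@chart_jets R N hN (image_opens (opensT (grestrict U)))) => q d iota d0 Oi.
have iU x : oset U (iota x) by rewrite (rV0_eq x 0); have [y _ <-] := Oi; exact: set_valP.
rewrite -(hj q d (gfactor iU) d0).
exact: esym (cf_near (gpull_gfactor g (I : oset (opensT (grestrict U)) (gfactor iU 0)))).
Qed.

Section Lifts.
Variables (R : realType) (M : gspace R) (hM : gmanifold M) (k : int) (S : flow_setting M k).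
Variables (D : opens (fs_MR S)) (m : int) (X : graded_endo M m) (Y : graded_endo (gline R k) m).
Variables (Z : vector_field (grestrict D) m) (hZ : is_lift X Y Z).
Local Notation O := (image_opens (opensT (grestrict D))).

Lemma lift1E j (f : sect (opensT M) j) :
  lift1 (P := fs_MR S) O f = pullT (gincl D) (pullT (gfst (fs_MR S)) f).
Proof. by rewrite pullT_gincl. Qed.

Lemma lift_coordE :
  lift_coord (P := fs_MR S) O = pullT (gincl D) (pullT (gsnd (fs_MR S)) (line_coord R k)).
Proof. by rewrite pullT_gincl. Qed.

Lemma is_lift_fst i j (e : i + m = j) (f : sect (opensT M) i) :
  vfield Z e (lift1 (P := fs_MR S) O f) = lift1 (P := fs_MR S) O (X e f).
Proof. by have [W [W1 W2 W3]] := hZ; rewrite !lift1E W3 W1. Qed.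

Lemma is_lift_snd j (e : - k + m = j) :
  vfield Z e (lift_coord (P := fs_MR S) O) =
  pullT (gincl D) (pullT (gsnd (fs_MR S)) (Y e (line_coord R k))).
Proof. by have [W [W1 W2 W3]] := hZ; rewrite lift_coordE W3 W2. Qed.

End Lifts.

Lemma pullT_one (R : realType) (A B : gspace R) (phi : gmap A B) :
  pullT phi (gone (opensT B)) = gone (opensT A).
Proof. by rewrite /pullT gpull_one gres_one. Qed.

Section VectorFields.
Variables (R : realType) (N : gspace R) (m : int) (X : vector_field N m).

Lemma vfield_lin i j (e : i + m = j) : linear (vfield X e).
Proof. by have [] := vfield_derivation X. Qed.

Lemma vfield_leib i j k i' j' k' (e : i + j = k) (ei : i + m = i') (ej : j + m = j')
    (ek : k + m = k') (el : i' + j = k') (er : i + j' = k')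
    (f : sect (opensT N) i) (g : sect (opensT N) j) :
  vfield X ek (gmul e f g) =
    gmul el (vfield X ei f) g + gsign R m i *: gmul er f (vfield X ej g).
Proof. by have [_] := vfield_derivation X; apply. Qed.

Lemma vfield0 i j (e : i + m = j) : vfield X e 0 = 0.
Proof.
have := vfield_lin e 1 0 0; rewrite !scale1r !addr0; exact: addr_self0.
Qed.

Lemma vfieldB i j (e : i + m = j) f g : vfield X e (f - g) = vfield X e f - vfield X e g.
Proof. by rewrite addrC -scaleN1r vfield_lin scaleN1r addrC. Qed.

Lemma vfieldZ i j (e : i + m = j) r f : vfield X e (r *: f) = r *: vfield X e f.
Proof. by rewrite -[r *: f]addr0 vfield_lin vfield0 addr0. Qed.

Lemma vfield_one (hN : graded_commutative_algebras N) j (e : 0 + m = j) :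
  vfield X e (gone _) = 0.
Proof.
have e' : 0 + j = j by rewrite add0r.
have er : j + 0 = j by rewrite addr0.
have := vfield_leib (addr0 0) e e e er e' (gone _) (gone _).
rewrite !(gmul1 hN) gsign0r scale1r.
have -> : gmul er (vfield X e (gone _)) (gone _) = vfield X e (gone _).
  by rewrite (gmulC hN er e') gsign0r scale1r (gmul1 hN).
exact: addr_self0.
Qed.

Lemma jet_vfield q (d : 'I_q -> int) (iota : gmap (gdom R 0 d) N) i j (e : i + m = j) f :
  jet iota (vfield X e f) = jet iota (vfield X erefl f).
Proof. by case: j / e. Qed.

Lemma jet_vfield_leib q (d : 'I_q -> int) (iota : gmap (gdom R 0 d) N) i j n (e : i + j = n)
    (f : sect (opensT N) i) (g : sect (opensT N) j) :
  jet iota (vfield X erefl (gmul e f g)) =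
    fmul d (jet iota (vfield X erefl f)) (jet iota g) +
    gsign R m i *: fmul d (jet iota f) (jet iota (vfield X erefl g)).
Proof.
have el : i + m + j = n + m by rewrite -e addrAC.
have er : i + (j + m) = n + m by rewrite -e addrA.
by rewrite (vfield_leib e erefl erefl erefl el er) jetD jetZ !jet_mul.
Qed.

Lemma vfieldD i j (e : i + m = j) f g : vfield X e (f + g) = vfield X e f + vfield X e g.
Proof. by have := vfield_lin e 1 f g; rewrite !scale1r. Qed.

End VectorFields.

(** The two outer terms have the shape of a derivation; the two mixed ones cancel in a graded
    commutator. *)
Lemma jet_vfield_leib2 (R : realType) (N : gspace R) m (X : vector_field N m) p
    (Y : vector_field N p) q (d : 'I_q -> int)
    (iota : gmap (gdom R 0 d) N) i j n (e : i + j = n)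
    (f : sect (opensT N) i) (g : sect (opensT N) j) :
  jet iota (vfield X erefl (vfield Y erefl (gmul e f g))) =
    fmul d (jet iota (vfield X erefl (vfield Y erefl f))) (jet iota g) +
    gsign R m (i + p) *: fmul d (jet iota (vfield Y erefl f)) (jet iota (vfield X erefl g)) +
    gsign R p i *: (fmul d (jet iota (vfield X erefl f)) (jet iota (vfield Y erefl g)) +
      gsign R m i *: fmul d (jet iota f) (jet iota (vfield X erefl (vfield Y erefl g)))).
Proof.
have el : i + p + j = n + p by rewrite -e addrAC.
have er : i + (j + p) = n + p by rewrite -e addrA.
rewrite (vfield_leib Y e erefl erefl erefl el er) vfieldD vfieldZ jetD jetZ.
by rewrite !jet_vfield_leib.
Qed.

Lemma grestrict_algebras (R : realType) (N : gspace R) (hN : graded_commutative_algebras N)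
    (U : opens N) : graded_commutative_algebras (grestrict U).
Proof.
split=> [V i j k e f|V i j k e g|V i j k ij jk n e1 e2 e e' f g h|V k e f|V i j k e e' f g].
- exact: (gmul_linearr hN).
- exact: (gmul_linearl hN).
- exact: (gmulA hN).
- exact: (gmul1 hN).
- exact: (gmulC hN).
Qed.

(** * The commutator of the lifts and the invariance defect *)

Section CommutingLifts.
Variables (R : realType) (M : gspace R) (hM : gmanifold M) (k l : int) (S : flow_setting M k).
Variables (D : opens (fs_MR S)) (T : vector_field (gline R k) k) (Y : vector_field M l).
Variables (Z : vector_field (grestrict D) k) (Y1 : vector_field (grestrict D) l).
Hypotheses (hT : is_coord_field T) (hZ : is_lift (endo0 M k) T Z).
Hypothesis hY1 : is_lift Y (endo0 (gline R k) l) Y1.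
Local Notation P := (fs_MR S).
Local Notation O := (image_opens (opensT (grestrict D))).

Lemma flow_field_fst i j (e : i + k = j) (f : sect (opensT M) i) :
  vfield Z e (lift1 (P := P) O f) = 0.
Proof. by rewrite (is_lift_fst hZ) /endo0 lift1E !pullT0. Qed.

Lemma flow_field_snd : vfield Z (addNr k) (lift_coord (P := P) O) = gone O.
Proof. by rewrite (is_lift_snd hZ) hT !pullT_one. Qed.

Lemma lift_field_snd j (e : - k + l = j) : vfield Y1 e (lift_coord (P := P) O) = 0.
Proof. by rewrite (is_lift_snd hY1) /endo0 !pullT0. Qed.

(* The commutator kills the pulled back sections and the coordinate of the line. *)
Lemma lifts_commute i n (e : i + l + k = n) (e' : i + k + l = n)
    (g : sect (opensT (grestrict D)) i) :
  vfield Z e (vfield Y1 erefl g) = gsign R k l *: vfield Y1 e' (vfield Z erefl g).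
Proof.
apply/eqP; rewrite -subr_eq0; apply/eqP.
apply: (restrict_jets (gprod_manifold P)) => q d iota d0.
pose K j (f : @sect R P O j) := jet iota (vfield Z erefl (vfield Y1 erefl f)) -
  gsign R k l *: jet iota (vfield Y1 erefl (vfield Z erefl f)).
have jE j (f : @sect R P O j) : jet (gcomp (gincl D) iota) f = jet iota f by exact: jet_gincl.
have hK : jet_derivation (gcomp (gincl D) iota) (k + l) K.
  split=> [j r f f'|j f|j j' p eq f f'].
  - rewrite /K !vfield_lin !jet_lin; apply/funext => c.
    rewrite !(fpsDE, fpsNE, fpsZE); ring.
  - rewrite /K [X in fhomog _ _ X]addrC -scaleNr.
    have h1 := jet_homog iota (vfield Z erefl (vfield Y1 erefl f)).
    have h2 := jet_homog iota (vfield Y1 erefl (vfield Z erefl f)).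
    apply: fhomog_lin; first by rewrite addrA.
    by rewrite [k + l]addrC addrA.
  - rewrite !jE /K !jet_vfield_leib2; apply/funext => c.
    rewrite !(fmulDl, fmulDr, fmulNl, fmulNr, fmulZl, fmulZr).
    rewrite !(fpsDE, fpsNE, fpsZE) [gsign R k (j + l)]gsignDr [gsign R l (j + k)]gsignDr.
    rewrite [gsign R (k + l) j]gsignDl [gsign R l k]gsignC.
    (* The terms with one derivative on each factor cancel because the sign of (k, l) squares to
       1. *)
    have s2 := gsign_sq R k l; set s := gsign R k l in s2 *.
    move: (gsign R k j) (gsign R l j) => u v.
    ring: s2.
have Oi : oset O (gcomp (gincl D) iota 0) by exists (iota 0).
rewrite jetB jetZ jet_vfield [X in _ - _ *: X]jet_vfield -/(K i g).
apply: (jet_derivation0 hM Oi hK) => [j f|]; rewrite /K.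
  by rewrite (is_lift_fst hY1) !flow_field_fst !vfield0 !jet0 scaler0 subrr.
(* Z t = 1, and [Y1] kills 1. The degrees -k + k and 0 agree only up to a proof, hence the general
   [j]. *)
have cz j (ej : - k + k = j) : jet iota (vfield Y1 erefl (vfield Z ej (lift_coord (P := P) O))) = 0.
  have j0 : 0 = j by rewrite -ej addNr.
  move: ej; case: j / j0 => ej; rewrite (Prop_irrelevance ej (addNr k)) flow_field_snd.
  rewrite (vfield_one Y1 (grestrict_algebras (gmanifold_algebras (gprod_manifold P)) D)).
  exact: jet0.
by rewrite lift_field_snd vfield0 jet0 cz scaler0 subr0.
Qed.

Variables (theta : gmap (grestrict D) M) (X : vector_field M k).
Hypothesis hX : vf_related theta Z X.
Variables (c : gmap M (gpoint R)) (u : gmap M (grestrict D)).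
Hypotheses (u_fst : gmap_eq (gcomp (dom_fst D) u) (gid M))
  (u_snd : gmap_eq (gcomp (dom_snd D) u) (gcomp (fs_zero S) c))
  (theta_u : gmap_eq (gcomp theta u) (gid M)).

Lemma pull_unit_fst j (f : sect (opensT M) j) : pullT u (lift1 (P := P) O f) = f.
Proof.
rewrite lift1E -!pullT_comp -[RHS]pullT_id; apply: pullT_eq.
exact: u_fst.
Qed.

Lemma pull_unit_snd : pullT u (lift_coord (P := P) O) = 0.
Proof.
rewrite lift_coordE -(pullT_comp (gincl D)) -pullT_comp (pullT_eq _ u_snd) pullT_comp.
by rewrite fs_zeroP pullT0.
Qed.

Lemma pull_unit_flow j (f : sect (opensT M) j) : pullT u (pullT theta f) = f.
Proof. by rewrite -pullT_comp (pullT_eq _ theta_u) pullT_id. Qed.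

(** Both sides are derivations along [u]. They agree on functions of [M], since [u] is a section of
    the projection, and on t, since [Y1] kills t and t vanishes along [u]. *)
Lemma pull_unit_lift i j (e : i + l = j) (g : sect (opensT (grestrict D)) i) :
  pullT u (vfield Y1 e g) = vfield Y e (pullT u g).
Proof.
apply/eqP; rewrite -subr_eq0; apply/eqP; apply: (chart_jets hM) => q d zeta d0 _.
pose K j (f : @sect R P O j) := jet (gcomp u zeta) (vfield Y1 erefl f) -
  jet zeta (vfield Y erefl (pullT u f)).
have jE j' (f : @sect R P O j') :
  jet (gcomp (gincl D) (gcomp u zeta)) f = jet (gcomp u zeta) f by exact: jet_gincl.
have hK : jet_derivation (gcomp (gincl D) (gcomp u zeta)) l K.
  split=> [j' r f f'|j' f|i' j' p eq f f'].
  - rewrite /K pullT_lin !vfield_lin !jet_lin; apply/funext => b.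
    rewrite !(fpsDE, fpsNE, fpsZE); ring.
  - rewrite /K [X in fhomog _ _ X]addrC -scaleN1r.
    by apply: fhomog_lin; exact: jet_homog.
  - rewrite !jE /K pullT_mul !jet_vfield_leib !jet_pullT; apply/funext => b.
    rewrite !(fmulDl, fmulDr, fmulNl, fmulNr, fmulZl, fmulZr) !(fpsDE, fpsNE, fpsZE); ring.
have Oi : oset O (gcomp (gincl D) (gcomp u zeta) 0) by exists (u (zeta 0)).
rewrite jetB jet_pullT jet_vfield [X in _ - X]jet_vfield -/(K i g).
apply: (jet_derivation0 hM Oi hK) => [j' f|]; rewrite /K.
  by rewrite (is_lift_fst hY1) pull_unit_fst -jet_pullT pull_unit_fst subrr.
by rewrite lift_field_snd pull_unit_snd vfield0 !jet0 subrr.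
Qed.

Lemma related_commute : vf_related theta Y1 Y -> endo_eq (bracket X Y) (endo0 M (k + l)).
Proof.
move=> hY i j e f; rewrite /endo0 -[LHS]pull_unit_flow /bracket pullTB pullTZ -hX -!hY -hX.
by rewrite (lifts_commute (bracket_degl e) (bracket_degr e)) subrr pullT0.
Qed.

(** Its value is typed as a section of the product over the image of [D], since the jet arguments
    take place in the product. *)
Definition invariance_defect j (f : sect (opensT M) j) : @sect R P O (j + l) :=
  vfield Y1 erefl (pullT theta f) - pullT theta (vfield Y erefl f).

Local Notation A := invariance_defect.

Lemma pull_unit_defect j (f : sect (opensT M) j) : pullT u (A f) = 0.
Proof. by rewrite /A pullTB pull_unit_lift !pull_unit_flow subrr. Qed.

Lemma defect_lin j (r : R) (f g : sect (opensT M) j) : A (r *: f + g) = r *: A f + A g.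
Proof.
by rewrite /A !pullT_lin !vfield_lin pullT_lin scalerBr opprD addrACA.
Qed.

Lemma defect_leib i j n (e : i + j = n) (el : i + l + j = n + l)
  (er : i + (j + l) = n + l) (f : sect (opensT M) i) (g : sect (opensT M) j) :
  A (gmul e f g) = gmul el (A f) (pullT theta g : @sect R P O j) +
    gsign R l i *: gmul er (pullT theta f : @sect R P O i) (A g).
Proof.
have PA := gmanifold_algebras (gprod_manifold P).
have Bl (x y : @sect R P O (i + l)) (z : @sect R P O j) : gmul el (x - y) z = gmul el x z - gmul el y z.
  have := gmul_linearl PA el z (-1) y x; rewrite !scaleN1r => h.
  by rewrite [X in gmul _ X _]addrC h addrC.
have Br (z : @sect R P O i) (x y : @sect R P O (j + l)) : gmul er z (x - y) = gmul er z x - gmul er z y.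
  have := gmul_linearr PA er z (-1) y x; rewrite !scaleN1r => h.
  by rewrite [X in gmul _ _ X]addrC h addrC.
rewrite /A pullT_mul (vfield_leib Y1 e erefl erefl erefl el er).
rewrite (vfield_leib Y e erefl erefl erefl el er) [X in _ - pullT _ X]addrC pullT_lin !pullT_mul.
by rewrite Bl Br scalerBr [X in _ - X]addrC opprD addrACA.
Qed.

Hypothesis XY0 : endo_eq (bracket X Y) (endo0 M (k + l)).

Lemma defect_flow j m (e : j + k = m) (e' : j + l + k = m + l) (f : sect (opensT M) j) :
  vfield Z e' (A f) = gsign R k l *: A (vfield X e f).
Proof.
case: m / e e' => e'; rewrite /A vfieldB (lifts_commute e' erefl) hX (hX e') scalerBr.
congr (_ - _).
apply: etrans (pullTZ theta (gsign R k l) (vfield Y erefl (vfield X erefl f))).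
congr (pullT theta _).
have e : j + (k + l) = j + k + l by rewrite addrA.
have /eqP := XY0 e f; rewrite /bracket /endo0 subr_eq0 => /eqP.
by rewrite (Prop_irrelevance (bracket_degl e) e') (Prop_irrelevance (bracket_degr e) erefl).
Qed.

(** Differentiation along the line maps the family of all defects [A f] to itself up to sign. If the
    family vanishes at [iota0], so do all Taylor coefficients. *)
Lemma defect_taylor q (d : 'I_q -> int) (iota iota0 : gmap (gdom R 0 d) P) (c0 : R) :
  oset O (iota 0) -> iota 0 = iota0 0 ->
  (forall j (f : sect (opensT M) j), jet iota (lift1 O f) = jet iota0 (lift1 O f)) ->
  jet iota0 (lift_coord O) = c0 *: fone ->
  (forall j (f : sect (opensT M) j), jet iota0 (A f) = 0) ->
  forall j (f : sect (opensT M) j), jet iota (A f) = 0.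
Proof.
move=> Oi i0 fst_eq snd_cst A0 j f.
have Z_lin i j' (e : i + k = j') : linear (vfield Z e : @sect R P O i -> @sect R P O j').
  by move=> r x y; exact: (vfield_lin Z e r x y).
apply: (taylor_zero hM Oi i0 fst_eq snd_cst Z_lin (@vfield_leib _ _ _ Z) flow_field_fst
  flow_field_snd) => m.
elim: m j f => [|m IH] j f; first exact: A0.
rewrite (taylor_coefS _ _ _ _ m (addrAC j l k)) (defect_flow erefl) -[X in taylor_coef _ _ _ _ _ X]addr0.
rewrite (taylor_coef_lin _ _ _ Z_lin) IH (taylor_coef0 _ _ _ Z_lin).
by rewrite scaler0 addr0 fmul0r scaler0.
Qed.

Lemma jet_lift1_fst q (d : 'I_q -> int) (iota : gmap (gdom R 0 d) P) j (f : sect (opensT M) j) :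
  oset O (iota 0) -> jet iota (lift1 O f) = jet (gcomp (gfst P) iota) f.
Proof.
move=> Oi; exact: esym (jet_near (lift1_near f Oi)).
Qed.

(** The line has a single point, so [iota] and the formal point of the zero section with the same
    projection to [M] lie over the same point, and the Taylor formula starts at t = 0. *)
Lemma defect_zero_neq0 : k != 0 -> forall j (f : sect (opensT M) j), A f = 0.
Proof.
move=> k0 j f.
apply: (@chart_jets R P (gprod_manifold P) O) => q d iota d0 Oi.
pose zeta := gcomp (gfst P) iota; pose iota0 := gcomp (gincl D) (gcomp u zeta).
have j0 i (g : @sect R P O i) : jet iota0 g = jet zeta (pullT u g).
  by rewrite jet_pullT; exact: jet_gincl.
have snd_eq (x y : gline R k) : x = y.
  have row_eq n (v w : 'rV[R]_n) : n = 0%N -> v = w by move=> n0; subst n; exact: rV0_eq.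
  by apply: row_eq; rewrite (negbTE k0).
apply: (@defect_taylor q d iota iota0 0) => //.
- apply: (product_point hM (gline_manifold R k)) => //.
  have := u_fst.1 (zeta 0); exact: esym.
- move=> i g; rewrite j0 pull_unit_fst; exact: jet_lift1_fst.
- by rewrite j0 pull_unit_snd jet0 scale0r.
- by move=> i g; rewrite j0 pull_unit_defect jet0.
Qed.

Lemma related_of_defect : (forall j (f : sect (opensT M) j), A f = 0) -> vf_related theta Y1 Y.
Proof.
by move=> A0 i j e f; case: j / e; apply/eqP; rewrite -subr_eq0; apply/eqP; exact: A0.
Qed.

End CommutingLifts.

(** * Vanishing of the defect in degree zero *)

Section DegreeZero.
Variables (R : realType) (M : gspace R) (hM : gmanifold M) (l : int) (S : flow_setting M 0).
Variables (D : opens (fs_MR S)) (T : vector_field (gline R 0) 0) (Y : vector_field M l).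
Variables (Z : vector_field (grestrict D) 0) (Y1 : vector_field (grestrict D) l).
Hypotheses (hT : is_coord_field T) (hZ : is_lift (endo0 M 0) T Z).
Hypothesis hY1 : is_lift Y (endo0 (gline R 0) l) Y1.
Variables (theta : gmap (grestrict D) M) (X : vector_field M 0).
Hypothesis hX : vf_related theta Z X.
Variables (c : gmap M (gpoint R)) (u : gmap M (grestrict D)).
Hypotheses (u_fst : gmap_eq (gcomp (dom_fst D) u) (gid M))
  (u_snd : gmap_eq (gcomp (dom_snd D) u) (gcomp (fs_zero S) c))
  (theta_u : gmap_eq (gcomp theta u) (gid M)).
Hypothesis XY0 : endo_eq (bracket X Y) (endo0 M (0 + l)).
Hypothesis hD : flow_domain D.
Local Notation P := (fs_MR S).
Local Notation O := (image_opens (opensT (grestrict D))).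
Local Notation A := (invariance_defect Y Y1 theta).

Lemma image_opensTE x : oset O x <-> oset D x.
Proof.
split=> [[y _ <-]|Dx]; first exact: set_valP.
by exists (SigSub (mem_set Dx) : grestrict D).
Qed.

(** Let t0 be the real time of [iota]. The line [kappa] through [zeta] meets the zero section at
    time 0, where the defect vanishes, and the ODE argument carries this to time t0. The fibre of
    [kappa] there differs from [iota] only in the formal part of t, which [defect_taylor] takes care
    of. *)
Lemma defect_zero_0 j (f : sect (opensT M) j) : A f = 0.
Proof.
apply: (@chart_jets R P (gprod_manifold P) O) => q d iota d0 Oi.
pose zeta := gcomp (gfst P) iota; pose t0 : R := gsnd P (iota 0) 0 0.
have [kappa [k1 k2 k3 k4]] := flow_line_exists P d0 zeta.
have Z_lin i j' (e : i + 0 = j') : linear (vfield Z e : @sect R P O i -> @sect R P O j').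
  by move=> r x y; exact: (vfield_lin Z e r x y).
have kE x t : gfst P x = zeta 0 -> gsnd P x = line_pt t -> x = kappa (line_pt t).
  move=> x1 x2; apply: (product_point hM (gline_manifold R 0)); first by rewrite k1.
  by rewrite k2.
have A_derive i (g : sect (opensT M) i) s a : oset O (kappa (line_pt s)) ->
    is_derive s 1 (fun s => cf (gpull kappa (A g)) (line_pt s) a)
      (cf (gpull kappa (A (vfield X (addr0 i) g))) (line_pt s) a).
  move=> Os; have := flow_line_derive hM k3 k4 Z_lin (@vfield_leib _ _ _ Z)
    (flow_field_fst hZ) (flow_field_snd hT hZ) (A g) a Os.
  by rewrite (defect_flow hM hT hZ hY1 hX XY0 (addr0 i)) gsign0l scale1r.
have A_zero s : oset O (kappa (line_pt s)) -> forall i (g : sect (opensT M) i),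
    cf (gpull kappa (A g)) (line_pt s) = 0.
  (* The times at which the line is in the domain form the interval that [flow_domain] attaches to
     the base point of [zeta]. *)
  have IE : [set s : R | oset O (kappa (line_pt s))] =
      [set t : R | exists x, [/\ oset D x, gfst P x = zeta 0 & gsnd P x = const_mx t]].
    apply/seteqP; split=> t /=.
      by move=> /image_opensTE Dt; exists (kappa (line_pt t)); rewrite k1 k2.
    by move=> [x [Dx x1 x2]]; apply/image_opensTE; rewrite -(kE x t).
  have [_ intI I0] := hD (zeta 0).
  rewrite -IE in intI I0.
  apply: (flow_line_zero hM (@defect_lin _ _ _ _ S D Y Y1 theta)
    (@defect_leib _ _ _ _ S D Y Y1 theta) (X := fun i g => vfield X (addr0 i) g) A_derive) => //.
  move=> i g; have [fib [fibE fibP]] := fibre_exists d (line_pt (0 : R)).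
  have <- : jet (gcomp kappa fib) (A g) = cf (gpull kappa (A g)) (line_pt 0).
    exact: fibP.
  have unitE i' (h : sect (opensT (grestrict D)) i') :
      jet (gcomp u zeta) h = jet zeta (pullT u h) by rewrite jet_pullT.
  (* Both formal points have projection [zeta] to [M] and time 0. *)
  have e : gmap_eq (gcomp kappa fib) (gcomp (gincl D) (gcomp u zeta)).
    apply: (gproduct_ext (gdom_manifold R 0 d0)).
      apply: (gmap_eq_jets hM) => [|i' h].
        by apply: etrans (k1 _) _; exact: esym (u_fst.1 (zeta 0)).
      rewrite -[LHS]jet_pullT; do 3 rewrite -[RHS]jet_pullT; rewrite -lift1E (pull_unit_fst u_fst).
      by rewrite -(k3 _ h (line_pt 0)); exact: fibP.
    apply: gline_maps_eq.
    rewrite -[LHS]jet_pullT; do 3 rewrite -[RHS]jet_pullT; rewrite -lift_coordE (pull_unit_snd u_snd) jet0.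
    have <- : cf (gpull kappa (pullT (gsnd P) (line_coord R 0))) (line_pt 0) = 0.
      by rewrite k4 mxE scale0r.
    exact: fibP.
  have Ok : oset O (gcomp kappa fib 0) by rewrite /= fibE.
  rewrite (jet_gmap_eq (A g) e Ok).
  have -> : jet (gcomp (gincl D) (gcomp u zeta)) (A g) = jet (gcomp u zeta) (A g) by exact: jet_gincl.
  by rewrite unitE (pull_unit_defect hM hY1 u_fst u_snd theta_u) jet0.
have [fib [fibE fibP]] := fibre_exists d (line_pt t0).
have i0 : iota 0 = gcomp kappa fib 0.
  by rewrite /= fibE; apply: kE => //; exact: rV1_line_pt.
have Ok : oset O (kappa (line_pt t0)) by move: Oi; rewrite i0 /= fibE.
have Oi0 : oset O (gcomp kappa fib 0) by rewrite -i0.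
apply: (defect_taylor hM hT hZ hY1 hX XY0 (c0 := t0) Oi i0).
- move=> i g; rewrite !jet_lift1_fst // -[RHS]jet_pullT -(k3 _ g (line_pt t0)).
  exact: esym (fibP _ _ (gpull kappa (pullT (gfst P) g)) 0 _).
- rewrite -(jet_near (lift_coord_near Oi0)).
  have -> : t0 *: fone = cf (gpull kappa (pullT (gsnd P) (line_coord R 0))) (line_pt t0).
    by rewrite k4 mxE.
  rewrite -(jet_near (pullT_near (gsnd P) (line_coord R 0) (gcomp kappa fib 0))).
  exact: fibP.
- move=> i g; rewrite -(A_zero t0 Ok i g); exact: fibP.
Qed.

End DegreeZero.

Theorem theorem4p4 (R : realType) (M : gspace R) (hM : gmanifold M)
    (k l : int) (X : vector_field M k) (Y : vector_field M l)
    (hXX : endo_eq (bracket X X) (endo0 M (k + k)))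
    (S : flow_setting M k) (theta : flow S) (htheta : is_flow_of theta X)
    (Y1 : vector_field (grestrict (fdom theta)) l)
    (hY1 : is_lift Y (endo0 (gline R k) l) Y1) :
  vf_related theta Y1 Y <-> endo_eq (bracket X Y) (endo0 M (k + l)).
Proof.
have [[T [Z [hT hZ hX]]] _] := htheta.
have [c [u [u_fst u_snd theta_u]]] := flow_unitP theta.
split=> [|XY0]; first exact: (related_commute hM hT hZ hY1 hX theta_u).
apply: related_of_defect => j f.
have [k0|k0] := eqVneq k 0; last first.
  exact: (defect_zero_neq0 hM hT hZ hY1 hX u_fst u_snd theta_u XY0 k0).
(* The flow is traded for its domain and its map before 0 is substituted for [k], which occurs in
   its type. *)
have hD := flow_domP theta; move: (fdom theta) (flow_map theta) hD => D th hD in Y1 hY1 Z hZ hX u u_fst u_snd theta_u *.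
clear htheta hXX theta; subst k.
exact: (defect_zero_0 hM hT hZ hY1 hX u_fst u_snd theta_u XY0 hD).
Qed.
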